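(* Let $G$ be a finitely generated group with word problem of Turing degree $\mathbf{a}$. Let $m,n\in\mathbb{N}$ and let $A\in M_{m\times n}(\mathbb{Z}G)$. The following are equivalent: 1. The $L^2$-Betti number $\dim_{\mathcal{R}G}\ker(R_A^{(2)})$ is $\mathbf{a}$-left-computable. 2. The $L^2$-Betti number $\dim_{\mathcal{R}G}\ker(R_A^{(2)})$ is $\mathbf{a}$-computable. 3. There exists a sequence $\epsilon:\mathbb{N}\to\mathbb{Q}$ of Turing degree at most $\mathbf{a}$ such that $\lim_{k\to\infty}\epsilon_k=0$ and for all $k\in\mathbb{N}_{>0}$ we have $\mu_{AA^*}\bigl((0,1/k)\bigr)\le\epsilon_k$.
   Context: Turing degrees: for $f,g:\mathbb{N}\to\mathbb{N}$, $f\le_T g$ means that $f$ is computable by a Turing machine with oracle $g$; the Turing degree of $f$ is its class under mutual reducibility. For a finite generating set $S$ of $G$, the word problem is the set of words in $S$ and formal inverses representing $e\in G$; its degree is independent of $S$. A real $r$ is $\mathbf{a}$-computable if there is a sequence $q:\mathbb{N}\to\mathbb{Q}$ of degree at most $\mathbf{a}$ with $|r-q_n|\le2^{-n}$ for all $n$; it is $\mathbf{a}$-left-computable if there is a sequence $q:\mathbb{N}\to\mathbb{Q}$ of degree at most $\mathbf{a}$ with $\lim_n q_n=r$ and $q_n\le r$ for all $n$. $\ell^2G$ is the Hilbert space of square-summable functions $G\to\mathbb{C}$; $R_A^{(2)}:(\ell^2G)^m\to(\ell^2G)^n$ is right multiplication by $A$. For a closed $G$-invariant subspace $V\subset(\ell^2G)^m$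 with orthogonal projection $P_V$, $\dim_{\mathcal{R}G}V=\sum_{i=1}^m\langle P_V(e_i),e_i\rangle$, where $e_i$ has $\delta_e$ in position $i$ and $0$ elsewhere. The involution $A\mapsto A^*$ is the transpose combined with the entrywise involution $\sum a_gg\mapsto\sum a_gg^{-1}$. The trace of a square matrix $B$ over $\mathbb{C}G$ is $\operatorname{tr}_{\mathbb{C}G}(B)=\sum_i(B_{ii})_e$, where $(\cdot)_e$ is the coefficient of the neutral element. For $\Delta=AA^*$, the spectral measure $\mu_\Delta$ is the unique Borel measure on $[0,\|R_\Delta^{(2)}\|]$ (extended by zero) with $\operatorname{tr}_{\mathbb{C}G}(p(\Delta))=\int p\,d\mu_\Delta$ for all $p\in\mathbb{R}[x]$. *)

(* Defs.v *)
From HB Require Import structures.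
From mathcomp Require Import all_boot all_order all_algebra finmap.
(* monalg must be imported before all_analysis: the other order is a clash of
   notation levels. *)
From mathcomp Require Import monalg.
From mathcomp Require Import complex.
From mathcomp Require Import all_classical all_reals all_analysis.

Set Implicit Arguments.
Unset Strict Implicit.
Unset Printing Implicit Defensive.

Import Order.TTheory GRing.Theory Num.Theory.
Import numFieldNormedType.Exports.

Local Open Scope classical_set_scope.
Local Open Scope ring_scope.

(** * Oracle Turing machines and Turing degrees *)

(* A two-way infinite tape: the cells to the left of the head, nearest first,
   and the cells from the head rightwards; all further cells are blank. *)
Definition tape (S : Type) : Type := (seq S * seq S)%type.

Inductive head_move := MoveLeft | NoMove | MoveRight.

Definition tape_read (S : Type) (blank : S) (t : tape S) : S := head blank t.2.

Definition tape_write (S : Type) (s : S) (t : tape S) : tape S :=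
  (t.1, s :: behead t.2).

Definition tape_move (S : Type) (blank : S) (d : head_move) (t : tape S) :
    tape S :=
  match d with
  | MoveLeft => (behead t.1, head blank t.1 :: t.2)
  | NoMove => t
  | MoveRight => (head blank t.2 :: t.1, behead t.2)
  end.

(* Numbers are written on tapes in unary. The value of a tape is the number of
   consecutive strokes from the head rightwards. *)
Definition unary_tape (S : Type) (stroke : S) (n : nat) : tape S :=
  ([::], nseq n stroke).

Definition tape_value (S : eqType) (stroke : S) (t : tape S) : nat :=
  find (predC1 stroke) t.2.

(* In the state tm_query, the machine does not follow tm_trans: the oracle
   tape, of value n, is replaced by the tape that holds the value of the oracle
   at n, and the machine goes to the state tm_answer. *)
Record oracle_tm := OracleTM {
  tm_state : finType;
  tm_tape : finType;
  tm_symbol : finType;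
  tm_blank : tm_symbol;
  tm_stroke : tm_symbol;
  tm_blank_stroke : tm_blank != tm_stroke;
  tm_start : tm_state;
  tm_halt : tm_state;
  tm_query : tm_state;
  tm_answer : tm_state;
  tm_io : tm_tape;
  tm_oracle : tm_tape;
  tm_trans : tm_state -> {ffun tm_tape -> tm_symbol} ->
    tm_state * (tm_tape -> tm_symbol * head_move)
}.

Definition tm_config (M : oracle_tm) : Type :=
  (tm_state M * {ffun tm_tape M -> tape (tm_symbol M)})%type.

Definition tm_init (M : oracle_tm) (x : nat) : tm_config M :=
  (tm_start M,
   [ffun k => if k == tm_io M then unary_tape (tm_stroke M) x
              else ([::], [::])]).

Definition tm_step (M : oracle_tm) (g : nat -> nat) (c : tm_config M) :
    tm_config M :=
  let: (q, t) := c in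
  if q == tm_halt M then c
  else if q == tm_query M then
    (tm_answer M,
     [ffun k => if k == tm_oracle M
                then unary_tape (tm_stroke M)
                       (g (tape_value (tm_stroke M) (t (tm_oracle M))))
                else t k])
  else
    let: (q', act) :=
      tm_trans q [ffun k => tape_read (tm_blank M) (t k)] in
    (q', [ffun k => tape_move (tm_blank M) (act k).2
                      (tape_write (act k).1 (t k))]).

Definition tm_computes (M : oracle_tm) (g f : nat -> nat) : Prop :=
  forall x, exists i, let c := iter i (tm_step g) (tm_init M x) in
    c.1 = tm_halt M /\ tape_value (tm_stroke M) (c.2 (tm_io M)) = f x.

Definition turing_le (f g : nat -> nat) : Prop :=
  exists M : oracle_tm, tm_computes M g f.

Definition turing_degree (g : nat -> nat) : set (nat -> nat) :=
  [set f | turing_le f g /\ turing_le g f].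

Definition degree_at_most (a : set (nat -> nat)) (f : nat -> nat) : Prop :=
  exists2 g, a g & turing_le f g.

Definition rat_code (q : rat) : nat :=
  CodeSeq.code [:: nat_of_bool (numq q < 0); `|numq q|%N; `|denq q|%N].

Definition rat_seq_degree_at_most (a : set (nat -> nat)) (q : nat -> rat) :
    Prop :=
  degree_at_most a (fun n => rat_code (q n)).

Definition computable_real (R : realType) (a : set (nat -> nat)) (r : R) :
    Prop :=
  exists2 q : nat -> rat, rat_seq_degree_at_most a q &
    forall n, `|r - ratr (q n)| <= 2 ^- n.

Definition left_computable_real (R : realType) (a : set (nat -> nat)) (r : R) :
    Prop :=
  exists2 q : nat -> rat, rat_seq_degree_at_most a q &
    ((fun n => ratr (q n) : R) @ \oo --> r) /\ (forall n, ratr (q n) <= r).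

(** * The word problem *)

(* The letter (i, b) stands for the i-th generator if b is false, and for its
   formal inverse if b is true. *)
Definition word (k : nat) : Type := seq ('I_k * bool).

Definition word_eval (G : groupType) (k : nat) (s : 'I_k -> G) (w : word k) :
    G :=
  foldr (fun l g => ((if l.2 then (s l.1)^-1 else s l.1) * g)%g) 1%g w.

Definition generates (G : groupType) (k : nat) (s : 'I_k -> G) : Prop :=
  forall g, exists w, word_eval s w = g.

Definition word_code (k : nat) (w : word k) : nat :=
  CodeSeq.code [seq ((nat_of_ord l.1).*2 + nat_of_bool l.2)%N | l <- w].

(* Characteristic function of the set of codes of words that represent 1. *)
Definition word_problem (G : groupType) (k : nat) (s : 'I_k -> G) (x : nat) :
    nat :=
  `[< exists2 w : word k, word_code w = x & word_eval s w = 1%g >].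

(** * Group rings *)

(* monalg only puts a ring structure on {malg K[M]} when M is a monoid in which
   1 is the only unit; grpalg K G is the same additive group for a group G,
   with the convolution product. *)
Definition grpalg (K : nzRingType) (G : groupType) : Type := {malg K[G]}.

HB.instance Definition _ (K : nzRingType) (G : groupType) :=
  GRing.Zmodule.copy (grpalg K G) {malg K[G]}.

Section GroupRing.
Variables (K : nzRingType) (G : groupType).
Implicit Types (a b c : {malg K[G]}) (x y : K) (g h : G).
Local Open Scope fset_scope.

Definition gr_one : {malg K[G]} := << 1 *g 1%g >>.

Definition gr_mul a b : {malg K[G]} :=
  \sum_(g <- msupp a) \sum_(h <- msupp b) << a@_g * b@_h *g (g * h)%g >>.

Lemma gr_mulw (d1 d2 : {fset G}) a b :
  msupp a `<=` d1 -> msupp b `<=` d2 ->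
  gr_mul a b =
  \sum_(g <- d1) \sum_(h <- d2) << a@_g * b@_h *g (g * h)%g >>.
Proof.
move=> le_d1 le_d2; rewrite /gr_mul (big_fset_incl _ le_d1) /=.
  apply/eq_bigr => g _; apply/big_fset_incl => // h _ /mcoeff_outdom ->.
  by rewrite mulr0 monalgU0.
move=> g _ /mcoeff_outdom ag.
by rewrite big1 => // h _; rewrite ag mul0r monalgU0.
Qed.

Lemma gr_mulDl : left_distributive gr_mul +%R.
Proof.
move=> a b c.
rewrite [in RHS](gr_mulw (fsubsetUl _ (msupp b)) (fsubset_refl _)).
rewrite [in RHS](gr_mulw (fsubsetUr (msupp a) _) (fsubset_refl _)).
rewrite (gr_mulw (msuppD_le _ _) (fsubset_refl _)).
rewrite -big_split /=; apply/eq_bigr => g _.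
rewrite -big_split /=; apply/eq_bigr => h _.
by rewrite mcoeffD mulrDl monalgUD.
Qed.

Lemma gr_mulDr : right_distributive gr_mul +%R.
Proof.
move=> a b c.
rewrite [in RHS](gr_mulw (fsubset_refl _) (fsubsetUl _ (msupp c))).
rewrite [in RHS](gr_mulw (fsubset_refl _) (fsubsetUr (msupp b) _)).
rewrite (gr_mulw (fsubset_refl _) (msuppD_le _ _)).
rewrite -big_split /=; apply/eq_bigr => g _.
rewrite -big_split /=; apply/eq_bigr => h _.
by rewrite mcoeffD mulrDr monalgUD.
Qed.

Lemma gr_mul0l : left_zero 0 gr_mul.
Proof. by move=> a; rewrite /gr_mul msupp0 big_seq_fset0. Qed.

Lemma gr_mul0r : right_zero 0 gr_mul.
Proof.
by move=> a; rewrite /gr_mul big1 // => g _; rewrite msupp0 big_seq_fset0.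
Qed.

Lemma gr_mulUU x y g h :
  gr_mul << x *g g >> << y *g h >> = << x * y *g (g * h)%g >>.
Proof. by rewrite (gr_mulw msuppU_le msuppU_le) !big_seq_fset1 !mcoeffUU. Qed.

Lemma gr_mul_suml (I : Type) (r : seq I) (F : I -> {malg K[G]}) b :
  gr_mul (\sum_(i <- r) F i) b = \sum_(i <- r) gr_mul (F i) b.
Proof.
exact: (big_morph (gr_mul^~ b) (fun _ _ => gr_mulDl _ _ _) (gr_mul0l _)).
Qed.

Lemma gr_mul_sumr (I : Type) (r : seq I) (F : I -> {malg K[G]}) a :
  gr_mul a (\sum_(i <- r) F i) = \sum_(i <- r) gr_mul a (F i).
Proof.
exact: (big_morph (gr_mul a) (fun _ _ => gr_mulDr _ _ _) (gr_mul0r _)).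
Qed.

Lemma gr_mul1l : left_id gr_one gr_mul.
Proof.
move=> a; rewrite [in LHS](monalgE a) gr_mul_sumr [RHS]monalgE.
by apply/eq_bigr => g _; rewrite gr_mulUU mul1r mul1g.
Qed.

Lemma gr_mul1r : right_id gr_one gr_mul.
Proof.
move=> a; rewrite [in LHS](monalgE a) gr_mul_suml [RHS]monalgE.
by apply/eq_bigr => g _; rewrite gr_mulUU mulr1 mulg1.
Qed.

Lemma gr_mulA : associative gr_mul.
Proof.
move=> a b c; rewrite (monalgE a) !gr_mul_suml; apply/eq_bigr => g _.
rewrite (monalgE b) gr_mul_sumr !gr_mul_suml gr_mul_sumr.
apply/eq_bigr => h _; rewrite (monalgE c) !gr_mul_sumr.
by apply/eq_bigr => l _; rewrite !gr_mulUU mulrA mulgA.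
Qed.

Lemma gr_one_neq0 : gr_one != 0.
Proof. by rewrite monalgU_eq0 oner_eq0. Qed.

HB.instance Definition _ := GRing.Zmodule_isNzRing.Build (grpalg K G)
  gr_mulA gr_mul1l gr_mul1r gr_mulDl gr_mulDr gr_one_neq0.

End GroupRing.

Definition gr_const (K : nzRingType) (G : groupType) (x : K) : grpalg K G :=
  << x *g 1%g >>.

Definition gr_map (K L : nzRingType) (G : groupType) (f : K -> L)
    (a : grpalg K G) : grpalg L G :=
  \sum_(g <- msupp a) << f a@_g *g g >>.

Definition gr_inv (K : nzRingType) (G : groupType) (a : grpalg K G) :
    grpalg K G :=
  \sum_(g <- msupp a) << a@_g *g (g^-1)%g >>.

Definition gr_adj (K : nzRingType) (G : groupType) (m n : nat)
    (A : 'M[grpalg K G]_(m, n)) : 'M[grpalg K G]_(n, m) :=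
  (map_mx (@gr_inv K G) A)^T.

Definition gr_trace (K : nzRingType) (G : groupType) (m : nat)
    (B : 'M[grpalg K G]_m) : K :=
  \sum_(i < m) (B i i)@_(1%g).

Definition gr_horner (K : nzRingType) (G : groupType) (m : nat) (p : {poly K})
    (B : 'M[grpalg K G]_m) : 'M[grpalg K G]_m :=
  \sum_(i < size p) gr_const G p`_i *: B ^+ i.

(** * The Hilbert space of square-summable functions *)

(* (l^2 G)^m is the set of the x : l2vec R G m such that l2 x. *)
Definition l2vec (R : realType) (G : groupType) (m : nat) : Type :=
  'I_m -> G -> R[i].

Definition l2sq (R : realType) (G : groupType) (m : nat) (x : l2vec R G m) :
    \bar R :=
  (\sum_(i < m) \esum_(g in [set: G]) (complex.Re (`|x i g| ^+ 2))%:E)%E.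

Definition l2 (R : realType) (G : groupType) (m : nat) : set (l2vec R G m) :=
  [set x | (l2sq x < +oo)%E].

Definition l2norm (R : realType) (G : groupType) (m : nat) (x : l2vec R G m) :
    R :=
  Num.sqrt (fine (l2sq x)).

(* Sums of absolutely summable families. *)
Definition real_sum (R : realType) (T : choiceType) (f : T -> R) : R :=
  fine (\esum_(t in [set: T]) (Num.max (f t) 0)%:E) -
  fine (\esum_(t in [set: T]) (Num.max (- f t) 0)%:E).

Definition complex_sum (R : realType) (T : choiceType) (f : T -> R[i]) : R[i] :=
  Complex (real_sum (fun t => complex.Re (f t)))
          (real_sum (fun t => complex.Im (f t))).

Definition l2inner (R : realType) (G : groupType) (m : nat)
    (x y : l2vec R G m) : R[i] :=
  \sum_(i < m) complex_sum (fun g => x i g * (y i g)^*%C).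

Definition l2basis (R : realType) (G : groupType) (m : nat) (i : 'I_m) :
    l2vec R G m :=
  fun j g => ((j == i) && (g == 1%g))%:R.

Arguments l2basis R G {m} i.

Definition is_orth_proj (R : realType) (G : groupType) (m : nat)
    (V : set (l2vec R G m)) (x y : l2vec R G m) : Prop :=
  V y /\ forall v, V v -> l2inner (fun i g => x i g - y i g) v = 0.

Definition orth_proj (R : realType) (G : groupType) (m : nat)
    (V : set (l2vec R G m)) (x : l2vec R G m) : l2vec R G m :=
  xget (fun _ _ => 0) [set y | is_orth_proj V x y].

(* Each <P_V e_i, e_i> is real, because an orthogonal projection is positive. *)
Definition vn_dim (R : realType) (G : groupType) (m : nat)
    (V : set (l2vec R G m)) : R :=
  complex.Re (\sum_(i < m) l2inner (orth_proj V (l2basis R G i)) (l2basis R G i)).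

(* x * A, where (x_i * a)(g) = \sum_h x_i(g h^-1) a(h) for a in the group ring *)
Definition l2_mulmx (R : realType) (G : groupType) (m n : nat)
    (A : 'M[grpalg R[i] G]_(m, n)) (x : l2vec R G m) : l2vec R G n :=
  fun j g =>
    \sum_(i < m) \sum_(h <- msupp (A i j)) x i (g * h^-1)%g * (A i j)@_h.

Definition gr_complex (R : realType) (G : groupType) (m n : nat)
    (A : 'M[grpalg int G]_(m, n)) : 'M[grpalg R[i] G]_(m, n) :=
  map_mx (gr_map (fun z : int => z%:~R)) A.

Definition l2_ker (R : realType) (G : groupType) (m n : nat)
    (A : 'M[grpalg R[i] G]_(m, n)) : set (l2vec R G m) :=
  [set x | l2 x /\ l2_mulmx A x = (fun _ _ => 0)].

Definition l2_opnorm (R : realType) (G : groupType) (m n : nat)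
    (A : 'M[grpalg R[i] G]_(m, n)) : R :=
  sup [set l2norm (l2_mulmx A x) | x in [set x | l2 x /\ l2norm x <= 1]].

Definition l2_betti (R : realType) (G : groupType) (m n : nat)
    (A : 'M[grpalg int G]_(m, n)) : R :=
  vn_dim (l2_ker (gr_complex R A)).

Definition is_spectral_measure (R : realType) (G : groupType) (m : nat)
    (D : 'M[grpalg R[i] G]_m)
    (mu : {measure set (measurableTypeR R) -> \bar R}) : Prop :=
  mu (~` `[0, l2_opnorm D]) = 0%E /\
  forall p : {poly R},
    mu.-integrable [set: R] (fun x => (p.[x])%:E) /\
    gr_trace (gr_horner (map_poly (fun x => x%:C%C) p) D) =
      (\int[mu]_x p.[x])%:C%C.

(* Main.v *)
Require Import Defs.
From mathcomp Require Import all_boot all_order all_algebra finmap.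
From mathcomp Require Import monalg.
From mathcomp Require Import complex.
From mathcomp Require Import all_classical all_reals all_analysis.
From mathcomp Require Import measurable_realfun.
From mathcomp Require Import zify ring lra.

Set Implicit Arguments.
Unset Strict Implicit.
Unset Printing Implicit Defensive.

Import Order.TTheory GRing.Theory Num.Theory.
Import numFieldNormedType.Exports.

(** Let [r] be the Betti number, [mu] the spectral measure and [B = A A^*]. Fix
    a natural number [K >= 2] that is at least the norm of [B]. The numbers
    [u a = tr ((K - B) ^ a) / K ^ a] are the integrals of [(1 - x / K) ^ a], and
    the proof rests on three facts about them.

    They are rational numbers that are computable from the word problem
    ([rat_computable_trace_expr]): write [K - B] as a sum of signed words; the
    trace of a power counts, with signs, the closed paths of words whose
    product represents the neutral element.

    They converge to [mu {0} = r]. On the side of the measure, this is the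
    convergence of the integrands. On the side of the Hilbert space, the rows of
    [(K - B) ^ a / K ^ a] are bounded and converge pointwise, hence weakly, and
    their limits are the orthogonal projections of the basis vectors onto the
    kernel ([l2_betti_shifted_trace]). All norms that occur are traces
    [tr (X X^* )], so they are expressed by the numbers [u a] again.

    The distance from [u a] to [r] is tied to the mass of the gap ]0, 1/j[ by
    two elementary estimates of [(1 - x / K) ^ a] ([gap_lower] and
    [gap_upper]): the mass of the gap is at most [2 * (u j - r)], and
    [u a - r] is at most the mass of the gap plus [u 0 / j] when
    [a >= j * j * K].

    So [r] is always the limit of computable upper bounds, and each of the three
    conditions provides the missing lower bounds. If lower bounds are given,
    then a search finds an upper bound that is close to one of them
    ([left_computable_computable]). If [r] is computable, then so is a bound for
    [2 * (u j - r)], hence for the mass of the gap ([computable_gap]). And if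
    that mass is controlled, then the control and [u 0 / j] can be subtracted
    from [u a] ([gap_left_computable]).

    Computability is treated by an intermediate notion: [computable g f] says
    that [f] is computed from the oracle [g] by a program with counters and
    loops. It agrees with computability by oracle machines ([turing_leP]), as
    such programs compile to machines, and the configurations of a machine can
    be coded by numbers in such a way that its steps are computed by programs.
    Because it is closed under composition, iteration and search, the
    algorithms above need no further programming. *)

(** * Loop programs on counters, and their compilation to oracle machines *)

Definition upd (st : nat -> nat) (r v : nat) : nat -> nat :=
  fun x => if x == r then v else st x.

(** [Loop r c] runs [c] as long as register [r] is positive, and decrements
    [r] before each pass. [Query] replaces the content of register 0 by the
    value of the oracle at it. *)
Inductive cmd :=
  Skip | Inc of nat | Dec of nat | Query | Seq of cmd & cmd | Loop of nat & cmd.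

Inductive exec (g : nat -> nat) : cmd -> (nat -> nat) -> (nat -> nat) -> Prop :=
| exec_skip st : exec g Skip st st
| exec_inc st r : exec g (Inc r) st (upd st r (st r).+1)
| exec_dec st r : exec g (Dec r) st (upd st r (st r).-1)
| exec_query st : exec g Query st (upd st 0 (g (st 0)))
| exec_seq c d st1 st2 st3 :
    exec g c st1 st2 -> exec g d st2 st3 -> exec g (Seq c d) st1 st3
| exec_loop0 r c st : st r = 0 -> exec g (Loop r c) st st
| exec_loopS r c st1 st2 st3 : 0 < st1 r ->
    exec g c (upd st1 r (st1 r).-1) st2 -> exec g (Loop r c) st2 st3 ->
    exec g (Loop r c) st1 st3.

Inductive instr := IInc of nat | IDec of nat & nat | IGoto of nat | IQuery.

Fixpoint csize (c : cmd) : nat :=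
  match c with
  | Skip => 0
  | Inc _ | Dec _ | Query => 1
  | Seq c d => csize c + csize d
  | Loop _ c => (csize c).+2
  end.

(** Code for [c] placed at address [p]. [IDec r l] jumps to [l] if register [r]
    is 0, and decrements it and falls through otherwise. *)
Fixpoint compile (c : cmd) (p : nat) : seq instr :=
  match c with
  | Skip => [::]
  | Inc r => [:: IInc r]
  | Dec r => [:: IDec r p.+1]
  | Query => [:: IQuery]
  | Seq c d => compile c p ++ compile d (p + csize c)
  | Loop r c => IDec r (p + (csize c).+2) :: rcons (compile c p.+1) (IGoto p)
  end.

Fixpoint creg (c : cmd) : nat :=
  match c with
  | Skip | Query => 0
  | Inc r | Dec r => r
  | Seq c d => maxn (creg c) (creg d)
  | Loop r c => maxn r (creg c)
  end.

Lemma size_compile c p : size (compile c p) = csize c.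
Proof.
elim: c p => //= [c IHc d IHd|r c IHc] p; first by rewrite size_cat IHc IHd.
by rewrite size_rcons IHc.
Qed.

Section Machine.
Variables (g : nat -> nat) (code : seq instr) (N io : nat).

Let L := size code.
Let symbol := option (option 'I_L.+1).
Let blank : symbol := None.
Let stroke : symbol := Some None.
Let ret (l : nat) : symbol := Some (Some (inord l)).
Let mstate := option (option ('I_L.+1 * bool)).
Let lab (b : bool) (l : nat) : mstate := Some (Some (inord l, b)).
Let mtape := option 'I_N.+1.
Let reg (r : nat) : mtape := Some (inord r).

(** All machines have one state in which queries are answered, so that the
    address at which the run goes on after a query is first written on the
    tape [None]. A counter is incremented in two moves, to the left and on the
    spot; the boolean in the state separates them. *)
Definition counter_trans (q : mstate) (rd : {ffun mtape -> symbol}) :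
    mstate * (mtape -> symbol * head_move) :=
  let keep (k : mtape) := (rd k, NoMove) in
  let act (k0 : mtape) (a : symbol * head_move) k :=
    if k == k0 then a else keep k in
  match q with
  | None => (None, keep)
  | Some None =>
      (if rd None is Some (Some l) then Some (Some (l, false)) else None, keep)
  | Some (Some (p, second)) =>
      match nth (IGoto 0) code p with
      | IInc r =>
          if second then (lab false p.+1, act (reg r) (stroke, NoMove))
          else (lab true p, act (reg r) (rd (reg r), MoveLeft))
      | IDec r l =>
          if rd (reg r) == stroke
          then (lab false p.+1, act (reg r) (blank, MoveRight))
          else (lab false l, keep)
      | IGoto l => (lab false l, keep)
      | IQuery => (None, act None (ret p.+1, NoMove))
      end
  end.

Lemma blank_neq_stroke : blank != stroke. Proof. by []. Qed.

Definition counter_tm : oracle_tm :=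
  OracleTM blank_neq_stroke (lab false 0) (lab false L) None (Some None)
    (reg io) (reg 0) counter_trans.

(** Counters are blocks of strokes that start at the head. A machine never
    gives cells back, so blanks pile up on both sides of the block. *)
Let holds (n : nat) (t : tape symbol) : Prop :=
  exists i j, t = (nseq i blank, nseq n stroke ++ nseq j blank).

Let matches (p : nat) (st : nat -> nat) (c : tm_config counter_tm) : Prop :=
  c.1 = lab false p /\ forall r, r <= N -> holds (st r) (c.2 (reg r)).

Lemma holds_keep n t :
  holds n t -> holds n (tape_write (tape_read blank t) t).
Proof.
case=> i [j ->]; rewrite /tape_write /tape_read /=; case: n => [|n] /=.
  by case: j => [|j]; [exists i, 1 | exists i, j.+1].
by exists i, j.
Qed.

Lemma holds_read n t : holds n t -> (tape_read blank t == stroke) = (0 < n).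
Proof. by case=> i [j ->]; case: n => // ; case: j. Qed.

Lemma holds_dec n t : holds n.+1 t ->
  holds n (tape_move blank MoveRight (tape_write blank t)).
Proof. by case=> i [j ->]; exists i.+1, j. Qed.

Lemma holds_inc n t : holds n t ->
  holds n.+1
    (tape_write stroke
       (tape_move blank MoveLeft (tape_write (tape_read blank t) t))).
Proof.
move/holds_keep=> [i [j]]; rewrite /tape_write => -> /=.
by exists i.-1, j; case: i.
Qed.

Lemma holds_value n t : holds n t -> tape_value stroke t = n.
Proof.
case=> i [j ->]; rewrite /tape_value /=; elim: n => [|n IHn] /=; last by rewrite IHn.
by case: j.
Qed.

Lemma lab_neq_halt p b : p < L -> (lab b p == lab false L) = false.
Proof.
move=> ltp; apply/negbTE/eqP => -[/(congr1 val)/=].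
by rewrite !inordK //; lia.
Qed.

Lemma reg_inj r1 r2 : r1 <= N -> r2 <= N -> (reg r1 == reg r2) = (r1 == r2).
Proof.
move=> le1 le2; apply/eqP/eqP => [[/(congr1 val)/=]|-> //].
by rewrite !inordK.
Qed.

Let reach (c c' : tm_config counter_tm) := exists i, iter i (tm_step g) c = c'.

Lemma reach_trans c1 c2 c3 : reach c1 c2 -> reach c2 c3 -> reach c1 c3.
Proof. by case=> i <- [j <-]; exists (j + i); rewrite iterD. Qed.

Lemma tm_step_at (p : nat) (b : bool) (T : {ffun mtape -> tape symbol}) :
    p < L ->
  tm_step g ((lab b p, T) : tm_config counter_tm) =
  let: (q', act) := counter_trans (lab b p) [ffun k => tape_read blank (T k)] in
  (q', [ffun k => tape_move blank (act k).2 (tape_write (act k).1 (T k))]).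
Proof. by move=> ltp; rewrite /tm_step lab_neq_halt. Qed.

Lemma step_goto p l st c : p < L -> nth (IGoto 0) code p = IGoto l ->
  matches p st c -> exists2 c', reach c c' & matches l st c'.
Proof.
case: c => q T /= ltp code_p [/= -> mT].
exists (tm_step g ((lab false p, T) : tm_config counter_tm)); first by exists 1.
rewrite tm_step_at // /counter_trans /lab /= inordK ?code_p; last by lia.
split=> // r ler; rewrite !ffunE; exact/holds_keep/mT.
Qed.

Lemma step_dec p r l st c : p < L -> r <= N ->
    nth (IGoto 0) code p = IDec r l -> matches p st c ->
  exists2 c', reach c c' &
    if st r == 0 then matches l st c' else matches p.+1 (upd st r (st r).-1) c'.
Proof.
case: c => q T /= ltp ler code_p [/= -> mT].
exists (tm_step g ((lab false p, T) : tm_config counter_tm)); first by exists 1.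
rewrite tm_step_at // /counter_trans /lab /= inordK ?code_p; last by lia.
rewrite ffunE (holds_read (mT r ler)); case: (st r) (mT r ler) => [|n] hr /=.
  by split=> // r' ler'; rewrite !ffunE; exact/holds_keep/mT.
split=> // r' ler'; rewrite !ffunE /= reg_inj // /upd.
by case: eqP => [->|_]; [exact: holds_dec | exact/holds_keep/mT].
Qed.

Lemma step_inc p r st c : p < L -> r <= N ->
    nth (IGoto 0) code p = IInc r -> matches p st c ->
  exists2 c', reach c c' & matches p.+1 (upd st r (st r).+1) c'.
Proof.
case: c => q T /= ltp ler code_p [/= -> mT].
exists (tm_step g (tm_step g ((lab false p, T) : tm_config counter_tm))).
  by exists 2.
rewrite (tm_step_at false T ltp) /counter_trans /lab /= inordK ?code_p; last by lia.
rewrite (tm_step_at true _ ltp) /counter_trans /lab /= inordK ?code_p; last by lia.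
split=> // r' ler'; rewrite !ffunE /= reg_inj // /upd.
case: eqP => [-> | _]; first by apply: holds_inc; exact: mT.
by do 2 apply: holds_keep; exact: mT.
Qed.

Lemma step_query p st c : p < L ->
    nth (IGoto 0) code p = IQuery -> matches p st c ->
  exists2 c', reach c c' & matches p.+1 (upd st 0 (g (st 0))) c'.
Proof.
case: c => q T /= ltp code_p [/= -> mT].
exists (tm_step g (tm_step g (tm_step g
         ((lab false p, T) : tm_config counter_tm)))); first by exists 3.
rewrite (tm_step_at false T ltp) /counter_trans /lab /= inordK ?code_p; last by lia.
rewrite {2}/tm_step /= /tm_step /= ffunE /=.
split=> [|r ler]; first by rewrite !ffunE.
rewrite !ffunE /= reg_inj // /upd; case: eqP => [_|ne] /=.
  rewrite (holds_value (holds_keep (mT 0 isT))); apply: holds_keep.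
  by exists 0, 0; rewrite cats0.
by do 2 apply: holds_keep; exact: mT.
Qed.

(** Induction on the run of [c], for all places of its code in the program: a
    loop re-enters its own code through the final jump. *)
Lemma compile_correct c st st' p cf pre post : exec g c st st' ->
    code = pre ++ compile c p ++ post -> size pre = p -> creg c <= N ->
    matches p st cf ->
  exists2 cf', reach cf cf' & matches (p + csize c) st' cf'.
Proof.
move=> ex; elim: ex p cf pre post => {c st st'} [st|st r|st r|st
  |c d st1 st2 st3 _ IH1 _ IH2|r c st st0|r c st1 st2 st3 st1r _ IH1 _ IH2] p cf
  pre post codeE sz_pre /= hreg m.
- by exists cf; [exists 0 | rewrite addn0].
- rewrite addn1; apply: step_inc => //; rewrite /L codeE -sz_pre.
    by rewrite !size_cat /=; lia.
  by rewrite nth_cat ltnn subnn.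
- have hp : p < L by rewrite /L codeE -sz_pre !size_cat /=; lia.
  have hn : nth (IGoto 0) code p = IDec r p.+1.
    by rewrite codeE -sz_pre nth_cat ltnn subnn.
  have [cf' rch m'] := step_dec hp hreg hn m; rewrite addn1; exists cf' => //.
  case: eqP m' => // st0 m'; rewrite [upd _ _ _](_ : _ = st) //.
  by apply/funext => x; rewrite /upd st0; case: eqP => // ->.
- rewrite addn1; apply: step_query => //; rewrite /L codeE -sz_pre.
    by rewrite !size_cat /=; lia.
  by rewrite nth_cat ltnn subnn.
- rewrite geq_max in hreg; case/andP: hreg => hc hd.
  have [|cf1 r1 m1] := IH1 p cf pre (compile d (p + csize c) ++ post) _ sz_pre hc m.
    by rewrite codeE /= -!catA.
  have [||cf2 r2 m2] :=
      IH2 (p + csize c) cf1 (pre ++ compile c p) post _ _ hd m1.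
  + by rewrite codeE /= -!catA.
  + by rewrite size_cat size_compile sz_pre.
  by exists cf2; [exact: reach_trans r2 | rewrite addnA].
- rewrite geq_max in hreg; case/andP: hreg => hr _.
  have hp : p < L by rewrite /L codeE -sz_pre !size_cat /=; lia.
  have hn : nth (IGoto 0) code p = IDec r (p + (csize c).+2).
    by rewrite codeE -sz_pre nth_cat ltnn subnn.
  have [cf' rch] := step_dec hp hr hn m; rewrite st0 /= => m'.
  by exists cf'.
have := hreg; rewrite geq_max => /andP[hr hc].
have hp : p < L by rewrite /L codeE -sz_pre !size_cat /=; lia.
have hn : nth (IGoto 0) code p = IDec r (p + (csize c).+2).
  by rewrite codeE -sz_pre nth_cat ltnn subnn.
have [cf1 r1] := step_dec hp hr hn m; rewrite eqn0Ngt st1r /= => m1.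
have [||cf2 r2 m2] := IH1 p.+1 cf1 (rcons pre (IDec r (p + (csize c).+2)))
  (IGoto p :: post) _ _ hc m1.
- by rewrite codeE /= -cats1 -cats1 -!catA.
- by rewrite size_rcons sz_pre.
have hp2 : p.+1 + csize c < L.
  rewrite /L codeE -sz_pre !size_cat /= size_rcons size_compile; lia.
have hn2 : nth (IGoto 0) code (p.+1 + csize c) = IGoto p.
  rewrite codeE -sz_pre nth_cat ifN; last by lia.
  rewrite (_ : _ - _ = (csize c).+1) /=; last by lia.
  by rewrite nth_cat size_rcons size_compile ltnSn nth_rcons size_compile ltnn eqxx.
have [cf3 r3 m3] := step_goto hp2 hn2 m2.
have [cf4 r4 m4] := IH2 p cf3 pre post codeE sz_pre hreg m3.
by exists cf4 => //; do 3 (apply: reach_trans; first by eassumption).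
Qed.

Lemma matches_init x : io <= N ->
  matches 0 (upd (fun=> 0) io x) (tm_init counter_tm x).
Proof.
move=> leio; split=> // r ler; rewrite /= ffunE reg_inj // /upd.
by case: eqP => _; [exists 0, 0; rewrite cats0 | exists 0, 0].
Qed.

End Machine.

(** Oracle machines are built only here: from now on it suffices to write loop
    programs. *)
Lemma exec_turing_le (f g : nat -> nat) (c : cmd) (io : nat) :
    (forall x, exists2 st, exec g c (upd (fun=> 0) io x) st & st io = f x) ->
  turing_le f g.
Proof.
move=> cf; pose N := maxn io (creg c).
exists (counter_tm (compile c 0) N io) => x.
have leio : io <= N by rewrite leq_maxl.
have [st ex stE] := cf x.
have [|||cf' [i iE] [hq hT]] := @compile_correct g (compile c 0) N io c _ _ 0
  _ [::] [::] ex _ _ _ (matches_init (compile c 0) x leio).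
- by rewrite cats0.
- by [].
- by rewrite leq_maxr.
exists i; rewrite iE; split.
  by rewrite hq /= add0n -(size_compile c 0).
by rewrite -stE; exact/holds_value/hT.
Qed.

(** * Functions computable from an oracle *)

(** The coding of lists of numbers by numbers is a bijection, so that every
    number is a list of numbers. The list operations on codes thus are total,
    and they also serve as a pairing; this one data type is enough below. *)
Definition lcons (a b : nat) : nat := 2 ^ a * b.*2.+1.
Definition hd (x : nat) : nat := head 0 (CodeSeq.decode x).
Definition tl (x : nat) : nat := CodeSeq.code (behead (CodeSeq.decode x)).

Lemma code_cons a s : CodeSeq.code (a :: s) = lcons a (CodeSeq.code s).
Proof. by []. Qed.

Lemma hd_code s : hd (CodeSeq.code s) = head 0 s.
Proof. by rewrite /hd CodeSeq.codeK. Qed.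

Lemma tl_code s : tl (CodeSeq.code s) = CodeSeq.code (behead s).
Proof. by rewrite /tl CodeSeq.codeK. Qed.

Lemma hd_lcons a b : hd (lcons a b) = a.
Proof. by have := hd_code (a :: CodeSeq.decode b); rewrite code_cons CodeSeq.decodeK. Qed.

Lemma tl_lcons a b : tl (lcons a b) = b.
Proof. by have := tl_code (a :: CodeSeq.decode b); rewrite code_cons CodeSeq.decodeK. Qed.

Lemma lcons_hd_tl x : 0 < x -> lcons (hd x) (tl x) = x.
Proof.
rewrite -[x]CodeSeq.decodeK; case: (CodeSeq.decode x) => // a s _.
by rewrite tl_code hd_code.
Qed.

Lemma lcons_gt0 a b : 0 < lcons a b.
Proof. by rewrite muln_gt0 expn_gt0. Qed.

Lemma lcons_gtr a b : b < lcons a b.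
Proof.
by rewrite /lcons; case: (2 ^ a) (expn_gt0 2 a) => // n _; nia.
Qed.

Lemma lcons0 b : lcons 0 b = b.*2.+1. Proof. exact: mul1n. Qed.
Lemma lconsS a b : lcons a.+1 b = (lcons a b).*2.
Proof. by rewrite /lcons expnS -mulnA mul2n. Qed.

(** The registers are used as a stack: a program works from a base register [b]
    on, and [s] is the part of the state that it must not touch. *)
Definition frame (b : nat) (s : nat -> nat) (l : seq nat) : nat -> nat :=
  fun r => if r < b then s r else nth 0 l (r - b).

Lemma frame_get b s l i : frame b s l (b + i) = nth 0 l i.
Proof. by rewrite /frame ltnNge leq_addr addKn. Qed.

Lemma frame_upd b s l i v :
  upd (frame b s l) (b + i) v = frame b s (set_nth 0 l i v).
Proof.
apply/funext => r; rewrite /upd /frame; case: eqP => [->|ne].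
  by rewrite ltnNge leq_addr addKn nth_set_nth /= eqxx.
by case: ltnP => // le; rewrite nth_set_nth /= ifN //; lia.
Qed.

Lemma frame_upd0 b s l v : 0 < b -> upd (frame b s l) 0 v = frame b (upd s 0 v) l.
Proof.
by move=> b0; apply/funext => r; rewrite /upd /frame; case: eqP => // ->; rewrite b0.
Qed.

Lemma frame_cat b s l1 l2 :
  frame b s (l1 ++ l2) = frame (b + size l1) (frame b s l1) l2.
Proof.
apply/funext => r; rewrite /frame nth_cat.
case: ltnP => [lt|ge]; first by rewrite (leq_trans lt) // leq_addr.
by rewrite ltn_subLR // subnDA.
Qed.

Lemma eq_frame b s l1 l2 :
  (forall i, nth 0 l1 i = nth 0 l2 i) -> frame b s l1 = frame b s l2.
Proof. by move=> eq12; apply/funext => r; rewrite /frame eq12. Qed.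

Lemma frame_init x : upd (fun=> 0) 1 x = frame 1 (fun=> 0) [:: x].
Proof.
apply/funext => -[|[|r]]; rewrite /upd /frame //=.
by rewrite nth_nil.
Qed.

(** A program for [f] may start at any register, provided that all later
    registers are empty; it leaves them empty, which is what makes programs
    composable. Register 0 is reserved for queries. *)
Definition computable (g f : nat -> nat) : Prop :=
  exists P : nat -> cmd, forall b s x, 0 < b -> s 0 = 0 ->
    exec g (P b) (frame b s [:: x]) (frame b s [:: f x]).

Lemma computable_turing_le f g : computable g f -> turing_le f g.
Proof.
case=> P HP; apply: (@exec_turing_le f g (P 1) 1) => x.
by exists (frame 1 (fun=> 0) [:: f x]); rewrite // frame_init; exact: HP.
Qed.

Section Programs.
Variable g : nat -> nat.

Lemma exec_eq c st1 st2 st3 : exec g c st1 st2 -> st2 = st3 -> exec g c st1 st3.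
Proof. by move=> ? <-. Qed.

Lemma exec_count (r : nat) (c : cmd) (F : nat -> nat -> nat) N :
    (forall n, F n r = n) ->
    (forall n, n < N -> exec g c (upd (F n.+1) r n) (F n)) ->
  exec g (Loop r c) (F N) (F 0).
Proof.
move=> Fr body; elim: N body => [|N IHN] body; first exact: exec_loop0.
apply: exec_loopS; rewrite ?Fr //=; first exact: body.
by apply: IHN => n /ltnW; apply: body.
Qed.

(** The invariant rule for a loop that counts register [b + i] down: [F n] is
    the frame when that register contains [n]. *)
Lemma exec_loopf b i c (F : nat -> seq nat) s N l l' :
    (forall n, nth 0 (F n) i = n) ->
    (forall n, n < N ->
       exec g c (frame b s (set_nth 0 (F n.+1) i n)) (frame b s (F n))) ->
    (forall i, nth 0 l i = nth 0 (F N) i) ->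
    (forall i, nth 0 (F 0) i = nth 0 l' i) ->
  exec g (Loop (b + i) c) (frame b s l) (frame b s l').
Proof.
move=> Fi body /eq_frame-> /eq_frame eq_l'; rewrite -eq_l'.
apply: (exec_count (F := fun n => frame b s (F n))) => n; first by rewrite frame_get.
by rewrite frame_upd; exact: body.
Qed.

Lemma exec_incf b i s l : exec g (Inc (b + i)) (frame b s l)
  (frame b s (set_nth 0 l i (nth 0 l i).+1)).
Proof. by apply: exec_eq (exec_inc _ _ _) _; rewrite frame_upd frame_get. Qed.

Lemma exec_decf b i s l : exec g (Dec (b + i)) (frame b s l)
  (frame b s (set_nth 0 l i (nth 0 l i).-1)).
Proof. by apply: exec_eq (exec_dec _ _ _) _; rewrite frame_upd frame_get. Qed.

Lemma exec_nested b i (P : nat -> cmd) f s l x :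
    (forall b s x, 0 < b -> s 0 = 0 ->
      exec g (P b) (frame b s [:: x]) (frame b s [:: f x])) ->
    0 < b -> s 0 = 0 -> size l = i ->
  exec g (P (b + i)) (frame b s (rcons l x)) (frame b s (rcons l (f x))).
Proof.
move=> HP b0 s0 <-; rewrite -!cats1 !frame_cat; apply: HP; first by lia.
by rewrite /frame b0.
Qed.

Ltac frame_eq :=
  try (apply: eq_frame); do ?case=> [|[|[|[|[|[|[|?]]]]]]];
  rewrite //= ?nth_nil ?nth_default //=; try lia.

Definition clear r := Loop r Skip.

Lemma exec_clear b i s l :
  exec g (clear (b + i)) (frame b s l) (frame b s (set_nth 0 l i 0)).
Proof.
apply: (exec_loopf (F := fun n => set_nth 0 l i n) (N := nth 0 l i)) => [n|n _|j|//].
- by rewrite nth_set_nth /= eqxx.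
- apply: exec_eq (exec_skip _ _) _; apply: eq_frame => j.
  by rewrite !nth_set_nth /= !nth_set_nth /=; case: eqP.
- by rewrite nth_set_nth /=; case: eqP => [->|].
Qed.

Definition move r r' := Loop r (Inc r').

Lemma exec_move b i j s l : i != j ->
  exec g (move (b + i) (b + j)) (frame b s l)
    (frame b s (set_nth 0 (set_nth 0 l i 0) j (nth 0 l j + nth 0 l i))).
Proof.
move=> neij; set y := nth 0 l j; set x := nth 0 l i.
apply: (exec_loopf
  (F := fun n => set_nth 0 (set_nth 0 l i n) j (y + (x - n))) (N := x)) => [n|n lt|k|k].
- by rewrite nth_set_nth /= (negbTE neij) nth_set_nth /= eqxx.
- apply: exec_eq (exec_incf _ _ _ _) _; apply: eq_frame => k.
  do ?rewrite nth_set_nth /=; rewrite eqxx.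
  case: (k =P j) => [_|_]; last by case: (k =P i).
  by rewrite eq_sym (negbTE neij); lia.
- rewrite !nth_set_nth /= !nth_set_nth /=; case: (k =P j) => [->|_].
    by rewrite -/y; lia.
  by case: (k =P i) => [->|_].
- by rewrite !nth_set_nth /= !nth_set_nth /= subn0.
Qed.

Definition dup b := Seq (Loop (b + 0) (Seq (Inc (b + 1)) (Inc (b + 2))))
  (move (b + 2) (b + 0)).

Lemma exec_dup b s x : exec g (dup b) (frame b s [:: x]) (frame b s [:: x; x]).
Proof.
apply: exec_seq.
  apply: (exec_loopf (F := fun n => [:: n; x - n; x - n]) (N := x)
    (l' := [:: 0; x; x])); try by frame_eq.
  move=> n lt; apply: exec_seq; first exact: exec_incf.
  by apply: exec_eq (exec_incf _ _ _ _) _; frame_eq.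
by apply: exec_eq; first exact: exec_move; frame_eq.
Qed.

Lemma computable_id : computable g id.
Proof. by exists (fun=> Skip) => *; exact: exec_skip. Qed.

Lemma computable_S : computable g S.
Proof.
exists (fun b => Inc (b + 0)) => b s x _ _.
by apply: exec_eq (exec_incf _ _ _ _) _.
Qed.

Lemma computable0 : computable g (fun=> 0).
Proof.
exists (fun b => clear (b + 0)) => b s x _ _.
by apply: exec_eq (exec_clear _ _ _ _) _.
Qed.

Lemma computable_comp f h : computable g f -> computable g h ->
  computable g (fun x => f (h x)).
Proof.
move=> [P HP] [Q HQ]; exists (fun b => Seq (Q b) (P b)) => b s x b0 s0.
by apply: exec_seq; [exact: HQ | exact: HP].
Qed.

Lemma computable_oracle : computable g g.
Proof.
exists (fun b => Seq (Loop (b + 0) (Inc 0)) (Seq Query (Loop 0 (Inc (b + 0))))).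
move=> b s x b0 s0.
have upd00 u v : upd (upd s 0 u) 0 v = upd s 0 v by apply/funext => -[|r].
have upd0 : upd s 0 0 = s by apply/funext => -[|r] //; rewrite /upd s0.
have upd_frame l v w : upd (frame b (upd s 0 v) l) 0 w = frame b (upd s 0 w) l.
  by rewrite frame_upd0 // upd00.
have at0 l v : frame b (upd s 0 v) l 0 = v by rewrite /frame b0.
apply: (exec_seq (st2 := frame b (upd s 0 x) [:: 0])).
  have := exec_count (r := b + 0) (c := Inc 0)
    (F := fun n => frame b (upd s 0 (x - n)) [:: n]) (N := x).
  rewrite subnn subn0 upd0; apply=> n; first by rewrite frame_get.
  move=> lt; rewrite frame_upd; apply: exec_eq (exec_inc _ _ _) _.
  by rewrite upd_frame at0; have -> : (x - n.+1).+1 = x - n by lia.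
apply: exec_seq; first exact: exec_query.
rewrite upd_frame at0.
have := exec_count (r := 0) (c := Inc (b + 0))
  (F := fun n => frame b (upd s 0 n) [:: g x - n]) (N := g x).
rewrite subnn subn0 upd0; apply=> n; first by rewrite at0.
move=> lt; rewrite upd_frame; apply: exec_eq (exec_incf _ _ _ _) _.
by rewrite /=; have -> : (g x - n.+1).+1 = g x - n by lia.
Qed.

Definition cons_prog b :=
  Seq (Seq (Loop (b + 1) (Seq (Inc (b + 2)) (Inc (b + 2)))) (Inc (b + 2)))
 (Seq (Loop (b + 0) (Seq (Loop (b + 2) (Seq (Inc (b + 1)) (Inc (b + 1))))
                         (move (b + 1) (b + 2))))
      (move (b + 2) (b + 0))).

Lemma exec_cons b s x y :
  exec g (cons_prog b) (frame b s [:: x; y]) (frame b s [:: lcons x y]).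
Proof.
apply: (exec_seq (st2 := frame b s [:: x; 0; y.*2.+1])).
  apply: (exec_seq (st2 := frame b s [:: x; 0; y.*2])).
    apply: (exec_loopf (F := fun n => [:: x; n; (y - n).*2]) (N := y));
      try by frame_eq.
    move=> n lt; apply: exec_seq; first exact: exec_incf.
    by apply: exec_eq (exec_incf _ _ _ _) _; frame_eq.
  by apply: exec_eq (exec_incf _ _ _ _) _; frame_eq.
apply: (exec_seq (st2 := frame b s [:: 0; 0; lcons x y])); last first.
  by apply: exec_eq; first exact: exec_move; frame_eq.
apply: (exec_loopf (F := fun n => [:: n; 0; lcons (x - n) y]) (N := x)).
- by frame_eq.
- move=> n lt; set v := lcons _ _.
  apply: (exec_seq (st2 := frame b s [:: n; v.*2; 0])).
    apply: (exec_loopf (F := fun k => [:: n; (v - k).*2; k]) (N := v));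
      try by frame_eq.
    move=> k ltk; apply: exec_seq; first exact: exec_incf.
    by apply: exec_eq (exec_incf _ _ _ _) _; frame_eq.
  apply: exec_eq; first exact: exec_move.
  rewrite /v -lconsS; have -> : (x - n.+1).+1 = x - n by lia.
  by frame_eq.
- by rewrite subnn lcons0.
- by rewrite subn0.
Qed.

Lemma computable_lcons f h : computable g f -> computable g h ->
  computable g (fun x => lcons (f x) (h x)).
Proof.
move=> [P HP] [Q HQ].
exists (fun b => Seq (dup b) (Seq (P (b + 1)) (Seq (Seq (move (b + 0) (b + 2))
  (Seq (move (b + 1) (b + 0)) (move (b + 2) (b + 1))))
  (Seq (Q (b + 1)) (cons_prog b))))) => b s x b0 s0.
apply: exec_seq; first exact: exec_dup.
apply: exec_seq; first exact: (@exec_nested b 1 P f s [:: x] x HP).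
apply: (exec_seq (st2 := frame b s [:: f x; x])).
  apply: exec_seq; first exact: exec_move.
  apply: exec_seq; first exact: exec_move.
  by apply: exec_eq; first exact: exec_move; frame_eq.
apply: exec_seq; first exact: (@exec_nested b 1 Q h s [:: f x] x HQ).
exact: exec_cons.
Qed.

(** The quotient of register [b] by 2 goes to [b + 2], the remainder to [b + 3];
    [b + 4] holds the opposite parity while they are updated. *)
Definition halve b :=
  Loop (b + 0) (Seq (Inc (b + 4))
    (Seq (Loop (b + 3) (Seq (Inc (b + 2)) (Dec (b + 4)))) (move (b + 4) (b + 3)))).

Lemma exec_halve b s x a f :
  exec g (halve b) (frame b s [:: x; a; 0; 0; 0; f])
    (frame b s [:: 0; a; x./2; odd x : nat; 0; f]).
Proof.
apply: (exec_loopf (F := fun n => [:: n; a; (x - n)./2; odd (x - n) : nat; 0; f])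
  (N := x)).
- by frame_eq.
- move=> n lt; rewrite /=; have -> : x - n = (x - n.+1).+1 by lia.
  set k := x - n.+1; apply: exec_seq; first exact: exec_incf.
  rewrite /= uphalf_half.
  apply: (exec_seq (st2 := frame b s [:: n; a; odd k + k./2; 0; ~~ odd k : nat; f])).
    apply: (exec_loopf (F := fun i => [:: n; a; odd k - i + k./2; i; 1 - (odd k - i); f])
      (N := odd k)); try by frame_eq; case: (odd k).
    move=> i lti; apply: exec_seq; first exact: exec_incf.
    apply: exec_eq (exec_decf _ _ _ _) _.
    by case: (odd k) lti => //; case: i => // _; frame_eq.
  by apply: exec_eq; first exact: exec_move; case: (odd k); frame_eq.
- by rewrite subnn.
- by rewrite subn0.
Qed.

(** As [lcons a c = 2 ^ a * (2 * c + 1)], the head is the number of halvings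
    that leave an even number, and the tail is what the next one leaves.
    Register [b + 5] is the flag that keeps this loop going. It is set from the
    start only for positive numbers, because 0 can be halved forever. *)
Definition uncons_body b :=
  Seq (halve b) (Seq (Seq (Inc (b + 5)) (Inc (b + 1)))
    (Seq (Loop (b + 3) (Seq (Dec (b + 5)) (Dec (b + 1))))
      (Seq (Loop (b + 5) (Seq (move (b + 2) (b + 0)) (Inc (b + 4))))
         (move (b + 4) (b + 5))))).

Definition uncons_prog b :=
  Seq (move (b + 0) (b + 2))
 (Seq (Loop (b + 2) (Seq (Inc (b + 0)) (Seq (clear (b + 5)) (Inc (b + 5)))))
 (Seq (Loop (b + 5) (uncons_body b))
      (Seq (move (b + 1) (b + 0)) (move (b + 2) (b + 1))))).

Lemma exec_uncons_body b s x a :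
  exec g (uncons_body b) (frame b s [:: x; a; 0; 0; 0; 0])
    (frame b s (if odd x then [:: 0; a; x./2; 0; 0; 0]
                else [:: x./2; a.+1; 0; 0; 0; 1])).
Proof.
apply: exec_seq; first exact: exec_halve.
apply: exec_seq; first by apply: exec_seq; exact: exec_incf.
apply: (exec_seq
  (st2 := frame b s [:: 0; (~~ odd x) + a; x./2; 0; 0; ~~ odd x : nat])).
  apply: (exec_loopf (F := fun i => [:: 0; 1 + a - (odd x - i); x./2; i; 0;
     1 - (odd x - i)]) (N := odd x)); try by case: (odd x); frame_eq.
  move=> i lti; apply: exec_seq; first exact: exec_decf.
  apply: exec_eq (exec_decf _ _ _ _) _.
  by case: (odd x) lti => //; case: i => // _; frame_eq.
case: (odd x) => /=.
  apply: (exec_seq (st2 := frame b s [:: 0; a; x./2; 0; 0; 0])).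
    by apply: exec_loop0; rewrite frame_get.
  by apply: exec_eq; first exact: exec_move; frame_eq.
apply: (exec_seq (st2 := frame b s [:: x./2; a.+1; 0; 0; 1; 0])); last first.
  by apply: exec_eq; first exact: exec_move; frame_eq.
apply: exec_loopS; first by rewrite frame_get.
  rewrite frame_get frame_upd.
  by apply: exec_seq; [exact: exec_move | exact: exec_incf].
by apply: exec_eq; [apply: exec_loop0; rewrite frame_get | frame_eq].
Qed.

Lemma exec_uncons_loop b s a c d :
  exec g (Loop (b + 5) (uncons_body b)) (frame b s [:: lcons c d; a; 0; 0; 0; 1])
    (frame b s [:: 0; a + c; d; 0; 0; 0]).
Proof.
elim: c a => [|c IHc] a; (apply: exec_loopS; first by rewrite frame_get).
- rewrite frame_upd frame_get; exact: exec_uncons_body.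
- rewrite lcons0 /= odd_double uphalf_double addn0.
  by apply: exec_loop0; rewrite frame_get.
- rewrite frame_upd frame_get; exact: exec_uncons_body.
- by rewrite lconsS odd_double doubleK -[a + c.+1]addSnnS; exact: IHc.
Qed.

Lemma exec_uncons b s x :
  exec g (uncons_prog b) (frame b s [:: x]) (frame b s [:: hd x; tl x]).
Proof.
apply: exec_seq; first exact: exec_move.
apply: (exec_seq (st2 := frame b s [:: x; 0; 0; 0; 0; (0 < x) : nat])).
  apply: (exec_loopf (F := fun i => [:: x - i; 0; i; 0; 0; (0 < x - i) : nat])
    (N := x)); try by frame_eq.
  move=> n lt; apply: exec_seq; first exact: exec_incf.
  apply: exec_seq; first exact: exec_clear.
  by apply: exec_eq; first exact: exec_incf; frame_eq.
apply: (exec_seq (st2 := frame b s [:: 0; hd x; tl x])); last first.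
  apply: exec_seq; first exact: exec_move.
  by apply: exec_eq; first exact: exec_move; frame_eq.
case: (posnP x) => [->|x0].
  by apply: exec_eq; [apply: exec_loop0; rewrite frame_get | frame_eq].
rewrite -[in X in frame b s (X :: _)](lcons_hd_tl x0).
apply: exec_eq; first exact: exec_uncons_loop.
by rewrite add0n; frame_eq.
Qed.

Lemma computable_hd : computable g hd.
Proof.
exists (fun b => Seq (uncons_prog b) (clear (b + 1))) => b s x _ _.
apply: exec_seq; first exact: exec_uncons.
by apply: exec_eq; first exact: exec_clear; frame_eq.
Qed.

Lemma computable_tl : computable g tl.
Proof.
exists (fun b => Seq (uncons_prog b) (Seq (clear (b + 0)) (move (b + 1) (b + 0)))).
move=> b s x _ _; apply: exec_seq; first exact: exec_uncons.
apply: exec_seq; first exact: exec_clear.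
by apply: exec_eq; first exact: exec_move; frame_eq.
Qed.

Lemma computable_iter_hd_tl f : computable g f ->
  computable g (fun z => iter (hd z) f (tl z)).
Proof.
case=> P HP; exists (fun b => Seq (uncons_prog b)
  (Seq (Loop (b + 0) (P (b + 1))) (move (b + 1) (b + 0)))) => b s z b0 s0.
apply: exec_seq; first exact: exec_uncons.
apply: (exec_seq (st2 := frame b s [:: 0; iter (hd z) f (tl z)])); last first.
  by apply: exec_eq; first exact: exec_move; frame_eq.
apply: (exec_loopf (F := fun n => [:: n; iter (hd z - n) f (tl z)]) (N := hd z)).
- by frame_eq.
- move=> n lt; have -> : hd z - n = (hd z - n.+1).+1 by lia.
  rewrite iterS; exact: (@exec_nested b 1 P f s [:: n]).
- by rewrite subnn.
- by rewrite subn0.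
Qed.

(** Unbounded search, for a state instead of a number; the run of a machine is
    the case where [step] is its transition. *)
Lemma computable_while f step k w :
    computable g f -> computable g step -> computable g k ->
    (forall x, exists2 n, w x = iter n step (k x) & f (w x) = 0 /\
       forall i, i < n -> f (iter i step (k x)) != 0) ->
  computable g w.
Proof.
move=> [P HP] [Q HQ] [K HK] wE.
exists (fun b => Seq (K b) (Seq (Seq (dup b) (P (b + 1))) (Loop (b + 1)
  (Seq (clear (b + 1)) (Seq (Q b) (Seq (dup b) (P (b + 1)))))))) => b s x b0 s0.
apply: exec_seq; first exact: HK.
have test y : exec g (Seq (dup b) (P (b + 1))) (frame b s [:: y])
    (frame b s [:: y; f y]).
  apply: exec_seq; first exact: exec_dup.
  exact: (@exec_nested b 1 P f s [:: y]).
apply: exec_seq; first exact: test.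
have [n -> []] := wE x; elim: n (k x) {wE} => [|n IHn] z /= fw0 nz.
  rewrite fw0; apply: exec_eq; [apply: exec_loop0; rewrite frame_get // | frame_eq].
apply: exec_loopS.
- by rewrite frame_get /= lt0n; exact: (nz 0).
- rewrite frame_get frame_upd.
  apply: (exec_seq (st2 := frame b s [:: z])).
    by apply: exec_eq; first exact: exec_clear; frame_eq.
  by apply: exec_seq; [exact: HQ | exact: test].
rewrite -iterS iterSr; apply: IHn; first by rewrite -iterSr.
by move=> i lt; rewrite -iterSr; exact: nz.
Qed.

End Programs.

(** * Closure properties of the computable functions *)

Section Closure.
Variable g : nat -> nat.
Implicit Types f h k : nat -> nat.

Lemma computable_const c : computable g (fun=> c).
Proof.
elim: c => [|c IHc]; first exact: computable0.
exact: (computable_comp (computable_S g) IHc).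
Qed.

Lemma computable_succ f : computable g f -> computable g (fun x => (f x).+1).
Proof. exact: (computable_comp (computable_S g)). Qed.

Lemma computable_hdf f : computable g f -> computable g (fun x => hd (f x)).
Proof. exact: (computable_comp (computable_hd g)). Qed.

Lemma computable_tlf f : computable g f -> computable g (fun x => tl (f x)).
Proof. exact: (computable_comp (computable_tl g)). Qed.

(** The parameter [x] of the iterated function travels along in a pair. *)
Lemma computable_iter (F : nat -> nat -> nat) h k :
    computable g (fun z => F (hd z) (tl z)) -> computable g h -> computable g k ->
  computable g (fun x => iter (h x) (F x) (k x)).
Proof.
move=> cF ch ck.
pose step z := lcons (hd z) (F (hd z) (tl z)).
have cstep : computable g step by apply: computable_lcons (computable_hd g) cF.
have := computable_tlf (computable_comp (computable_iter_hd_tl cstep)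
  (computable_lcons ch (computable_lcons (computable_id g) ck))).
congr (computable g _); apply/funext => x; rewrite hd_lcons tl_lcons.
suff -> n : iter n step (lcons x (k x)) = lcons x (iter n (F x) (k x)).
  by rewrite tl_lcons.
by elim: n => //= n ->; rewrite /step hd_lcons tl_lcons.
Qed.

Lemma computable_add f h :
  computable g f -> computable g h -> computable g (fun x => f x + h x).
Proof.
move=> cf ch.
have := @computable_iter (fun=> S) f h (computable_succ (computable_tl g)) cf ch.
by congr (computable g _); apply/funext => x; rewrite iter_succn addnC.
Qed.

(** Iteration on pairs of a number and its predecessor. *)
Lemma computable_pred f : computable g f -> computable g (fun x => (f x).-1).
Proof.
move=> cf; pose F (x z : nat) := lcons (hd z).+1 (hd z).
have cF : computable g (fun z => F (hd z) (tl z)).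
  apply: computable_lcons; first apply: computable_succ.
    exact/computable_hdf/computable_tl.
  exact/computable_hdf/computable_tl.
have := computable_tlf (computable_iter cF cf (computable0 g)).
congr (computable g _); apply/funext => x; case: (f x) => //= n.
rewrite tl_lcons; elim: n => //= n IHn.
by rewrite hd_lcons IHn.
Qed.

Lemma computable_sub f h :
  computable g f -> computable g h -> computable g (fun x => f x - h x).
Proof.
move=> cf ch.
have := @computable_iter (fun=> predn) h f (computable_pred (computable_tl g)) ch cf.
congr (computable g _); apply/funext => x.
by elim: (h x) => [|n IHn]; rewrite ?subn0 // subnS -IHn.
Qed.

Lemma computable_mul f h :
  computable g f -> computable g h -> computable g (fun x => f x * h x).
Proof.
move=> cf ch.
have cF : computable g (fun z => h (hd z) + tl z).
  by apply: computable_add (computable_tl g); apply: computable_comp (computable_hd g).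
have := @computable_iter (fun x => addn (h x)) f (fun=> 0) cF cf (computable_const 0).
congr (computable g _); apply/funext => x.
by elim: (f x) => //= n ->.
Qed.

Lemma computable_exp f h :
  computable g f -> computable g h -> computable g (fun x => f x ^ h x).
Proof.
move=> cf ch.
have cF : computable g (fun z => f (hd z) * tl z).
  by apply: computable_mul (computable_tl g); apply: computable_comp (computable_hd g).
have := @computable_iter (fun x => muln (f x)) h (fun=> 1) cF ch (computable_const 1).
congr (computable g _); apply/funext => x.
by elim: (h x) => //= n ->; rewrite expnS.
Qed.

Lemma computable_leq f h :
  computable g f -> computable g h -> computable g (fun x => (f x <= h x) : nat).
Proof.
move=> cf ch; have := computable_sub (computable_const 1) (computable_sub cf ch).
by congr (computable g _); apply/funext => x; lia.
Qed.

Lemma computable_and (a b : nat -> bool) :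
    computable g (fun x => a x : nat) -> computable g (fun x => b x : nat) ->
  computable g (fun x => (a x && b x) : nat).
Proof.
move=> ca cb; have := computable_mul ca cb.
by congr (computable g _); apply/funext => x; rewrite mulnb.
Qed.

Lemma computable_neg (a : nat -> bool) :
  computable g (fun x => a x : nat) -> computable g (fun x => (~~ a x) : nat).
Proof.
move=> ca; have := computable_sub (computable_const 1) ca.
by congr (computable g _); apply/funext => x; case: (a x).
Qed.

Lemma computable_or (a b : nat -> bool) :
    computable g (fun x => a x : nat) -> computable g (fun x => b x : nat) ->
  computable g (fun x => (a x || b x) : nat).
Proof.
move=> ca cb; have := computable_neg (computable_and (computable_neg ca) (computable_neg cb)).
by congr (computable g _); apply/funext => x; rewrite negb_and !negbK.
Qed.

Lemma computable_eq f h :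
  computable g f -> computable g h -> computable g (fun x => (f x == h x) : nat).
Proof.
move=> cf ch; have := computable_and (computable_leq cf ch) (computable_leq ch cf).
by congr (computable g _); apply/funext => x; rewrite eqn_leq.
Qed.

Lemma computable_if (b : nat -> bool) f h :
    computable g (fun x => b x : nat) -> computable g f -> computable g h ->
  computable g (fun x => if b x then f x else h x).
Proof.
move=> cb cf ch.
have := computable_add (computable_mul cb cf) (computable_mul (computable_neg cb) ch).
by congr (computable g _); apply/funext => x; case: (b x); lia.
Qed.

Lemma computable_mu (P : nat -> nat -> bool) (m : nat -> nat) :
    computable g (fun z => P (hd z) (tl z) : nat) ->
    (forall x, P x (m x) /\ forall y, y < m x -> ~~ P x y) ->
  computable g m.
Proof.
move=> cP mP; pose step z := lcons (hd z) (tl z).+1.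
have cstep : computable g step.
  by apply: computable_lcons (computable_hd g) (computable_succ (computable_tl g)).
pose w x := lcons x (m x).
suff cw : computable g w.
  have := computable_tlf cw; congr (computable g _); apply/funext => x.
  by rewrite /w tl_lcons.
apply: (computable_while (computable_neg cP) cstep
  (computable_lcons (computable_id g) (computable_const 0))) => x.
have itE n : iter n step (lcons x 0) = lcons x n.
  by elim: n => //= n ->; rewrite /step hd_lcons tl_lcons.
have [Pm minm] := mP x; exists (m x); first by rewrite itE.
split=> [|i lti]; first by rewrite /w hd_lcons tl_lcons Pm.
by rewrite itE hd_lcons tl_lcons minm.
Qed.

(** The quotient is found by search, so that only products are needed. *)
Lemma computable_div f h :
  computable g f -> computable g h -> computable g (fun x => f x %/ h x).
Proof.
move=> cf ch.
apply: (@computable_mu (fun x y => (h x == 0) || (f x < y.+1 * h x))) => [|x].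
  apply: computable_or.
    by apply: computable_eq (computable_const 0); apply: computable_comp (computable_hd g).
  apply: computable_leq.
    by apply: computable_succ; apply: computable_comp (computable_hd g).
  apply: computable_mul; first exact/computable_succ/computable_tl.
  by apply: computable_comp (computable_hd g).
case: (posnP (h x)) => [->|h0]; first by rewrite divn0.
rewrite ltn_ceil //; split=> //= y.
by rewrite leq_divRL // -leqNgt.
Qed.

Lemma size_decode n : size (CodeSeq.decode n) <= n.
Proof.
elim/ltn_ind: n => n IHn; rewrite -{2}[n]CodeSeq.decodeK.
case E: (CodeSeq.decode n) => [//|a s] /=.
have lt : CodeSeq.code s < n.
  by rewrite -[n]CodeSeq.decodeK E; exact: lcons_gtr.
by apply: leq_ltn_trans (lcons_gtr a _); rewrite -{1}[s]CodeSeq.codeK IHn.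
Qed.

(** One iteration per element; the code of a list is at least its length, so
    that it bounds the number of iterations, and further ones do nothing. *)
Lemma computable_foldl (F : nat -> nat -> nat -> nat) k l :
    computable g (fun z => F (hd z) (hd (tl z)) (tl (tl z))) ->
    computable g k -> computable g l ->
  computable g (fun x => foldl (F x) (k x) (CodeSeq.decode (l x))).
Proof.
move=> cF ck cl.
pose step x w := if tl w == 0 then w
  else lcons (F x (hd w) (hd (tl w))) (tl (tl w)).
have cstep : computable g (fun z => step (hd z) (tl z)).
  have c2 := computable_tl g; have c3 := computable_tlf c2.
  apply: computable_if => //; first exact: computable_eq c3 (computable_const 0).
  apply: computable_lcons; last exact: computable_tlf.
  have := computable_comp cF (computable_lcons (computable_hd g)
    (computable_lcons (computable_hdf c2) (computable_hdf c3))).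
  by congr (computable g _); apply/funext => z; rewrite hd_lcons !tl_lcons hd_lcons.
have := computable_hdf (computable_iter cstep cl (computable_lcons ck cl)).
congr (computable g _); apply/funext => x.
set n := {1}(l x); have : size (CodeSeq.decode (l x)) <= n by exact: size_decode.
rewrite -{2}[l x]CodeSeq.decodeK; elim: n (CodeSeq.decode _) (k x) => [|n IHn] s a.
  by case: s => //= _; rewrite hd_lcons.
case: s => [_|e s le].
  rewrite (_ : iter _ _ _ = lcons a 0) ?hd_lcons //.
  by elim: n.+1 => //= i ->; rewrite /step tl_lcons.
have stepE : step x (lcons a (CodeSeq.code (e :: s))) =
    lcons (F x a e) (CodeSeq.code s).
  rewrite /step !tl_lcons !hd_lcons code_cons.
  by rewrite (gtn_eqF (lcons_gt0 _ _)).
by rewrite iterSr stepE; exact: IHn.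
Qed.

Lemma computable_table (F : nat -> nat) (ks : seq nat) :
  exists2 h, computable g h & {in ks, h =1 F}.
Proof.
elim: ks => [|a ks [h ch hE]]; first by exists (fun=> 0); first exact: computable_const.
exists (fun x => if x == a then F a else h x).
  apply: computable_if (computable_const _) ch.
  exact: computable_eq (computable_id g) (computable_const a).
move=> x; rewrite inE; case: eqP => [-> //|_ /= xin]; exact: hE.
Qed.

Lemma computable_code_map (T : eqType) (F : T -> nat -> nat) (ts : seq T) :
    (forall t, computable g (F t)) ->
  computable g (fun x => CodeSeq.code [seq F t x | t <- ts]).
Proof.
move=> cF; elim: ts => [|t ts IH]; first exact: computable_const.
exact: computable_lcons.
Qed.

Lemma hd_iter_tl i x : hd (iter i tl x) = nth 0 (CodeSeq.decode x) i.
Proof.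
have -> : iter i tl x = CodeSeq.code (drop i (CodeSeq.decode x)).
  elim: i => [|i IHi]; first by rewrite drop0 CodeSeq.decodeK.
  by rewrite iterS IHi tl_code -drop1 drop_drop.
by rewrite hd_code -nth0 nth_drop addn0.
Qed.

Lemma computable_nth f h : computable g f -> computable g h ->
  computable g (fun x => nth 0 (CodeSeq.decode (f x)) (h x)).
Proof.
move=> cf ch; have := computable_hdf (@computable_iter (fun=> tl) h f
  (computable_tlf (computable_tl g)) ch cf).
by congr (computable g _); apply/funext => x; rewrite hd_iter_tl.
Qed.

End Closure.

(** * Oracle machines compute computable functions *)

Section Simulation.
Variables (g : nat -> nat) (M : oracle_tm).

Let ks := enum (tm_tape M).
Let blank := tm_blank M.

(** Blanks have code 0, because 0 is what [hd] reads off an empty list. *)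
Definition symbol_code (s : tm_symbol M) : nat :=
  if s == blank then 0 else (enum_rank s).+1.

Definition tape_code (t : tape (tm_symbol M)) : nat :=
  lcons (CodeSeq.code [seq symbol_code s | s <- t.1])
        (CodeSeq.code [seq symbol_code s | s <- t.2]).

Definition config_code (c : tm_config M) : nat :=
  lcons (enum_rank c.1) (CodeSeq.code [seq tape_code (c.2 k) | k <- ks]).

Definition tape_of (k : tm_tape M) (x : nat) : nat :=
  nth 0 (CodeSeq.decode (tl x)) (index k ks).

Lemma symbol_code_inj : injective symbol_code.
Proof.
move=> s1 s2; rewrite /symbol_code; case: eqP => [->|_]; case: eqP => // _.
by case=> /ord_inj/enum_rank_inj.
Qed.

Lemma config_codeK k c : tape_of k (config_code c) = tape_code (c.2 k).
Proof.
rewrite /tape_of tl_lcons CodeSeq.codeK (nth_map k) ?nth_index ?mem_enum //.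
by rewrite index_mem mem_enum.
Qed.

Lemma hd_symbols l :
  hd (CodeSeq.code [seq symbol_code s | s <- l]) = symbol_code (head blank l).
Proof. by rewrite hd_code; case: l => //=; rewrite /symbol_code eqxx. Qed.

Lemma tl_symbols l : tl (CodeSeq.code [seq symbol_code s | s <- l]) =
  CodeSeq.code [seq symbol_code s | s <- behead l].
Proof. by rewrite tl_code behead_map. Qed.

Definition value_of (t : nat) : nat :=
  find (predC1 (symbol_code (tm_stroke M))) (CodeSeq.decode (tl t)).

Lemma value_ofE t : value_of (tape_code t) = tape_value (tm_stroke M) t.
Proof.
rewrite /value_of tl_lcons CodeSeq.codeK find_map; apply: eq_find => s /=.
by rewrite (inj_eq symbol_code_inj).
Qed.

Lemma computable_value_of : computable g value_of.
Proof.
pose c := symbol_code (tm_stroke M).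
apply: (@computable_mu g (fun t y => nth 0 (CodeSeq.decode (tl t)) y != c)).
  apply/computable_neg/computable_eq/computable_const/computable_nth.
    exact/computable_tlf/computable_hd.
  exact: computable_tl.
move=> t; split=> [|y lty]; last by have /= -> := before_find 0 lty.
rewrite /value_of; set l := CodeSeq.decode _.
have [hl|hl] := boolP (has (predC1 c) l); first exact: (nth_find 0 hl).
rewrite nth_default; last by rewrite hasNfind.
by rewrite /c /symbol_code eq_sym ifN // eq_sym tm_blank_stroke.
Qed.

Definition unary_code (n : nat) : nat :=
  lcons 0 (iter n (lcons (symbol_code (tm_stroke M))) 0).

Lemma unary_codeE n : unary_code n = tape_code (unary_tape (tm_stroke M) n).
Proof.
rewrite /unary_code /tape_code /unary_tape /=; congr lcons.
by elim: n => //= n ->.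
Qed.

Lemma computable_unary_code f :
  computable g f -> computable g (fun x => unary_code (f x)).
Proof.
move=> cf; apply: computable_lcons (computable_const g 0) _.
apply: (@computable_iter g (fun=> lcons (symbol_code (tm_stroke M))) f (fun=> 0)) => //.
  exact: computable_lcons (computable_const _ _) (computable_tl g).
exact: computable_const.
Qed.

Definition reads (c : tm_config M) : {ffun tm_tape M -> tm_symbol M} :=
  [ffun k => tape_read blank (c.2 k)].

Definition key (q : tm_state M) (rd : {ffun tm_tape M -> tm_symbol M}) : nat :=
  lcons (enum_rank q) (CodeSeq.code [seq symbol_code (rd k) | k <- ks]).

Definition key_of (x : nat) : nat :=
  lcons (hd x) (CodeSeq.code [seq hd (tl (tape_of k x)) | k <- ks]).

Lemma key_ofE c : key_of (config_code c) = key c.1 (reads c).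
Proof.
rewrite /key_of /key hd_lcons; congr (lcons _ (CodeSeq.code _)).
by apply: eq_map => k; rewrite config_codeK tl_lcons hd_symbols ffunE.
Qed.

Lemma key_inj q rd q' rd' : key q rd = key q' rd' -> q = q' /\ rd = rd'.
Proof.
move=> eqk; split; first by have := congr1 hd eqk; rewrite !hd_lcons => /ord_inj/enum_rank_inj.
have := congr1 tl eqk; rewrite !tl_lcons => /(can_inj CodeSeq.codeK) eqm.
apply/ffunP => k; apply: symbol_code_inj.
have kin : index k ks < size ks by rewrite index_mem mem_enum.
have nthE (r : {ffun tm_tape M -> tm_symbol M}) :
    symbol_code (r k) = nth 0 [seq symbol_code (r i) | i <- ks] (index k ks).
  by rewrite (nth_map k) // nth_index ?mem_enum.
by rewrite !nthE eqm.
Qed.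

(** The transition function has a finite domain, so that it may be read off a
    table. *)
Lemma computable_trans (F : tm_state M -> {ffun tm_tape M -> tm_symbol M} -> nat) :
  exists2 h, computable g h & forall c, h (config_code c) = F c.1 (reads c).
Proof.
pose D := [seq (q, rd) | q <- enum (tm_state M),
                         rd <- enum {ffun tm_tape M -> tm_symbol M}].
pose F' x := F (nth (tm_start M, [ffun=> blank]) D (index x [seq key p.1 p.2 | p <- D])).1
  (nth (tm_start M, [ffun=> blank]) D (index x [seq key p.1 p.2 | p <- D])).2.
have [h ch hE] := computable_table g F' [seq key p.1 p.2 | p <- D].
have ckey : computable g key_of.
  apply: computable_lcons (computable_hd g) _; apply: computable_code_map => k.
  apply/computable_hdf/computable_tlf/computable_nth; first exact: computable_tl.
  exact: computable_const.
exists (fun x => h (key_of x)); first exact: computable_comp ckey.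
move=> c; rewrite key_ofE.
have inD : (c.1, reads c) \in D by rewrite allpairs_f ?mem_enum.
rewrite hE; last exact: (map_f (fun p => key p.1 p.2) inD).
have inj : injective (fun p : tm_state M * {ffun tm_tape M -> tm_symbol M} => key p.1 p.2).
  by move=> [q rd] [q' rd'] /key_inj[/= -> ->].
by rewrite /F' (index_map inj (D : seq _) (c.1, reads c)) nth_index.
Qed.

Definition move_code (d : head_move) : nat :=
  match d with MoveLeft => 0 | NoMove => 1 | MoveRight => 2 end.

Definition write_move (t s d : nat) : nat :=
  if d == 0 then lcons (tl (hd t)) (lcons (hd (hd t)) (lcons s (tl (tl t))))
  else if d == 1 then lcons (hd t) (lcons s (tl (tl t)))
  else lcons (lcons s (hd t)) (tl (tl t)).

Lemma write_moveE t s d :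
  write_move (tape_code t) (symbol_code s) (move_code d) =
  tape_code (tape_move blank d (tape_write s t)).
Proof.
case: t => l r; rewrite /write_move /tape_code /tape_write.
by case: d => /=; rewrite ?hd_lcons !tl_lcons ?hd_symbols ?tl_symbols.
Qed.

Lemma computable_write_move t s d : computable g t -> computable g s ->
  computable g d -> computable g (fun x => write_move (t x) (s x) (d x)).
Proof.
move=> ct cs cd.
have cl := computable_hdf ct; have cr := computable_tlf (computable_tlf ct).
apply: computable_if; first exact: computable_eq (computable_const _ _).
  by do ?[apply: computable_lcons | apply: computable_tlf | apply: computable_hdf].
apply: computable_if; first exact: computable_eq (computable_const _ _).
  by do ?[apply: computable_lcons | apply: computable_tlf | apply: computable_hdf].
by do ?[apply: computable_lcons | apply: computable_tlf | apply: computable_hdf].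
Qed.

Lemma computable_step : exists2 h, computable g h &
  forall c, h (config_code c) = config_code (tm_step g c).
Proof.
have [hq cq hqE] := computable_trans (fun q rd => enum_rank (tm_trans q rd).1).
have /choice[hs hsP] : forall k, exists h, computable g h /\
    forall c, h (config_code c) = symbol_code ((tm_trans c.1 (reads c)).2 k).1.
  move=> k; have [h ch hE] := computable_trans (fun q rd =>
    symbol_code ((tm_trans q rd).2 k).1); by exists h.
have /choice[hm hmP] : forall k, exists h, computable g h /\
    forall c, h (config_code c) = move_code ((tm_trans c.1 (reads c)).2 k).2.
  move=> k; have [h ch hE] := computable_trans (fun q rd =>
    move_code ((tm_trans q rd).2 k).2); by exists h.
have ctape k : computable g (tape_of k).
  by apply: computable_nth (computable_tl g) (computable_const _ _).
exists (fun x => if hd x == enum_rank (tm_halt M) then x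
  else if hd x == enum_rank (tm_query M) then
    lcons (enum_rank (tm_answer M)) (CodeSeq.code [seq
      (if k == tm_oracle M then unary_code (g (value_of (tape_of (tm_oracle M) x)))
       else tape_of k x) | k <- ks])
  else lcons (hq x) (CodeSeq.code
         [seq write_move (tape_of k x) (hs k x) (hm k x) | k <- ks])).
  have ceq q : computable g (fun x => hd x == q :> nat).
    exact: computable_eq (computable_hd g) (computable_const _ _).
  apply: computable_if (computable_id g) _ => //; apply: computable_if => //.
    apply: computable_lcons (computable_const _ _) _.
    apply: computable_code_map => k; case: eqP => // _.
    apply: computable_unary_code; apply: computable_comp (computable_oracle g) _.
    exact: computable_comp computable_value_of (ctape _).
  apply: computable_lcons => //; apply: computable_code_map => k.
  by apply: computable_write_move; [|apply: (hsP k).1|apply: (hmP k).1].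
case=> q T; rewrite {1 2}/config_code !hd_lcons /tm_step /=.
have eqr (q' : tm_state M) : (enum_rank q == enum_rank q' :> nat) = (q == q').
  by rewrite (inj_eq val_inj) (inj_eq enum_rank_inj).
rewrite !eqr; case: eqP => // _; case: eqP => [_|_].
  rewrite /config_code; congr (lcons _ (CodeSeq.code _)); apply: eq_map => k /=.
  rewrite ffunE -/(config_code (q, T)) !config_codeK /= value_ofE unary_codeE.
  by case: eqP.
rewrite -[finfun _]/(reads (q, T)) hqE /=.
have hsE k := (hsP k).2 (q, T); have hmE k := (hmP k).2 (q, T).
case E: (tm_trans q (reads (q, T))) hsE hmE => [q' act] /= hsE hmE.
rewrite {4}/config_code; congr (lcons _ (CodeSeq.code _)).
by apply: eq_map => k /=; rewrite ffunE hsE hmE config_codeK write_moveE.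
Qed.

Lemma tm_step_halt c i : c.1 = tm_halt M -> iter i (tm_step g) c = c.
Proof. by case: c => q T /= ->; elim: i => //= i ->; rewrite /= eqxx. Qed.

(** Search for the first halting configuration. Configurations do not change
    any more after it, so it yields the value of any halting time. *)
Lemma tm_computes_computable f : tm_computes M g f -> computable g f.
Proof.
move=> Mf; have [h ch hE] := computable_step.
pose init x := config_code (tm_init M x).
have cinit : computable g init.
  have -> : init = fun x => lcons (enum_rank (tm_start M)) (CodeSeq.code
      [seq (if k == tm_io M then unary_code x else lcons 0 0) | k <- ks]).
    apply/funext => x; congr (lcons _ (CodeSeq.code _)); apply: eq_map => k.
    by rewrite ffunE; case: eqP => // _; rewrite unary_codeE.
  apply: computable_lcons (computable_const _ _) _.
  apply: computable_code_map => k; case: eqP => _; last exact: computable_const.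
  exact: computable_unary_code (computable_id g).
have itE i x : iter i h (init x) = config_code (iter i (tm_step g) (tm_init M x)).
  by elim: i => //= i ->; rewrite hE.
have halts x : exists i, (iter i (tm_step g) (tm_init M x)).1 == tm_halt M.
  by have [i [hi _]] := Mf x; exists i; apply/eqP.
pose n x := ex_minn (halts x).
pose w x := iter (n x) h (init x).
have cw : computable g w.
  apply: (computable_while (f := fun x => (hd x != enum_rank (tm_halt M))) _ ch cinit).
    exact/computable_neg/computable_eq/computable_const/computable_hd.
  move=> x; exists (n x) => //; rewrite /w /n; case: ex_minnP => i hi mini.
  split=> [|j ltj]; rewrite itE hd_lcons (inj_eq val_inj) (inj_eq enum_rank_inj).
    by rewrite hi.
  by rewrite eqb0 negbK; apply: contraL ltj => /mini; rewrite -leqNgt.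
have -> : f = fun x => value_of (tape_of (tm_io M) (w x)).
  apply/funext => x; rewrite /w itE config_codeK value_ofE.
  have [i /= [hi <-]] := Mf x; rewrite /n; case: ex_minnP => j /eqP hj minj.
  have lej : j <= i by apply: minj; rewrite hi.
  by rewrite -(subnK lej) iterD tm_step_halt.
apply: computable_comp computable_value_of _.
apply: computable_nth (computable_const _ _); exact: computable_tlf.
Qed.

End Simulation.

Lemma turing_leP f g : turing_le f g <-> computable g f.
Proof.
by split=> [[M] | cf]; [exact: tm_computes_computable | exact: computable_turing_le].
Qed.

(** * Computable sequences of rational numbers *)

Definition rat_computable (g : nat -> nat) (q : nat -> rat) : Prop :=
  computable g (fun n => rat_code (q n)).

Section Rationals.
Variable g : nat -> nat.

(** The reduced denominator of [e / c] is the least positive [d] such that [c]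
    divides [e * d]; a search finds it without computing a gcd. *)
Lemma denq_minimal (e c : nat) (z : int) (q : rat) : 0 < c -> `|z|%N = e ->
    q = (z%:Q / c%:Q)%R ->
  [/\ c %| e * `|denq q|%N, `|numq q|%N = e * `|denq q|%N %/ c &
      forall y, 0 < y -> c %| e * y -> `|denq q|%N <= y].
Proof.
move=> c0 ze qE.
have numE : (numq q * c%:Z = z * denq q)%R.
  have c0' : (c%:Q != 0)%R by rewrite intr_eq0; lia.
  have dq0 : ((denq q)%:Q != 0)%R by rewrite intr_eq0 denq_eq0.
  have /eqP := qE; rewrite -{1}[q]divq_num_den eqr_div // -!intrM eqr_int.
  by move/eqP.
have absE : `|numq q|%N * c = e * `|denq q|%N.
  by rewrite -ze -!abszM -numE abszM.
split; first by rewrite -absE dvdn_mull.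
  by rewrite -absE mulnK.
move=> y y0 /dvdnP[t ty]; apply: dvdn_leq => //.
have cop : coprime `|denq q|%N `|numq q|%N by rewrite coprime_sym coprime_num_den.
rewrite -(Gauss_dvdr _ cop); apply/dvdnP; exists t.
by apply/eqP; rewrite -(eqn_pmul2r c0) mulnAC absE mulnAC ty; apply/eqP; lia.
Qed.

Lemma rat_computable_frac (a b c : nat -> nat) :
    computable g a -> computable g b -> computable g c -> (forall x, 0 < c x) ->
  rat_computable g (fun x => ((a x)%:Q - (b x)%:Q) / (c x)%:Q)%R.
Proof.
move=> ca cb cc c0; set q := fun x => (_ / _)%R.
pose e x := (a x - b x) + (b x - a x).
have ce : computable g e by apply: computable_add; apply: computable_sub.
have qE x : q x = (((a x)%:Z - (b x)%:Z)%:Q / (c x)%:Q)%R by rewrite /q intrB.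
have abse x : `|((a x)%:Z - (b x)%:Z)%R|%N = e x by rewrite /e; lia.
have den0 x : 0 < `|denq (q x)|%N by rewrite absz_gt0 denq_neq0.
pose m x := `|denq (q x)|%N.-1.
have cm : computable g m.
  apply: (@computable_mu g (fun x y => e x * y.+1 - e x * y.+1 %/ c x * c x == 0)).
    have ch := computable_hd g; have ct := computable_tl g.
    have cey : computable g (fun z => e (hd z) * (tl z).+1).
      by apply: computable_mul; [exact: computable_comp ce ch | exact: computable_succ].
    have cch : computable g (fun z => c (hd z)) by exact: computable_comp cc ch.
    apply/computable_eq/computable_const/computable_sub => //.
    by apply: computable_mul => //; apply: computable_div.
  have dvdE x y : (e x * y - e x * y %/ c x * c x == 0) = (c x %| e x * y).
    by rewrite {1}(divn_eq (e x * y) (c x)) addKn.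
  move=> x; have [dvd _ mini] := denq_minimal (c0 x) (abse x) (qE x).
  rewrite /m prednK // dvdE; split=> // y lty; rewrite dvdE.
  by apply: contraL lty => /(mini y.+1 isT); lia.
rewrite /rat_computable (_ : (fun x => rat_code (q x)) = fun x =>
    lcons (a x < b x) (lcons (e x * (m x).+1 %/ c x) (lcons (m x).+1 0))); last first.
  apply/funext => x; rewrite /rat_code !code_cons prednK //.
  have [_ -> _] := denq_minimal (c0 x) (abse x) (qE x).
  rewrite numq_lt0 qE pmulr_llt0 ?invr_gt0 ?ltr0z; last exact: c0.
  by rewrite ltrz0 subr_lt0 ltz_nat.
have cm1 := computable_succ cm.
apply: computable_lcons; first exact: computable_leq (computable_succ ca) cb.
apply: computable_lcons; last exact: computable_lcons (computable_const _ _).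
by apply: computable_div => //; apply: computable_mul.
Qed.

(** Numerators are differences of natural numbers, which avoids cases on signs.
    Together with the previous lemma this reduces rational arithmetic to
    arithmetic on unreduced fractions. *)
Lemma rat_computableE q : rat_computable g q ->
  exists a b c, [/\ computable g a, computable g b, computable g c,
    forall x, 0 < c x & forall x, q x = (((a x)%:Q - (b x)%:Q) / (c x)%:Q)%R].
Proof.
move=> cq; pose part i x := nth 0 (CodeSeq.decode (rat_code (q x))) i.
have cpart i : computable g (part i).
  exact: computable_nth cq (computable_const _ _).
exists (fun x => if part 0 x == 0 then part 1 x else 0).
exists (fun x => if part 0 x == 0 then 0 else part 1 x).
exists (part 2).
have ceq : computable g (fun x => part 0 x == 0 : nat).
  exact: computable_eq (cpart 0) (computable_const _ _).
split.
- exact: computable_if ceq (cpart 1) (computable_const _ _).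
- exact: computable_if ceq (computable_const _ _) (cpart 1).
- exact: cpart.
- by move=> x; rewrite /part CodeSeq.codeK /= absz_gt0 denq_neq0.
move=> x; rewrite /part CodeSeq.codeK /= -[LHS]divq_num_den.
rewrite (_ : (`|denq (q x)|%N)%:Q%R = (denq (q x))%:Q%R); last first.
  by rewrite absz_denq.
congr (_ / _)%R; case: (ltrP (numq (q x)) 0) => [lt|ge] /=.
  by rewrite sub0r -intrN ltz0_abs // opprK.
by rewrite subr0 gez0_abs.
Qed.

Lemma rat_computable_comp q h :
  rat_computable g q -> computable g h -> rat_computable g (fun x => q (h x)).
Proof. by move=> cq ch; exact: computable_comp cq ch. Qed.

Lemma rat_computable_of q a b c :
    computable g a -> computable g b -> computable g c -> (forall x, 0 < c x) ->
    (forall x, q x = ((a x)%:Q - (b x)%:Q) / (c x)%:Q)%R ->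
  rat_computable g q.
Proof.
move=> ca cb cc c0 /funext->; exact: (@rat_computable_frac a b c).
Qed.

Lemma rat_computable_nat f :
  computable g f -> rat_computable g (fun x => (f x)%:R)%R.
Proof.
move=> cf; apply: (rat_computable_of cf (computable_const _ 0) (computable_const _ 1)) => // x.
by rewrite subr0 divr1.
Qed.

Lemma rat_computable_invn f : computable g f -> (forall x, 0 < f x) ->
  rat_computable g (fun x => (f x)%:R^-1)%R.
Proof.
move=> cf f0; apply: (rat_computable_of (computable_const _ 1) (computable_const _ 0) cf) => // x.
by rewrite subr0 div1r.
Qed.

Lemma rat_computable_sub q r : rat_computable g q -> rat_computable g r ->
  rat_computable g (fun x => q x - r x)%R.
Proof.
move=> /rat_computableE[a [b [c [ca cb cc c0 qE]]]].
move=> /rat_computableE[a' [b' [c' [ca' cb' cc' c0' rE]]]].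
apply: (@rat_computable_of _ (fun x => a x * c' x + b' x * c x)
  (fun x => b x * c' x + a' x * c x) (fun x => c x * c' x)).
- by apply: computable_add; apply: computable_mul.
- by apply: computable_add; apply: computable_mul.
- exact: computable_mul.
- by move=> x; rewrite muln_gt0 c0 c0'.
move=> x; rewrite qE rE !PoszD !PoszM !intrD !intrM; field.
by rewrite !pnatr_eq0 -!lt0n c0 c0'.
Qed.

Lemma rat_computable_mul q r : rat_computable g q -> rat_computable g r ->
  rat_computable g (fun x => q x * r x)%R.
Proof.
move=> /rat_computableE[a [b [c [ca cb cc c0 qE]]]].
move=> /rat_computableE[a' [b' [c' [ca' cb' cc' c0' rE]]]].
apply: (@rat_computable_of _ (fun x => a x * a' x + b x * b' x)
  (fun x => a x * b' x + b x * a' x) (fun x => c x * c' x)).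
- by apply: computable_add; apply: computable_mul.
- by apply: computable_add; apply: computable_mul.
- exact: computable_mul.
- by move=> x; rewrite muln_gt0 c0 c0'.
move=> x; rewrite qE rE !PoszD !PoszM !intrD !intrM; field.
by rewrite !pnatr_eq0 -!lt0n c0 c0'.
Qed.

Lemma computable_rat_le0 q :
  rat_computable g q -> computable g (fun x => (q x <= 0)%R : nat).
Proof.
move=> /rat_computableE[a [b [c [ca cb cc c0 qE]]]].
rewrite (_ : (fun _ => _) = fun x => a x <= b x : nat).
  exact: computable_leq.
apply/funext => x; rewrite qE pmulr_lle0 ?invr_gt0 ?ltr0z; last exact: c0.
by rewrite subr_le0 ler_int.
Qed.

End Rationals.

(** * Traces of powers of a matrix over the group ring *)

Section TracePowers.
Variables (G : groupType) (k : nat) (s : 'I_k -> G) (m : nat).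
Local Open Scope ring_scope.

Lemma word_eval_cat w1 w2 :
  word_eval s (w1 ++ w2) = (word_eval s w1 * word_eval s w2)%g.
Proof.
elim: w1 => [|l w1 IH] /=; first by rewrite mul1g.
by rewrite IH mulgA.
Qed.

Lemma word_code_inj : injective (@word_code k).
Proof.
move=> w1 w2 /(can_inj CodeSeq.codeK); apply: inj_map => -[i b] [j c] /= eqij.
have eqbc : b = c by move/(congr1 odd): eqij; rewrite !oddD !odd_double; case: b; case: c.
by move: eqij; rewrite eqbc => /addIn/double_inj/ord_inj->.
Qed.

Lemma word_problemE w :
  word_problem s (word_code w) = (word_eval s w == 1%g) :> nat.
Proof.
rewrite /word_problem; congr nat_of_bool; apply/asboolP/eqP => [[v]|w1].
  by move/word_code_inj->.
by exists w.
Qed.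

(** Every matrix over the integral group ring is a sum of matrices that have one
    signed group element as their only entry. Words for the group elements turn
    them into finite data. *)
Definition term : Type := ('I_m * 'I_m * bool * word k)%type.

Definition trow (t : term) : 'I_m := t.1.1.1.
Definition tcol (t : term) : 'I_m := t.1.1.2.
Definition tsign (t : term) : bool := t.1.2.
Definition tword (t : term) : word k := t.2.

Definition tval (t : term) : 'M[grpalg int G]_m :=
  \matrix_(i, j) if (i == trow t) && (j == tcol t)
                 then << (-1) ^+ tsign t *g word_eval s (tword t) >> else 0.

Definition tmul (t u : term) : term :=
  (trow t, tcol u, tsign t (+) tsign u, tword t ++ tword u).

Definition terms_val (l : seq term) : 'M[grpalg int G]_m := \sum_(t <- l) tval t.

Lemma tval_mul t u :
  tval t * tval u = if tcol t == trow u then tval (tmul t u) else 0.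
Proof.
apply/matrixP => i j; rewrite mxE (bigD1 (tcol t)) //= !mxE eqxx andbT.
rewrite big1 ?addr0 => [|c /negbTE nc]; last by rewrite !mxE nc andbF mul0r.
case: (tcol t == trow u); last by rewrite mulr0 mxE.
rewrite mxE /=; case: (i == _); last by rewrite mul0r.
case: (j == _); last by rewrite mulr0.
by rewrite [LHS]gr_mulUU word_eval_cat signr_addb.
Qed.

Lemma tval_trace t : gr_trace (tval t) =
  (if (trow t == tcol t) && (word_eval s (tword t) == 1%g) then (-1) ^+ tsign t
   else 0).
Proof.
rewrite /gr_trace (bigD1 (trow t)) //= mxE eqxx /=.
rewrite big1 ?addr0 => [|c /negbTE nc]; last by rewrite mxE nc mcoeff0.
case: (_ == tcol t) => /=; last by rewrite mcoeff0.
by rewrite mcoeffU; case: (_ == 1%g); rewrite ?mulr1n ?mulr0n.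
Qed.

Lemma gr_traceD (K : nzRingType) (X Y : 'M[grpalg K G]_m) :
  gr_trace (X + Y) = gr_trace X + gr_trace Y.
Proof. by rewrite /gr_trace -big_split; apply: eq_bigr => i _; rewrite mxE mcoeffD. Qed.

Lemma gr_trace0 (K : nzRingType) : gr_trace (0 : 'M[grpalg K G]_m) = 0.
Proof. by rewrite /gr_trace big1 // => i _; rewrite mxE mcoeff0. Qed.

Lemma terms_val_exists (B : 'M[grpalg int G]_m) :
  generates s -> exists l, terms_val l = B.
Proof.
move=> gen; pose P B := exists l, terms_val l = B.
have P0 : P 0 by exists [::]; rewrite /terms_val big_nil.
have PD X Y : P X -> P Y -> P (X + Y).
  by move=> [l1 <-] [l2 <-]; exists (l1 ++ l2); rewrite /terms_val big_cat.
pose single (i j : 'I_m) (g : G) (c : int) : 'M[grpalg int G]_m :=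
  \matrix_(i', j') if (i' == i) && (j' == j) then << c *g g >> else 0.
have singleD i j g : {morph single i j g : c d / c + d}.
  by move=> c d; apply/matrixP => i' j'; rewrite !mxE; case: ifP => _; rewrite ?addr0 ?monalgUD.
have Psign i j g (b : bool) : P (single i j g ((-1) ^+ b)).
  by have [w <-] := gen g; exists [:: (i, j, b, w)]; rewrite /terms_val big_seq1.
have Psingle i j g c : P (single i j g c).
  elim/int_ind: c => [|n IHn|n IHn].
  - rewrite (_ : single _ _ _ _ = 0) //; apply/matrixP => i' j'.
    by rewrite !mxE monalgU0; case: ifP.
  - by rewrite -addn1 PoszD singleD; apply: PD => //; exact: (Psign i j g false).
  - by rewrite -addn1 PoszD opprD singleD; apply: PD => //; exact: (Psign i j g true).
have -> : B = \sum_i \sum_j \sum_(g <- msupp (B i j)) single i j g (B i j)@_g.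
  apply/matrixP => i j; rewrite summxE (bigD1 i) //= summxE (bigD1 j) //= summxE.
  rewrite [X in _ + X + _]big1 => [|j' nj]; last first.
    by rewrite summxE big1 // => g _; rewrite mxE [j == j']eq_sym (negbTE nj) andbF.
  rewrite [X in _ + X]big1 => [|i' ni]; last first.
    rewrite summxE big1 // => j' _; rewrite summxE big1 // => g _.
    by rewrite mxE [i == i']eq_sym (negbTE ni).
  rewrite !addr0 [LHS](monalgE (B i j : {malg int[G]})).
  by apply: eq_bigr => g _; rewrite mxE !eqxx.
by do 3 (apply: (big_ind P) => // ? _).
Qed.

Definition extend (L : seq term) (acc : seq term) (p : term) : seq term :=
  foldl (fun acc e => if tcol e == trow p then tmul e p :: acc else acc) acc L.

Definition terms_mul (L l : seq term) : seq term := foldl (extend L) [::] l.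

Lemma terms_val_nil : terms_val [::] = 0.
Proof. exact: big_nil. Qed.

Lemma terms_val_cons t l : terms_val (t :: l) = tval t + terms_val l.
Proof. exact: big_cons. Qed.

Lemma terms_val_mul L l : terms_val (terms_mul L l) = terms_val L * terms_val l.
Proof.
have extE acc p : terms_val (extend L acc p) = terms_val acc + terms_val L * tval p.
  rewrite /extend; elim: L acc => [|e L IH] acc /=.
    by rewrite terms_val_nil mul0r addr0.
  rewrite IH terms_val_cons mulrDl addrA tval_mul; congr (_ + _).
  by case: ifP => _; rewrite ?addr0 // terms_val_cons addrC.
rewrite /terms_mul; suff H acc :
    terms_val (foldl (extend L) acc l) = terms_val acc + terms_val L * terms_val l.
  by rewrite H terms_val_nil add0r.
elim: l acc => [|p l IH] acc /=; first by rewrite terms_val_nil mulr0 addr0.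
by rewrite IH extE terms_val_cons mulrDr addrA.
Qed.

Definition terms1 : seq term := [seq (i, i, false, [::]) | i <- enum 'I_m].

Lemma terms_val1 : terms_val terms1 = 1.
Proof.
rewrite /terms_val big_map big_enum /=; apply/matrixP => i j; rewrite summxE (bigD1 i) //=.
rewrite big1 ?addr0 => [|c nc]; last by rewrite mxE eq_sym (negbTE nc).
by rewrite !mxE eqxx /= [j == i]eq_sym; case: (i == j).
Qed.

Local Close Scope ring_scope.

Definition term_code (t : term) : nat :=
  lcons (trow t) (lcons (tcol t) (lcons (tsign t) (word_code (tword t)))).

Definition terms_code (l : seq term) : nat := CodeSeq.code (map term_code l).

Definition prepend (w : word k) (x : nat) : nat :=
  foldr (fun l => lcons ((nat_of_ord l.1).*2 + nat_of_bool l.2)) x w.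

Definition tmul_code (e : term) (p : nat) : nat :=
  lcons (trow e) (lcons (hd (tl p))
    (lcons (if tsign e then 1 - hd (tl (tl p)) else hd (tl (tl p)))
           (prepend (tword e) (tl (tl (tl p)))))).

Lemma tmul_codeE e p : tmul_code e (term_code p) = term_code (tmul e p).
Proof.
rewrite /tmul_code /term_code /=; rewrite !(hd_lcons, tl_lcons).
congr (lcons _ (lcons _ (lcons _ _))).
  by rewrite [tsign (tmul e p)](_ : _ = tsign e (+) tsign p) //; case: (tsign e); case: (tsign p).
rewrite /word_code map_cat; elim: (tword e) => //= l w ->.
by rewrite -code_cons.
Qed.

Definition extend_code (L : seq term) (acc p : nat) : nat :=
  foldl (fun acc e => if tcol e == hd p :> nat
                      then lcons (tmul_code e p) acc else acc) acc L.

Lemma extend_codeE L acc p :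
  extend_code L (terms_code acc) (term_code p) = terms_code (extend L acc p).
Proof.
have hdE : hd (term_code p) = trow p by rewrite hd_lcons.
rewrite /extend_code /extend hdE; elim: L acc => //= e L IH acc.
rewrite (inj_eq val_inj) tmul_codeE -IH; congr (foldl _ _ _).
by case: ifP => // _; rewrite -code_cons.
Qed.

Definition terms_mul_code (L : seq term) (x : nat) : nat :=
  foldl (extend_code L) 0 (CodeSeq.decode x).

Lemma terms_mul_codeE L l :
  terms_mul_code L (terms_code l) = terms_code (terms_mul L l).
Proof.
rewrite /terms_mul_code /terms_mul /terms_code CodeSeq.codeK.
rewrite -[0]/(terms_code [::]); elim: l [::] => //= p l IH acc.
by rewrite extend_codeE IH.
Qed.

(** Words enter multiplication only through concatenation; the word problem is
    consulted only here, to read off the trace. *)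
Definition closed_path (b p : nat) : bool :=
  [&& hd p == hd (tl p), hd (tl (tl p)) == b &
      word_problem s (tl (tl (tl p))) == 1].

Definition closed_paths (b : nat) (x : nat) : nat :=
  foldl (fun acc p => acc + closed_path b p) 0 (CodeSeq.decode x).

Lemma closed_pathsE l : gr_trace (terms_val l) =
  ((closed_paths 0 (terms_code l))%:Z - (closed_paths 1 (terms_code l))%:Z)%R.
Proof.
rewrite /closed_paths /terms_code CodeSeq.codeK.
suff H a b : ((a%:Z - b%:Z) + gr_trace (terms_val l))%R =
    ((foldl (fun acc p => acc + closed_path 0 p)%N a (map term_code l))%:Z -
     (foldl (fun acc p => acc + closed_path 1 p)%N b (map term_code l))%:Z)%R.
  by rewrite -H subrr add0r.
elim: l a b => [|t l IH] a b; first by rewrite terms_val_nil gr_trace0 addr0.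
rewrite [RHS]/= -IH terms_val_cons gr_traceD tval_trace addrA; congr (_ + _)%R.
rewrite /closed_path /term_code !(hd_lcons, tl_lcons) word_problemE (inj_eq val_inj).
rewrite eqb0 !eqb1.
case: (trow t == tcol t) => /=; last by rewrite !addn0 addr0.
case: (word_eval s _ == 1%g); last by rewrite !andbF !addn0 addr0.
by case: (tsign t); rewrite [nat_of_bool _]/= [nat_of_bool _]/= addn0 PoszD; ring.
Qed.

Lemma computable_extend_code g L acc p : computable g acc -> computable g p ->
  computable g (fun x => extend_code L (acc x) (p x)).
Proof.
move=> cacc cp; rewrite /extend_code; elim: L acc cacc => //= e L IH acc cacc.
apply: (IH (fun x => if _ then _ else acc x)).
have c1 := computable_tlf cp; have c2 := computable_tlf c1; have c3 := computable_tlf c2.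
apply: computable_if => //.
  exact: computable_eq (computable_const _ _) (computable_hdf cp).
apply: computable_lcons => //; apply: computable_lcons (computable_const _ _) _.
apply: computable_lcons; first exact: computable_hdf.
apply: computable_lcons.
  have ch := computable_hdf c2; case: (tsign e) => //.
  exact: computable_sub (computable_const _ _) ch.
rewrite /prepend; elim: (tword e) => //= l w IHw.
exact: computable_lcons (computable_const _ _) IHw.
Qed.

Lemma computable_terms_mul_code g L : computable g (terms_mul_code L).
Proof.
apply: (@computable_foldl g (fun=> extend_code L) (fun=> 0) id).
- have ct := computable_tl g; apply: computable_extend_code.
    exact: computable_hdf.
  exact: computable_tlf.
- exact: computable_const.
- exact: computable_id.
Qed.

Lemma computable_closed_paths g b :
  computable g (word_problem s) -> computable g (closed_paths b).
Proof.
move=> cwp; apply: (@computable_foldl g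
  (fun _ acc p => acc + closed_path b p) (fun=> 0) id).
- have ct := computable_tl g; have cp := computable_tlf ct.
  have c1 := computable_tlf cp; have c2 := computable_tlf c1; have c3 := computable_tlf c2.
  apply: computable_add; first exact: computable_hdf.
  apply: computable_and; first exact: computable_eq (computable_hdf cp) (computable_hdf c1).
  apply: computable_and; first exact: computable_eq (computable_hdf c2) (computable_const _ _).
  apply: computable_eq (computable_const _ _); exact: computable_comp cwp c3.
- exact: computable_const.
- exact: computable_id.
Qed.

(** [B ^+ n] is a sum over the paths of [n] terms of [B]; its trace counts, with
    signs, the closed paths whose word represents 1. *)
Lemma rat_computable_trace_expr g (B : 'M[grpalg int G]_m) :
    generates s -> computable g (word_problem s) ->
  rat_computable g (fun n => (gr_trace (B ^+ n))%:~R)%R.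
Proof.
move=> gen cwp; have [L LE] := terms_val_exists B gen.
pose x n := iter n (terms_mul_code L) (terms_code terms1).
have cx : computable g x.
  apply: (@computable_iter g (fun=> terms_mul_code L) id (fun=> terms_code terms1)).
  - exact: computable_comp (computable_terms_mul_code g L) (computable_tl g).
  - exact: computable_id.
  - exact: computable_const.
apply: (@rat_computable_of g _ (fun n => closed_paths 0 (x n))
  (fun n => closed_paths 1 (x n)) (fun=> 1)) => //.
- exact: computable_comp (computable_closed_paths 0 cwp) cx.
- exact: computable_comp (computable_closed_paths 1 cwp) cx.
- exact: computable_const.
move=> n; rewrite divr1 -intrB; congr (_%:~R)%R.
have [l -> <-] : exists2 l, x n = terms_code l & terms_val l = (B ^+ n)%R.
  elim: n => [|n [l xn lE]]; first by exists terms1; rewrite // terms_val1 expr0.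
  exists (terms_mul L l); first by rewrite /x iterS -/(x n) xn terms_mul_codeE.
  by rewrite terms_val_mul LE lE exprS.
exact: closed_pathsE.
Qed.

End TracePowers.

(** * Adjoints and traces over the group ring *)

Local Open Scope ring_scope.

Section GroupRingAlgebra.
Variables (G : groupType).
Implicit Types (K L : comNzRingType).

Lemma gr_mulU K (c d : K) (g h : G) :
  (<< c *g g >> : grpalg K G) * << d *g h >> = << c * d *g (g * h)%g >>.
Proof. exact: gr_mulUU. Qed.

Lemma mcoeff_gr_map K L (f : {rmorphism K -> L}) (a : grpalg K G) g :
  (gr_map f a)@_g = f a@_g.
Proof.
rewrite /gr_map raddf_sum /=; have [gin|gout] := boolP (g \in msupp a).
  rewrite (bigD1_seq g) ?fset_uniq //= mcoeffUU big1 ?addr0 // => h nh.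
  by rewrite mcoeffU (negbTE nh).
rewrite (mcoeff_outdom gout) rmorph0 big_seq big1 // => h hin.
by rewrite mcoeffU; case: eqP => // hg; rewrite hg (negbTE gout) in hin.
Qed.

Lemma mcoeff_gr_inv K (a : grpalg K G) g : (gr_inv a)@_g = a@_(g^-1)%g.
Proof.
rewrite /gr_inv raddf_sum /=; have [gin|gout] := boolP ((g^-1)%g \in msupp a).
  rewrite (bigD1_seq (g^-1)%g) ?fset_uniq //= invgK mcoeffUU big1 ?addr0 // => h nh.
  rewrite mcoeffU; case: eqP => // hg; case/eqP: nh.
  by rewrite -hg invgK.
rewrite (mcoeff_outdom gout) big_seq big1 // => h hin.
rewrite mcoeffU; case: eqP => // hg.
by rewrite -hg invgK hin in gout.
Qed.

Lemma gr_mapD K L (f : {rmorphism K -> L}) : {morph @gr_map K L G f : a b / a + b}.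
Proof. by move=> a b; apply/malgP => g; rewrite mcoeffD !mcoeff_gr_map mcoeffD rmorphD. Qed.

Lemma gr_map0 K L (f : {rmorphism K -> L}) : @gr_map K L G f 0 = 0.
Proof. by apply/malgP => g; rewrite mcoeff_gr_map !mcoeff0 rmorph0. Qed.

Lemma gr_invD K : {morph @gr_inv K G : a b / a + b}.
Proof. by move=> a b; apply/malgP => g; rewrite mcoeffD !mcoeff_gr_inv mcoeffD. Qed.

Lemma gr_inv0 K : @gr_inv K G 0 = 0.
Proof. by apply/malgP => g; rewrite mcoeff_gr_inv !mcoeff0. Qed.

Lemma gr_mapU K L (f : {rmorphism K -> L}) c (g : G) :
  gr_map f << c *g g >> = << f c *g g >>.
Proof.
apply/malgP => h; rewrite mcoeff_gr_map !mcoeffU.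
by case: (g == h); rewrite ?mulr1n ?mulr0n ?rmorph0.
Qed.

Lemma gr_invU K (c : K) (g : G) : gr_inv << c *g g >> = << c *g (g^-1)%g >>.
Proof.
apply/malgP => h; rewrite mcoeff_gr_inv !mcoeffU.
by rewrite -(inj_eq invg_inj) invgK.
Qed.

Lemma gr_ind K (P : grpalg K G -> Prop) :
    P 0 -> (forall a b, P a -> P b -> P (a + b)) ->
    (forall c g, P << c *g g >>) -> forall a, P a.
Proof. by move=> P0 PD PU a; rewrite [a]monalgE; apply: big_ind. Qed.

Lemma gr_mapM K L (f : {rmorphism K -> L}) : {morph @gr_map K L G f : a b / a * b}.
Proof.
move=> a b; elim/gr_ind: a => [|a1 a2 IH1 IH2|c g].
- by rewrite mul0r gr_map0 mul0r.
- by rewrite mulrDl !gr_mapD IH1 IH2 mulrDl.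
elim/gr_ind: b => [|b1 b2 IH1 IH2|d h].
- by rewrite mulr0 gr_map0 mulr0.
- by rewrite mulrDr !gr_mapD IH1 IH2 mulrDr.
by rewrite !gr_mapU !gr_mulU gr_mapU rmorphM.
Qed.

Lemma gr_invM K (a b : grpalg K G) : gr_inv (a * b) = gr_inv b * gr_inv a.
Proof.
elim/gr_ind: a => [|a1 a2 IH1 IH2|c g].
- by rewrite mul0r gr_inv0 mulr0.
- by rewrite mulrDl !gr_invD IH1 IH2 mulrDr.
elim/gr_ind: b => [|b1 b2 IH1 IH2|d h].
- by rewrite mulr0 gr_inv0 mul0r.
- by rewrite mulrDr !gr_invD IH1 IH2 mulrDl.
by rewrite !gr_invU !gr_mulU gr_invU invgM mulrC.
Qed.

Lemma mcoeff_gr_mul K (a b : grpalg K G) g :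
  (a * b)@_g = \sum_(h <- msupp b) a@_(g * h^-1)%g * b@_h.
Proof.
elim/gr_ind: a => [|a1 a2 IH1 IH2|c k].
- by rewrite mul0r mcoeff0 big1 // => h _; rewrite mcoeff0 mul0r.
- rewrite mulrDl mcoeffD IH1 IH2 -big_split; apply: eq_bigr => h _.
  by rewrite mcoeffD mulrDl.
rewrite {1}[b]monalgE mulr_sumr raddf_sum; apply: eq_bigr => h _ /=.
rewrite gr_mulU !mcoeffU -mulrnAl; congr (_ *+ _ * _).
by congr nat_of_bool; apply/eqP/eqP => [<-|->]; rewrite ?mulgK ?mulgVK.
Qed.

Lemma gr_invK K : involutive (@gr_inv K G).
Proof. by move=> a; apply/malgP => g; rewrite !mcoeff_gr_inv invgK. Qed.

Lemma gr_inv1 K : gr_inv 1 = 1 :> grpalg K G.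
Proof. by rewrite [LHS]gr_invU invg1. Qed.

Lemma gr_adj_mul K m n p (X : 'M[grpalg K G]_(m, n)) (Y : 'M[grpalg K G]_(n, p)) :
  gr_adj (X *m Y) = gr_adj Y *m gr_adj X.
Proof.
apply/matrixP => i j; rewrite !mxE (big_morph _ (@gr_invD K) (gr_inv0 K)).
by apply: eq_bigr => l _; rewrite !mxE gr_invM.
Qed.

Lemma gr_adjK K m n (X : 'M[grpalg K G]_(m, n)) : gr_adj (gr_adj X) = X.
Proof. by apply/matrixP => i j; rewrite !mxE gr_invK. Qed.

Lemma gr_adjD K m n : {morph @gr_adj K G m n : X Y / X + Y}.
Proof. by move=> X Y; apply/matrixP => i j; rewrite !mxE gr_invD. Qed.

Lemma gr_adj0 K m n : @gr_adj K G m n 0 = 0.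
Proof. by apply/matrixP => i j; rewrite !mxE gr_inv0. Qed.

Lemma gr_adjN K m n (X : 'M[grpalg K G]_(m, n)) : gr_adj (- X) = - gr_adj X.
Proof. by apply/eqP; rewrite -addr_eq0 -gr_adjD addNr gr_adj0. Qed.

Lemma gr_adjMn K m n (X : 'M[grpalg K G]_(m, n)) c : gr_adj (X *+ c) = gr_adj X *+ c.
Proof. by elim: c => [|c IHc]; rewrite ?gr_adj0 // !mulrS gr_adjD IHc. Qed.

Lemma gr_adj1 K m : gr_adj 1 = 1 :> 'M[grpalg K G]_m.
Proof.
apply/matrixP => i j; rewrite !mxE eq_sym.
by case: (i == j); rewrite ?mulr1n ?mulr0n ?gr_inv1 ?gr_inv0.
Qed.

Lemma gr_adj_expr K m (X : 'M[grpalg K G]_m) a : gr_adj (X ^+ a) = gr_adj X ^+ a.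
Proof.
elim: a => [|a IHa]; first by rewrite !expr0 gr_adj1.
by rewrite exprSr [LHS](gr_adj_mul (X ^+ a) X) IHa exprS.
Qed.

Lemma gr_adj_nat K m c : gr_adj c%:R = c%:R :> 'M[grpalg K G]_m.
Proof. by rewrite gr_adjMn gr_adj1. Qed.

Lemma gr_traceN K m (X : 'M[grpalg K G]_m) : gr_trace (- X) = - gr_trace X.
Proof. by apply/eqP; rewrite -addr_eq0 -gr_traceD addNr gr_trace0. Qed.

Lemma gr_traceMn K m (X : 'M[grpalg K G]_m) c : gr_trace (X *+ c) = gr_trace X *+ c.
Proof. by elim: c => [|c IHc]; rewrite ?gr_trace0 // !mulrS gr_traceD IHc. Qed.

Lemma gr_mul_inv_coef1 K (a : grpalg K G) :
  (a * gr_inv a)@_(1%g) = \sum_(g <- msupp a) a@_g ^+ 2.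
Proof.
rewrite -[a * _]/(gr_mul a (gr_inv a)) {1}[a]monalgE gr_mul_suml raddf_sum.
apply: eq_big_seq => g gin /=.
rewrite /gr_inv gr_mul_sumr raddf_sum (bigD1_seq g) ?fset_uniq //=.
rewrite big1 => [|h nh]; last first.
  rewrite gr_mulUU mcoeffU; case: eqP => // gh; case/eqP: nh.
  by apply/esym/eqP; rewrite -divg_eq1 gh.
by rewrite gr_mulUU mulgV mcoeffUU addr0.
Qed.

(** This trace is the square of a Hilbert-Schmidt norm. It is the source of all
    norm estimates. *)
Lemma gr_trace_adj K m n (X : 'M[grpalg K G]_(m, n)) :
  gr_trace (X *m gr_adj X) =
  \sum_(i < m) \sum_(j < n) \sum_(g <- msupp (X i j)) (X i j)@_g ^+ 2.
Proof.
apply: eq_bigr => i _; rewrite mxE raddf_sum; apply: eq_bigr => j _ /=.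
by rewrite !mxE -gr_mul_inv_coef1.
Qed.

End GroupRingAlgebra.

(** * Powers of a positive matrix below a multiple of the identity *)

Section ShiftedPowers.
Variables (R : realType) (G : groupType) (m n : nat).
Variables (A : 'M[grpalg int G]_(m, n)) (K : nat).
Hypothesis K0 : (0 < K)%N.

(** For [K] at least the norm of the Laplacian, the powers of this matrix divided
    by [K] have spectral functions [(1 - x / K) ^+ a] with values in the unit
    interval, which decrease to the indicator function of 0. *)
Definition shifted : 'M[grpalg int G]_m := K%:R - A *m gr_adj A.

Local Notation E := shifted.

Definition shifted_trace (a : nat) : R := (gr_trace (E ^+ a))%:~R / K%:R ^+ a.

Definition shifted_entry (a : nat) (i j : 'I_m) (g : G) : R :=
  (((E ^+ a) i j)@_g)%:~R / K%:R ^+ a.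

Local Notation u := shifted_trace.
Local Notation y := shifted_entry.

Let KR0 : 0 < K%:R :> R. Proof. by rewrite ltr0n. Qed.

Lemma gr_trace_adj_ge0 p q (X : 'M[grpalg int G]_(p, q)) :
  0 <= gr_trace (X *m gr_adj X).
Proof.
rewrite gr_trace_adj; do 2 apply: sumr_ge0 => ? _.
by apply: sumr_ge0 => g _; exact: sqr_ge0.
Qed.

Lemma row_le_trace_adj p q (X : 'M[grpalg int G]_(p, q)) i (F : seq G) : uniq F ->
  \sum_(j < q) \sum_(g <- F) (X i j)@_g ^+ 2 <= gr_trace (X *m gr_adj X).
Proof.
move=> uF; rewrite gr_trace_adj (bigD1 i) //= -[leLHS]addr0; apply: lerD; last first.
  do 2 apply: sumr_ge0 => ? _; by apply: sumr_ge0 => g _; exact: sqr_ge0.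
apply: ler_sum => j _; rewrite (bigID (fun g => g \in msupp (X i j))) /=.
rewrite [X in _ + X]big1 ?addr0 => [|g /mcoeff_outdom->]; last by rewrite expr0n.
rewrite -big_filter [leRHS](bigID (fun g => g \in F)) /= -[X in _ <= X + _]big_filter.
rewrite (perm_big [seq g <- msupp (X i j) | g \in F]) /=; last first.
  apply: uniq_perm; rewrite ?filter_uniq ?fset_uniq // => g.
  by rewrite !mem_filter andbC.
by rewrite lerDl; apply: sumr_ge0 => g _; exact: sqr_ge0.
Qed.

Lemma coef_le_trace_adj p q (X : 'M[grpalg int G]_(p, q)) i j g :
  (X i j)@_g ^+ 2 <= gr_trace (X *m gr_adj X).
Proof.
apply: le_trans (row_le_trace_adj X i (F := [:: g]) isT).
rewrite (bigD1 j) //= big_seq1 lerDl; apply: sumr_ge0 => ? _.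
by rewrite big_seq1 sqr_ge0.
Qed.

Lemma gr_adj_shifted : gr_adj E = E.
Proof. by rewrite gr_adjD gr_adj_nat gr_adjN gr_adj_mul gr_adjK. Qed.

Lemma gr_adj_shiftedX a : gr_adj (E ^+ a) = E ^+ a.
Proof. by rewrite gr_adj_expr gr_adj_shifted. Qed.

(** The matrix is self-adjoint, so the squared Hilbert-Schmidt norm of its [a]-th
    power is the trace of the power [a + a]. *)
Lemma shifted_entry_bound a i (F : seq G) : uniq F ->
  \sum_(j < m) \sum_(g <- F) y a i j g ^+ 2 <= u (a + a).
Proof.
move=> uF; have := row_le_trace_adj (E ^+ a) i uF.
rewrite gr_adj_shiftedX [_ *m _](_ : _ = E ^+ (a + a)); last by rewrite exprD.
rewrite -(ler_int R) => le; rewrite /u ler_pdivlMr ?exprn_gt0 // [in leLHS]exprD.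
apply: le_trans _ le; rewrite [leRHS]raddf_sum mulr_suml; apply: ler_sum => j _ /=.
rewrite raddf_sum mulr_suml; apply: ler_sum => g _ /=.
by rewrite /y expr_div_n -expr2 divfK ?expf_neq0 ?lt0r_neq0 // rmorphXn.
Qed.

Lemma commrB_sqr (S : pzRingType) (x z : S) (p q : nat) : GRing.comm x z ->
  (x *+ p - z *+ q) * (x *+ p - z *+ q) =
  x * x *+ (p * p) - x * z *+ (p * q) *+ 2 + z * z *+ (q * q).
Proof.
move=> cxz; rewrite mulrBl !mulrBr !(mulrnAl, mulrnAr) -!mulrnA -cxz.
rewrite [(q * p)%N]mulnC muln2 -addnn mulrnDr opprB opprD.
by rewrite !addrA addrAC.
Qed.

Lemma rescale_dist (x z ta tab tb p q : R) : p != 0 -> q != 0 ->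
    (x * p - z * q) ^+ 2 <=
      ta * (p * p) - tab * (p * q) * 2%:R + tb * (q * q) ->
  (x / q - z / p) ^+ 2 <= ta / (q * q) - tab / (q * p) *+ 2 + tb / (p * p).
Proof.
move=> p0 q0 le; rewrite -(ler_pM2r (_ : 0 < (p * q) ^+ 2)); last first.
  by rewrite exprn_even_gt0 // mulf_neq0.
have -> : (x / q - z / p) ^+ 2 * (p * q) ^+ 2 = (x * p - z * q) ^+ 2.
  by field; rewrite p0.
apply: le_trans le _; rewrite le_eqVlt; apply/orP; left; apply/eqP.
by field; rewrite p0.
Qed.

(** The same norm of the difference of two scaled powers, expanded; if the traces
    converge, then the powers form a Cauchy sequence. *)
Lemma shifted_entry_dist a b i j g :
  (y a i j g - y b i j g) ^+ 2 <= u (a + a) - u (a + b) *+ 2 + u (b + b).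
Proof.
pose p := (K ^ b)%N; pose q := (K ^ a)%N.
pose X := E ^+ a *+ p - E ^+ b *+ q.
have := coef_le_trace_adj X i j g.
have -> : gr_adj X = X by rewrite gr_adjD gr_adjN !gr_adjMn !gr_adj_shiftedX.
have -> : X *m X = E ^+ (a + a) *+ (p * p) - E ^+ (a + b) *+ (p * q) *+ 2
    + E ^+ (b + b) *+ (q * q).
  by rewrite [LHS]commrB_sqr ?exprD //; exact: commrX (commr_sym (commrX _ (commr_refl _))).
have castM (c : int) (r : nat) : (c *+ r)%:~R = c%:~R * r%:R :> R.
  by rewrite rmorphMn /= mulr_natr.
have powE c : K%:R ^+ c = (K ^ c)%N%:R :> R by rewrite natrX.
rewrite gr_traceD gr_traceD gr_traceN !gr_traceMn.
rewrite /X mxE [X in (_ + X)@_g]mxE !mulmxnE mcoeffB !mcoeffMn -(ler_int R).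
rewrite rmorphXn /= !intrD !rmorphN /= !castM (natrM _ p p) (natrM _ p q) (natrM _ q q) => le.
rewrite /y /u !powE !expnD !natrM.
by apply: rescale_dist le; rewrite pnatr_eq0 -lt0n expn_gt0 K0.
Qed.

(** The Laplacian is [K] minus the shifted matrix, so that the squared norm of
    the product with [A] telescopes. *)
Lemma shifted_entry_mulA a i j g :
  ((((E ^+ a *m A) i j)@_g)%:~R / K%:R ^+ a) ^+ 2 <= K%:R * (u (a + a) - u (a + a).+1).
Proof.
have := coef_le_trace_adj (E ^+ a *m A) i j g.
rewrite gr_adj_mul gr_adj_shiftedX mulmxA -(mulmxA _ A).
rewrite (_ : A *m gr_adj A = K%:R - E); last by rewrite /E opprB addrC subrK.
rewrite -[_ *m _ *m _]/(_ * _ * _) mulrBr mulrBl mulr_natr mulrnAl -exprD -exprSr -exprD.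
rewrite addSn gr_traceD gr_traceN gr_traceMn -(ler_int R) rmorphB rmorphMn rmorphXn /=.
move=> le; rewrite expr_div_n ler_pdivrMr ?exprn_gt0 //.
apply: le_trans le _; rewrite le_eqVlt; apply/orP; left; apply/eqP.
have powE : K%:R ^+ (a + a) = K%:R ^+ a ^+ 2 :> R by rewrite exprD expr2.
rewrite /u [K%:R ^+ (a + a).+1]exprS powE -mulr_natr.
have : K%:R != 0 :> R by rewrite pnatr_eq0 -lt0n.
move: (_%:~R) (_%:~R) => t t'; move: (K%:R) => c c0; field.
by rewrite expf_neq0.
Qed.

(** The identity minus a power vanishes at the spectral value 0, so it factors
    through the Laplacian and acts as 0 on the kernel of [A]. *)
Lemma shifted_factor a :
  exists C : 'M[grpalg int G]_(m, n), (K ^ a)%:R - E ^+ a = C *m gr_adj A.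
Proof.
suff [S SE] : exists S, (K ^ a)%:R - E ^+ a = S * (K%:R - E).
  by exists (S *m A); rewrite SE -mulmxA /E opprB addrC subrK.
elim: a => [|a [S SE]]; first by exists 0; rewrite expr0 mul0r subrr.
exists (S * K%:R + E ^+ a); rewrite mulrDl -mulrA -[K%:R * _]commr_nat mulrA -SE.
by rewrite mulrBl mulrBr -exprSr expnSr natrM addrA subrK.
Qed.

End ShiftedPowers.

(** * Unordered sums and weak limits *)

Local Open Scope classical_set_scope.

Section UnorderedSums.
Variables (R : realType) (T : choiceType).
Implicit Types (f h : T -> R) (F : {fset T}).

Definition abs_bounded f : Prop :=
  exists M : R, forall F, \sum_(t <- F) `|f t| <= M.

(** Convergence along the directed set of finite subsets. It makes linearity and
    uniqueness evident, unlike the difference of two suprema in [real_sum]. *)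
Definition has_sum f (L : R) : Prop :=
  forall e, 0 < e -> exists F0 : {fset T}, forall F, (F0 `<=` F)%fset ->
    `|L - \sum_(t <- F) f t| <= e.

Lemma sum_fset_split f F F' : (F `<=` F')%fset ->
  \sum_(t <- F') f t = \sum_(t <- F) f t + \sum_(t <- (F' `\` F)%fset) f t.
Proof.
move=> /fsetIidPr FF'; rewrite (big_fsetID _ (fun t => t \in F)) /=.
congr (_ + _); apply: perm_big; apply: uniq_perm; rewrite ?fset_uniq // => t.
  by rewrite !inE -[in RHS]FF' inE.
by rewrite !inE andbC.
Qed.

Lemma ler_sum_fset f F F' : (forall t, 0 <= f t) -> (F `<=` F')%fset ->
  \sum_(t <- F) f t <= \sum_(t <- F') f t.
Proof.
by move=> f0 /sum_fset_split->; rewrite lerDl; apply: sumr_ge0.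
Qed.

Lemma esum_le_fset f M : (forall F, \sum_(t <- F) f t <= M) ->
  (\esum_(t in [set: T]) (f t)%:E <= M%:E)%E.
Proof.
move=> fM; apply: ub_ereal_sup => _ [A [finA _] <-].
by rewrite fsbig_finite // sumEFin lee_fin.
Qed.

Lemma esum_fset_le f F : (\sum_(t <- F) (f t)%:E <= \esum_(t in [set: T]) (f t)%:E)%E.
Proof.
apply: esum_ge; exists [set` F]; first by split; [exact: finite_fset | ].
by rewrite fsbig_finite ?set_fsetK //; exact: finite_fset.
Qed.

Lemma has_sum_esum f M : (forall t, 0 <= f t) ->
  (forall F, \sum_(t <- F) f t <= M) ->
  has_sum f (fine (\esum_(t in [set: T]) (f t)%:E)).
Proof.
move=> f0 fM; set S := (\esum_(t in _) _)%E.
have Sfin : S \is a fin_num.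
  rewrite ge0_fin_numE; last by apply: esum_ge0 => t _; rewrite lee_fin.
  exact: le_lt_trans (esum_le_fset fM) (ltry _).
move=> e e0; have [_ [A [finA _] <-] lt] := ub_ereal_sup_adherent e0 Sfin.
exists (fset_set A) => F AF; have := esum_fset_le f F.
rewrite -/S -(fineK Sfin) sumEFin lee_fin => le.
rewrite ger0_norm ?subr_ge0 // lerBlDr -lerBlDl ltW //.
move: lt; rewrite -/(esum _ _) -/S -(fineK Sfin) fsbig_finite // sumEFin -EFinB lte_fin.
by move=> /lt_le_trans; apply; exact: ler_sum_fset.
Qed.

Lemma abs_boundedD f h : abs_bounded f -> abs_bounded h ->
  abs_bounded (fun t => f t + h t).
Proof.
move=> [M fM] [N hN]; exists (M + N) => F; apply: le_trans (lerD (fM F) (hN F)).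
by rewrite -big_split; apply: ler_sum => t _; exact: ler_normD.
Qed.

Lemma has_sum_unique f L L' : has_sum f L -> has_sum f L' -> L = L'.
Proof.
move=> fL fL'; apply/eqP; rewrite -subr_eq0 -normr_eq0.
apply/eqP/le_anti; rewrite normr_ge0 andbT; apply/ler_addgt0Pl => e e0; rewrite addr0.
have e20 : 0 < e / 2 by rewrite divr_gt0.
have [F0 F0L] := fL _ e20; have [F1 F1L] := fL' _ e20.
have := F0L _ (fsubsetUl F0 F1); have := F1L _ (fsubsetUr F0 F1).
set s := \sum_(_ <- _) _ => h1 h2; rewrite (splitr e).
rewrite (_ : L - L' = (L - s) - (L' - s)); last by rewrite opprB addrA subrK.
by apply: le_trans (ler_normB _ _) _; exact: lerD.
Qed.

Lemma has_sumD f h L L' : has_sum f L -> has_sum h L' ->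
  has_sum (fun t => f t + h t) (L + L').
Proof.
move=> fL fL' e e0; have e20 : 0 < e / 2 by rewrite divr_gt0.
have [F0 F0L] := fL _ e20; have [F1 F1L] := fL' _ e20.
exists (F0 `|` F1)%fset => F; rewrite fsubUset => /andP[le0 le1].
rewrite big_split opprD addrACA (splitr e).
by apply: le_trans (ler_normD _ _) _; apply: lerD; [exact: F0L | exact: F1L].
Qed.

Lemma has_sumN f L : has_sum f L -> has_sum (fun t => - f t) (- L).
Proof.
move=> fL e /fL[F0 F0L]; exists F0 => F /F0L.
by rewrite sumrN -opprD normrN.
Qed.

Lemma has_sum_fset f F0 : (forall t, t \notin F0 -> f t = 0) ->
  has_sum f (\sum_(t <- F0) f t).
Proof.
move=> f0 e e0; exists F0 => F F0F; rewrite (sum_fset_split _ F0F) opprD addrA subrr.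
rewrite sub0r normrN big_seq big1 ?normr0 ?ltW // => t.
by rewrite inE => /andP[/f0].
Qed.

Lemma has_sum_sum (I : Type) (r : seq I) (f : I -> T -> R) (L : I -> R) :
    (forall i, has_sum (f i) (L i)) ->
  has_sum (fun t => \sum_(i <- r) f i t) (\sum_(i <- r) L i).
Proof.
move=> fL; elim: r => [|i r IH].
  have := @has_sum_fset (fun=> 0) fset0 (fun _ _ => erefl).
  by rewrite !big_nil; congr (has_sum _ _); apply/funext => t; rewrite big_nil.
rewrite big_cons; have := has_sumD (fL i) IH; congr (has_sum _ _).
by apply/funext => t; rewrite big_cons.
Qed.

Lemma has_sum_ge f L t : (forall t, 0 <= f t) -> has_sum f L -> f t <= L.
Proof.
move=> f0 fL; apply/ler_addgt0Pl => e /fL[F0 F0L].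
have := F0L _ (fsubsetUl F0 [fset t]%fset).
set s := \sum_(_ <- _) _ => h; have : f t <= s.
  rewrite /s (sum_fset_split f (fsubsetUr F0 [fset t]%fset)) big_seq_fset1 lerDl.
  exact: sumr_ge0.
by move/le_trans; apply; rewrite -lerBlDr; apply: le_trans h; rewrite distrC ler_norm.
Qed.

Lemma real_sumP f : abs_bounded f -> has_sum f (real_sum f).
Proof.
move=> [M fM]; rewrite /real_sum.
have pos h : (forall t, 0 <= h t <= `|f t|) ->
    has_sum h (fine (\esum_(t in [set: T]) (h t)%:E)).
  move=> hf; apply: (@has_sum_esum h M) => [t|F]; first by have /andP[] := hf t.
  by apply: le_trans (fM F); apply: ler_sum => t _; have /andP[] := hf t.
have hp : has_sum (fun t => Num.max (f t) 0) (fine (\esum_(t in [set: T]) (Num.max (f t) 0)%:E)).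
  by apply: pos => t; rewrite le_max lexx orbT /= ge_max ler_norm normr_ge0.
have hn : has_sum (fun t => Num.max (- f t) 0)
    (fine (\esum_(t in [set: T]) (Num.max (- f t) 0)%:E)).
  by apply: pos => t; rewrite le_max lexx orbT /= ge_max -normrN ler_norm normr_ge0.
have := has_sumD hp (has_sumN hn); congr (has_sum _ _); apply/funext => t.
case: (leP 0 (f t)) => ft.
  by rewrite max_r ?oppr_le0 // subr0.
by rewrite max_l ?oppr_ge0 ?ltW // opprK add0r.
Qed.

End UnorderedSums.

Section WeakLimit.
Variables (R : realType) (T : choiceType) (I : finType).
Implicit Types (d v : I -> T -> R).

Definition sq_bounded d (M : R) : Prop :=
  forall F : {fset T}, \sum_(t <- F) \sum_i d i t ^+ 2 <= M.

Lemma mul_le_sqr (x z e : R) : 0 < e -> `|x * z| <= e * x ^+ 2 + e^-1 * z ^+ 2.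
Proof.
move=> e0; rewrite normrM -[x ^+ 2]real_normK ?num_real // -[z ^+ 2]real_normK ?num_real //.
have := normr_ge0 x; have := normr_ge0 z; move: `|x| `|z| => {}x {}z z0 x0.
rewrite -(ler_pM2l e0) mulrDr [e * (_^-1 * _)]mulrA divff ?lt0r_neq0 // mul1r.
have := sqr_ge0 (e * x - z); have : 0 <= e * (x * z) by rewrite !mulr_ge0 // ltW.
nra.
Qed.

Lemma abs_bounded_mul d v M N i : sq_bounded d M -> sq_bounded v N ->
  abs_bounded (fun t => d i t * v i t).
Proof.
move=> dM vN; exists (M + N) => F; apply: le_trans (lerD (dM F) (vN F)).
rewrite -big_split; apply: ler_sum => t _ /=.
have := mul_le_sqr (d i t) (v i t) ltr01; rewrite invr1 !mul1r => /le_trans; apply.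
apply: lerD; rewrite (bigD1 i) //= lerDl; apply: sumr_ge0 => j _; exact: sqr_ge0.
Qed.

Lemma sq_boundedB d v M N : sq_bounded d M -> sq_bounded v N ->
  sq_bounded (fun i t => d i t - v i t) (2 * M + 2 * N).
Proof.
move=> dM vN F; apply: le_trans (lerD (ler_wpM2l (ler0n R 2) (dM F))
  (ler_wpM2l (ler0n R 2) (vN F))).
rewrite !mulr_sumr -big_split; apply: ler_sum => t _.
rewrite !mulr_sumr -big_split; apply: ler_sum => i _ /=.
by have := sqr_ge0 (d i t + v i t); nra.
Qed.

Lemma sq_bounded_fset d (F0 : {fset T}) : (forall i t, t \notin F0 -> d i t = 0) ->
  sq_bounded d (\sum_(t <- F0) \sum_i d i t ^+ 2).
Proof.
move=> d0 F; pose f t := \sum_i d i t ^+ 2.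
have f0 t : 0 <= f t by apply: sumr_ge0 => i _; exact: sqr_ge0.
apply: (le_trans (ler_sum_fset f0 (fsubsetUl F F0))).
rewrite (sum_fset_split f (fsubsetUr F F0)) [X in _ + X]big_seq [X in _ + X]big1 ?addr0 // => t.
by rewrite inE => /andP[tF0 _]; rewrite /f big1 // => i _; rewrite d0 // expr0n.
Qed.

(** The finite sum at which the supremum is almost attained leaves little for
    all sets that are disjoint from it. *)
Lemma sq_bounded_tail v N e : sq_bounded v N -> 0 < e ->
  exists F0 : {fset T}, forall F : {fset T}, (forall t, t \in F -> t \notin F0) ->
    \sum_(t <- F) \sum_i v i t ^+ 2 <= e.
Proof.
move=> vN e0; pose s t := \sum_i v i t ^+ 2.
have s0 t : 0 <= s t by apply: sumr_ge0 => i _; exact: sqr_ge0.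
have e20 : 0 < e / 2 by rewrite divr_gt0.
have [F0 F0P] := has_sum_esum s0 vN e20; set S := fine _ in F0P.
exists F0 => F dF; have h0 := F0P F0 (fsubset_refl _).
have sub : (F0 `<=` F0 `|` F)%fset by exact: fsubsetUl.
have := F0P _ sub; rewrite (sum_fset_split s sub).
have -> : ((F0 `|` F) `\` F0 = F)%fset.
  apply/fsetP => t; rewrite !inE; have := dF t.
  by case: (t \in F) => [/(_ isT)->|_]; rewrite ?orbT ?orbF ?andNb.
set a := \sum_(t <- F0) _ in h0 *; set b := \sum_(t <- F) _ => h1.
have : `|b| <= e.
  rewrite (_ : b = (S - a) - (S - (a + b))); last by ring.
  by apply: le_trans (ler_normB _ _) _; rewrite (splitr e); exact: lerD.
exact: le_trans (ler_norm _).
Qed.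

(** A bounded sequence that converges pointwise converges weakly: outside a
    finite set [v] is small, and on a finite set convergence is uniform.
    Weak convergence is what makes orthogonality pass to the limit. *)
Lemma weak_limit_orth d v (da : nat -> I -> T -> R) M N :
    (forall a, sq_bounded (da a) M) -> sq_bounded v N ->
    (forall i t, da ^~ i ^~ t @ \oo --> d i t) ->
    (forall a, exists2 D : {fset T}, (forall i t, t \notin D -> da a i t = 0) &
       \sum_(t <- D) \sum_i da a i t * v i t = 0) ->
  has_sum (fun t => \sum_i d i t * v i t) 0.
Proof.
move=> daM vN dad da0 e e0.
have M0 : 0 <= M by have := daM 0%N fset0; rewrite big_seq_fset0.
(* [c] balances the two halves of the error: [c * M] from the sequence, and a
   tail of size [e / 2 * c] divided by [c]. *)
pose c := e / (2 * (M + 1)).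
have M1 : 0 < M + 1 by rewrite ltr_wpDl.
have c0 : 0 < c by rewrite divr_gt0 // mulr_gt0.
have [|F0 F0v] := @sq_bounded_tail v N (e / 2 * c) vN; first by rewrite mulr_gt0 // divr_gt0.
exists F0 => F F0F; rewrite sub0r normrN.
have lim : `|\sum_(t <- F) \sum_i da a i t * v i t| @[a --> \oo] -->
    `|\sum_(t <- F) \sum_i d i t * v i t|.
  apply: cvg_norm; apply: cvg_big => [|t _]; first exact: add_continuous.
  apply: cvg_big => [|i _]; first exact: add_continuous.
  by apply: cvgMl; exact: dad.
apply: (cvgr_to_le lim); apply: nearW => a.
have [D D0 Dsum] := da0 a.
pose p t := \sum_i da a i t * v i t.
have : \sum_(t <- F) p t + \sum_(t <- (D `\` F)%fset) p t = 0.
  have -> : (D `\` F = (F `|` D) `\` F)%fset.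
    by apply/fsetP => t; rewrite !inE; case: (t \in F).
  rewrite -(sum_fset_split p (fsubsetUl F D)) (sum_fset_split p (fsubsetUr F D)).
  rewrite [X in X + _]Dsum add0r big_seq big1 // => t.
  by rewrite inE => /andP[/D0 Dt _]; rewrite /p big1 // => i _; rewrite Dt mul0r.
move/eqP; rewrite addr_eq0 => /eqP; rewrite -/(p _) => ->; rewrite normrN.
set F' := (D `\` F)%fset.
have : `|\sum_(t <- F') p t| <=
    c * (\sum_(t <- F') \sum_i da a i t ^+ 2) + c^-1 * (\sum_(t <- F') \sum_i v i t ^+ 2).
  rewrite !mulr_sumr -big_split; apply: le_trans (ler_norm_sum _ _ _) _.
  apply: ler_sum => t _ /=; rewrite !mulr_sumr -big_split.
  apply: le_trans (ler_norm_sum _ _ _) _; apply: ler_sum => i _ /=.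
  exact: mul_le_sqr.
move/le_trans; apply; rewrite (splitr e); apply: lerD.
  apply: le_trans (ler_wpM2l (ltW c0) (daM a F')) _.
  rewrite /c mulrAC ler_pdivrMr ?mulr_gt0 //.
  by rewrite (_ : e / 2 * _ = e * (M + 1)) ?ler_pM2l ?lerDl //; field.
rewrite mulrC ler_pdivrMr //; apply: F0v => t; rewrite inE => /andP[tF _].
by apply: contra tF; apply: fsubsetP.
Qed.

End WeakLimit.

(** * The inner product of square-summable functions *)

Section L2.
Variables (R : realType) (G : groupType).

Lemma ReD (x z : R[i]) : complex.Re (x + z) = complex.Re x + complex.Re z.
Proof. by case: x; case: z. Qed.

Lemma ImD (x z : R[i]) : complex.Im (x + z) = complex.Im x + complex.Im z.
Proof. by case: x; case: z. Qed.

Lemma Re_sum (I : Type) (r : seq I) (P : pred I) (F : I -> R[i]) :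
  complex.Re (\sum_(i <- r | P i) F i) = \sum_(i <- r | P i) complex.Re (F i).
Proof. exact: (big_morph _ ReD erefl). Qed.

Lemma Im_sum (I : Type) (r : seq I) (P : pred I) (F : I -> R[i]) :
  complex.Im (\sum_(i <- r | P i) F i) = \sum_(i <- r | P i) complex.Im (F i).
Proof. exact: (big_morph _ ImD erefl). Qed.

Lemma complexP (x z : R[i]) :
  complex.Re x = complex.Re z -> complex.Im x = complex.Im z -> x = z.
Proof. by case: x => a b; case: z => c d /= -> ->. Qed.

(** A complex family as a real family with twice as many components: all limits
    are taken over the reals. *)
Definition realify m (x : l2vec R G m) (c : 'I_m * bool) (g : G) : R :=
  if c.2 then complex.Im (x c.1 g) else complex.Re (x c.1 g).

Lemma sum_components m (F : 'I_m * bool -> R) :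
  \sum_c F c = \sum_i (F (i, false) + F (i, true)).
Proof.
transitivity (\sum_i \sum_b F (i, b)).
  by rewrite pair_bigA; apply: eq_bigr => -[].
by apply: eq_bigr => i _; rewrite big_bool addrC.
Qed.

Lemma l2P m (x : l2vec R G m) : l2 x <-> exists M, sq_bounded (realify x) M.
Proof.
have normE (z : R[i]) : complex.Re (`|z| ^+ 2) = complex.Re z ^+ 2 + complex.Im z ^+ 2.
  by rewrite -add_Re2_Im2.
pose p i g := complex.Re (`|x i g| ^+ 2).
have p0 i g : 0 <= p i g by rewrite /p normE addr_ge0 ?sqr_ge0.
have e0 i : (0 <= \esum_(g in [set: G]) (p i g)%:E)%E.
  by apply: esum_ge0 => g _; rewrite lee_fin.
have sumE (F : {fset G}) : \sum_(g <- F) \sum_c realify x c g ^+ 2 =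
    \sum_i \sum_(g <- F) p i g.
  rewrite [RHS]exchange_big; apply: eq_bigr => g _; rewrite sum_components.
  by apply: eq_bigr => i _; rewrite /p normE.
split=> [xl2|[M xM]].
  exists (fine (l2sq x)) => F; have fin : l2sq x \is a fin_num.
    by rewrite ge0_fin_numE //; apply: sume_ge0 => i _; exact: e0.
  rewrite -lee_fin fineK // sumE -sumEFin; apply: lee_sum => i _.
  rewrite -sumEFin; exact: esum_fset_le.
apply: (@le_lt_trans _ _ (\sum_(i < m) M%:E)%E); last by rewrite sumEFin ltry.
apply: lee_sum => i _; apply: esum_le_fset => F.
apply: le_trans (xM F); rewrite sumE (bigD1 i) //= lerDl.
by apply: sumr_ge0 => j _; apply: sumr_ge0.
Qed.

Lemma re_l2inner m (x v : l2vec R G m) : l2 x -> l2 v ->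
  has_sum (fun g => \sum_c realify x c g * realify v c g) (complex.Re (l2inner x v)).
Proof.
move=> /l2P[M xM] /l2P[N vN]; rewrite Re_sum.
have reE i g : complex.Re (x i g * (v i g)^*%C) =
    realify x (i, false) g * realify v (i, false) g +
    realify x (i, true) g * realify v (i, true) g.
  by rewrite /realify; case: (x i g) => a b; case: (v i g) => c d /=; rewrite mulrN opprK.
rewrite [X in has_sum X](_ : _ = fun g => \sum_(i < m) complex.Re (x i g * (v i g)^*%C)).
  apply: has_sum_sum => i; apply: real_sumP; under eq_fun do rewrite reE.
  by apply: abs_boundedD; apply: abs_bounded_mul xM vN.
by apply/funext => g; rewrite sum_components; apply: eq_bigr.
Qed.

Lemma im_l2inner m (x v : l2vec R G m) :
  complex.Im (l2inner x v) = complex.Re (l2inner x (fun i g => 'i%C * v i g)).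
Proof.
rewrite Im_sum Re_sum; apply: eq_bigr => i _ /=; congr real_sum; apply/funext => g.
case: (x i g) => a b; case: (v i g) => c d /=.
by rewrite !mul0r !mul1r sub0r add0r; ring.
Qed.

Lemma l2_mul_i m (v : l2vec R G m) : l2 v -> l2 (fun i g => 'i%C * v i g).
Proof.
move=> /l2P[M vM]; apply/l2P; exists M => F; rewrite (le_trans _ (vM F)) //.
apply: ler_sum => g _; rewrite !sum_components; apply: ler_sum => i _.
rewrite /realify /=; case: (v i g) => c d /=.
by rewrite !mul0r !mul1r sub0r add0r sqrrN addrC.
Qed.

Lemma l2B m (x v : l2vec R G m) : l2 x -> l2 v -> l2 (fun i g => x i g - v i g).
Proof.
move=> /l2P[M xM] /l2P[N vN]; apply/l2P; exists (2 * M + 2 * N) => F.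
rewrite (le_trans _ (sq_boundedB xM vN F)) // le_eqVlt; apply/orP; left; apply/eqP.
apply: eq_bigr => g _; apply: eq_bigr => c _; congr (_ ^+ 2); rewrite /realify.
by case: c.2; case: (x _ _) => ? ?; case: (v _ _) => ? ?.
Qed.

Lemma l2_basis m (i : 'I_m) : l2 (l2basis R G i).
Proof.
apply/l2P; exists (\sum_(g <- [fset 1%g]%fset) \sum_c realify (l2basis R G i) c g ^+ 2).
apply: sq_bounded_fset => c g; rewrite inE => /negbTE g1.
by rewrite /realify /l2basis g1 andbF; case: c.2.
Qed.

(** Orthogonality to a set that is stable under multiplication by the imaginary
    unit only has to be checked on real parts. *)
Lemma l2inner_eq0 m (x v : l2vec R G m) :
    complex.Re (l2inner x v) = 0 ->
    complex.Re (l2inner x (fun i g => 'i%C * v i g)) = 0 -> l2inner x v = 0.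
Proof. by move=> re0 im0; apply: complexP; rewrite // im_l2inner. Qed.

Lemma l2inner_self_eq0 m (x : l2vec R G m) : l2 x ->
  complex.Re (l2inner x x) = 0 -> x = (fun _ _ => 0).
Proof.
move=> xl2 x0; apply/funext => i; apply/funext => g.
have := re_l2inner xl2 xl2; rewrite x0 => hs.
have : \sum_c realify x c g * realify x c g <= 0.
  by apply: has_sum_ge hs => t; apply: sumr_ge0 => c _; rewrite -expr2 sqr_ge0.
have sq0 c : 0 <= realify x c g * realify x c g by rewrite -expr2 sqr_ge0.
move=> le0; have /eqP : \sum_c realify x c g * realify x c g = 0.
  by apply/le_anti; rewrite le0 sumr_ge0.
rewrite psumr_eq0 // => /allP all0.
have comp0 b : realify x (i, b) g = 0.
  by apply/eqP; rewrite -[_ == 0]orbb -mulf_eq0; exact: all0 (mem_index_enum _).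
by apply: complexP; [exact: (comp0 false) | exact: (comp0 true)].
Qed.

End L2.

(** * The projection onto the kernel as a weak limit *)

Section RealKernel.
Variables (R : realType) (G : groupType) (m n : nat).
Implicit Types (A : 'M[grpalg int G]_(m, n)) (w : 'I_m -> G -> R).

Definition real_mulmx A w (j : 'I_n) (g : G) : R :=
  \sum_(i < m) \sum_(h <- msupp (A i j)) w i (g * h^-1)%g * ((A i j)@_h)%:~R.

(** An integral matrix acts on real and imaginary parts separately. *)
Lemma realify_mulmx A (x : l2vec R G m) j b g :
  realify (l2_mulmx (gr_complex R A) x) (j, b) g =
  real_mulmx A (fun i => realify x (i, b)) j g.
Proof.
have coefE i h : (gr_complex R A i j)@_h = ((A i j)@_h)%:~R.
  by rewrite mxE; exact: (mcoeff_gr_map (intmul 1)).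
have suppE i : msupp (gr_complex R A i j) = msupp (A i j).
  by apply/fsetP => h; rewrite -!mcoeff_neq0 coefE intr_eq0.
have castE (z : int) : z%:~R = (z%:~R : R)%:C%C by rewrite rmorph_int.
rewrite /realify /=; case: b; rewrite /l2_mulmx ?Re_sum ?Im_sum; apply: eq_bigr => i _;
  rewrite ?Re_sum ?Im_sum suppE; apply: eq_bigr => h _; rewrite coefE castE;
  by case: (x i _) => a c /=; rewrite mulr0 ?subr0 ?add0r.
Qed.

Lemma l2_kerP A (x : l2vec R G m) : l2_ker (gr_complex R A) x <->
  l2 x /\ forall b j g, real_mulmx A (fun i => realify x (i, b)) j g = 0.
Proof.
split=> [[xl2 x0]|[xl2 x0]]; split=> //.
  by move=> b j g; rewrite -realify_mulmx x0 /realify; case: b.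
apply/funext => j; apply/funext => g; apply: complexP.
  exact: etrans (realify_mulmx A x j false g) (x0 _ _ _).
exact: etrans (realify_mulmx A x j true g) (x0 _ _ _).
Qed.

(** The bilinear pairing of finitely supported with arbitrary functions: it lets
    the algebra of the group ring act on elements of the kernel. *)
Definition gpair (a : grpalg int G) (phi : G -> R) : R :=
  \sum_(g <- msupp a) (a@_g)%:~R * phi g.

Lemma gpairw (F : {fset G}) (a : grpalg int G) phi : (msupp a `<=` F)%fset ->
  gpair a phi = \sum_(g <- F) (a@_g)%:~R * phi g.
Proof.
move=> aF; apply: big_fset_incl => // g _ /mcoeff_outdom->.
by rewrite mul0r.
Qed.

Lemma gpairD a b phi : gpair (a + b) phi = gpair a phi + gpair b phi.
Proof.
rewrite (gpairw (F := (msupp a `|` msupp b)%fset)) ?msuppD_le //.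
rewrite (gpairw phi (fsubsetUl (msupp a) (msupp b))).
rewrite (gpairw phi (fsubsetUr (msupp a) (msupp b))) -big_split.
by apply: eq_bigr => g _; rewrite mcoeffD rmorphD mulrDl.
Qed.

Lemma gpair0 phi : gpair 0 phi = 0.
Proof. by rewrite /gpair msupp0 big_seq_fset0. Qed.

Lemma gpairU c (g : G) phi : gpair << c *g g >> phi = c%:~R * phi g.
Proof. by rewrite (gpairw _ msuppU_le) big_seq_fset1 mcoeffUU. Qed.

Lemma gpair_sum (I : Type) (r : seq I) (a : I -> grpalg int G) phi :
  gpair (\sum_(i <- r) a i) phi = \sum_(i <- r) gpair (a i) phi.
Proof. by apply: (big_morph (gpair^~ phi)) => [a' b'|]; rewrite ?gpairD ?gpair0. Qed.

Lemma gpair_mul_inv a b phi : gpair (a * gr_inv b) phi =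
  gpair a (fun h => \sum_(t <- msupp b) phi (h * t^-1)%g * (b@_t)%:~R).
Proof.
elim/gr_ind: a => [|a1 a2 IH1 IH2|c g].
- by rewrite mul0r !gpair0.
- by rewrite mulrDl !gpairD IH1 IH2.
rewrite gpairU mulr_sumr /gr_inv mulr_sumr gpair_sum; apply: eq_bigr => t _.
by rewrite gr_mulU gpairU intrM -mulrA; congr (_ * _); rewrite mulrC.
Qed.

(** Right multiplication by the adjoint matrix is the adjoint operator. *)
Lemma gpair_mul_adj A (C : 'M[grpalg int G]_(m, n)) i w :
  \sum_(j < m) gpair ((C *m gr_adj A) i j) (w j) =
  \sum_(l < n) gpair (C i l) (real_mulmx A w l).
Proof.
transitivity (\sum_(j < m) \sum_(l < n) gpair (C i l)
  (fun h => \sum_(t <- msupp (A j l)) w j (h * t^-1)%g * ((A j l)@_t)%:~R)).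
  apply: eq_bigr => j _; rewrite mxE gpair_sum; apply: eq_bigr => l _.
  by rewrite !mxE gpair_mul_inv.
rewrite exchange_big; apply: eq_bigr => l _; rewrite /gpair exchange_big /=.
by apply: eq_bigr => h _; rewrite mulr_sumr.
Qed.

End RealKernel.

Section KernelProjection.
Variables (R : realType) (G : groupType) (m n : nat).
Variables (A : 'M[grpalg int G]_(m, n)) (K : nat) (l M : R).
Hypothesis K0 : (0 < K)%N.

Local Notation E := (shifted A K).
Local Notation u := (shifted_trace R A K).
Local Notation y := (shifted_entry R A K).
Local Notation V := (l2_ker (gr_complex R A)).

Hypothesis u_cvg : u @ \oo --> l.
Hypothesis u_le : forall a, u a <= M.

Lemma entry_is_cvg i j g : cvg (y a i j g @[a --> \oo]).
Proof.
apply/cauchy_cvgP/cauchy_exP => e e0.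
have e2 : 0 < e ^+ 2 / 5 by rewrite divr_gt0 // exprn_gt0.
have /cvgrPdist_lt/(_ _ e2)[N _ uN] := u_cvg.
exists (y N i j g); exists N => // a /= leNa; rewrite /ball /=.
rewrite -(ltr_pXn2r (n := 2)) ?nnegrE ?normr_ge0 ?ltW // real_normK ?num_real //.
apply: (le_lt_trans (shifted_entry_dist _ _ K0 _ _ _ _ _)).
have h k : (N <= k)%N -> `|l - u k| < e ^+ 2 / 5 by exact: uN.
have := h (N + N)%N (leq_addr _ _); have := h (N + a)%N (leq_addr _ _).
have := h (a + a)%N (leq_trans leNa (leq_addr _ _)).
rewrite !ltr_norml => /andP[a1 a2] /andP[a3 a4] /andP[a5 a6].
by move: a1 a2 a3 a4 a5 a6 e2; move: (e ^+ 2) => d; rewrite mulr2n; lra.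
Qed.

Definition proj_entry i j g : R := lim (y a i j g @[a --> \oo]).

Lemma entry_cvg i j g : y a i j g @[a --> \oo] --> proj_entry i j g.
Proof. exact: entry_is_cvg. Qed.

Definition complexify (w : 'I_m -> G -> R) : l2vec R G m := fun j g => (w j g)%:C%C.

Lemma realify_complexify w c g :
  realify (complexify w) c g = if c.2 then 0 else w c.1 g.
Proof. by []. Qed.

Lemma sq_bounded_complexify w N :
    (forall F : {fset G}, \sum_(j < m) \sum_(g <- F) w j g ^+ 2 <= N) ->
  sq_bounded (realify (complexify w)) N.
Proof.
move=> wN F; apply: le_trans (wN F); rewrite exchange_big le_eqVlt; apply/orP; left.
by rewrite sum_components; apply/eqP/eq_bigr => j _; rewrite /= [X in _ + X]big1 ?addr0 // =>
  g _; rewrite expr0n.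
Qed.

Lemma entry_sq_bounded a i : sq_bounded (realify (complexify (y a i))) M.
Proof.
apply: sq_bounded_complexify => F; apply: le_trans (u_le (a + a)).
by apply: shifted_entry_bound; rewrite ?fset_uniq.
Qed.

Lemma proj_sq_bounded i : sq_bounded (realify (complexify (proj_entry i))) M.
Proof.
apply: sq_bounded_complexify => F.
have lim : \sum_(j < m) \sum_(g <- F) y a i j g ^+ 2 @[a --> \oo] -->
    \sum_(j < m) \sum_(g <- F) proj_entry i j g ^+ 2.
  apply: cvg_big => [|j _]; first exact: add_continuous.
  apply: cvg_big => [|g _]; first exact: add_continuous.
  by rewrite expr2; under eq_fun do rewrite expr2; apply: cvgM; exact: entry_cvg.
apply: (cvgr_to_le lim); apply: nearW => a; apply: le_trans (u_le (a + a)).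
by apply: shifted_entry_bound; rewrite ?fset_uniq.
Qed.

Lemma proj_l2 i : l2 (complexify (proj_entry i)).
Proof. by apply/l2P; exists M; exact: proj_sq_bounded. Qed.

Lemma real_mulmx_entry a i j g :
  real_mulmx A (y a i) j g = (((E ^+ a *m A) i j)@_g)%:~R / K%:R ^+ a.
Proof.
rewrite mxE raddf_sum rmorph_sum mulr_suml; apply: eq_bigr => i' _ /=.
rewrite mcoeff_gr_mul rmorph_sum mulr_suml; apply: eq_bigr => h _ /=.
by rewrite rmorphM /= mulrAC.
Qed.

Lemma u_cvg_comp (f : nat -> nat) : (forall a, (a <= f a)%N) ->
  u (f a) @[a --> \oo] --> l.
Proof.
move=> fa; apply/cvgrPdist_lt => e e0.
have /cvgrPdist_lt/(_ _ e0)[N _ uN] := u_cvg.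
by exists N => // a /= leNa; apply: uN; exact: leq_trans (fa a).
Qed.

(** In the limit, the norm bound on the product of the powers with [A] is
    [K * (l - l)]. *)
Lemma proj_mulmx i j g : real_mulmx A (proj_entry i) j g = 0.
Proof.
have lim : real_mulmx A (y a i) j g @[a --> \oo] --> real_mulmx A (proj_entry i) j g.
  apply: cvg_big => [|i' _]; first exact: add_continuous.
  apply: cvg_big => [|h _]; first exact: add_continuous.
  by apply: cvgMl; exact: entry_cvg.
have lim2 : K%:R * (u (a + a) - u (a + a).+1) @[a --> \oo] --> K%:R * (l - l).
  apply: cvgMr; apply: cvgB; apply: u_cvg_comp => a; first exact: leq_addr.
  exact/leqW/leq_addr.
apply/eqP; rewrite -sqrf_eq0 eq_le sqr_ge0 andbT.
rewrite -[leRHS](mulr0 K%:R) -[in leRHS](subrr l).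
apply: (ler_cvg_to (f := fun a => real_mulmx A (y a i) j g ^+ 2) _ lim2).
  by rewrite expr2; under eq_fun do rewrite expr2; exact: cvgM.
by apply: nearW => a; rewrite real_mulmx_entry; exact: shifted_entry_mulA.
Qed.

Lemma proj_ker i : V (complexify (proj_entry i)).
Proof.
apply/l2_kerP; split=> [|[] j g]; first exact: proj_l2; last exact: proj_mulmx.
by rewrite /real_mulmx big1 // => i' _; rewrite big1 // => h _; rewrite mul0r.
Qed.

(** This is orthogonal to the kernel for every [a], not just in the limit. *)
Definition residual (a : nat) (i : 'I_m) : 'I_m -> G -> R :=
  fun j g => ((j == i) && (g == 1%g))%:R - y a i j g.

Lemma residual_gpair a i (w : 'I_m -> G -> R) :
    (forall j g, real_mulmx A w j g = 0) ->
  exists2 D : {fset G}, (forall j g, g \notin D -> residual a i j g = 0) &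
    \sum_(g <- D) \sum_j residual a i j g * w j g = 0.
Proof.
move=> w0; have [C CE] := shifted_factor A K a.
have resE j g : residual a i j g = (((C *m gr_adj A) i j)@_g)%:~R / K%:R ^+ a.
  have Ka0 : K%:R ^+ a != 0 :> R by rewrite expf_neq0 // pnatr_eq0 -lt0n.
  rewrite -CE !mxE mcoeffB mulmxnE rmorphB mulrBl; congr (_ - _).
  apply: (mulIf Ka0); rewrite divfK // mxE mcoeffMn -natrX mulrC.
  rewrite eq_sym; case: (i == j); rewrite /= ?mcoeff0 ?mul0rn ?mulr0 //.
  rewrite mcoeffU eq_sym; case: (1%g == g).
    by rewrite !mulr1n mulr1 -mulr_natl mulr1 natz pmulrn.
  by rewrite mulr0n mul0rn mulr0.
pose D : {fset G} := (\bigcup_(j <- enum 'I_m) msupp ((C *m gr_adj A) i j))%fset.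
have subD j : (msupp ((C *m gr_adj A) i j) `<=` D)%fset.
  by apply: bigfcup_sup => //; rewrite mem_enum.
exists D => [j g gD|].
  rewrite resE mcoeff_outdom ?mul0r //.
  by apply: contra gD; apply: fsubsetP; exact: subD.
rewrite exchange_big /=; have := gpair_mul_adj A C i w.
rewrite [RHS]big1 => [sum0|j _]; last first.
  by rewrite /gpair big1 // => g _; rewrite w0 mulr0.
have -> : \sum_j \sum_(g <- D) residual a i j g * w j g =
    (K%:R ^+ a)^-1 * \sum_j gpair ((C *m gr_adj A) i j) (w j).
  rewrite mulr_sumr; apply: eq_bigr => j _.
  rewrite (gpairw _ (subD j)) mulr_sumr; apply: eq_bigr => g _.
  by rewrite resE mulrAC mulrC.
by rewrite sum0 mulr0.
Qed.

Lemma residual_cvg i j g : residual a i j g @[a --> \oo] -->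
  ((j == i) && (g == 1%g))%:R - proj_entry i j g.
Proof. by apply: cvgB; [exact: cvg_cst | exact: entry_cvg]. Qed.

Definition basis_entry (i j : 'I_m) (g : G) : R := ((j == i) && (g == 1%g))%:R.

Lemma l2basisE i : l2basis R G i = complexify (basis_entry i).
Proof.
by apply/funext => j; apply/funext => g; rewrite /l2basis /complexify /basis_entry rmorph_nat.
Qed.

Lemma proj_orth i v : V v ->
  l2inner (fun j g => l2basis R G i j g - complexify (proj_entry i) j g) v = 0.
Proof.
set d := fun j g => _; move=> Vv.
have dl2 : l2 d by apply: l2B; [exact: l2_basis | exact: proj_l2].
have re0 v' : V v' -> complex.Re (l2inner d v') = 0.
  move=> /l2_kerP[vl2 v0]; have /l2P[N vN] := vl2.
  have /l2P[B basisB] := l2_basis R G i.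
  apply: has_sum_unique (re_l2inner dl2 vl2) _.
  apply: (weak_limit_orth (da := fun a => realify (complexify (residual a i)))
    (M := 2 * B + 2 * M) _ vN).
  - move=> a; rewrite (_ : realify _ = fun c g =>
      realify (l2basis R G i) c g - realify (complexify (y a i)) c g).
      exact: sq_boundedB basisB (entry_sq_bounded a i).
    by apply/funext => -[j []]; apply/funext => g; rewrite l2basisE !realify_complexify ?subr0.
  - move=> [j b] g; rewrite /d l2basisE.
    case: b; first by rewrite /realify /= subr0; exact: cvg_cst.
    exact: residual_cvg.
  move=> a; have [|D D0 Dsum] := residual_gpair a i (w := fun j => realify v' (j, false)).
    by move=> j g; exact: v0.
  exists D => [[j b] g /D0 res0|]; first by rewrite realify_complexify res0 if_same.
  rewrite -[RHS]Dsum; apply: eq_bigr => g _; rewrite sum_components; apply: eq_bigr => j _.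
  by rewrite !realify_complexify /= mul0r addr0.
apply: l2inner_eq0; apply: re0 => //.
apply/l2_kerP; have /l2_kerP[vl2 v0] := Vv; split; first exact: l2_mul_i.
have iv j b g : realify (fun i g => 'i%C * v i g) (j, b) g =
    if b then realify v (j, false) g else - realify v (j, true) g.
  rewrite /realify /=; case: (v j g) => c e /=.
  by rewrite !mul0r !mul1r sub0r add0r.
move=> b j g; case: b; rewrite -[RHS](v0 false j g).
  by do 2 (apply: eq_bigr => ? _); rewrite iv.
rewrite [RHS]v0 -[RHS]oppr0 -[in RHS](v0 true j g) -sumrN.
by apply: eq_bigr => i' _; rewrite -sumrN; apply: eq_bigr => h _; rewrite iv mulNr.
Qed.

Lemma l2_kerB (x z : l2vec R G m) : V x -> V z -> V (fun i g => x i g - z i g).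
Proof.
move=> /l2_kerP[xl2 x0] /l2_kerP[zl2 z0]; apply/l2_kerP; split; first exact: l2B.
move=> b j g; rewrite -[RHS](subrr 0) -{1}(x0 b j g) -(z0 b j g) -sumrB.
apply: eq_bigr => i _; rewrite -sumrB; apply: eq_bigr => h _; rewrite -mulrBl.
by congr (_ * _); rewrite /realify /=; case: b; case: (x i _); case: (z i _).
Qed.

(** Two orthogonal projections of the same vector differ by an element of the
    kernel that is orthogonal to itself. *)
Lemma orth_proj_ker i : orth_proj V (l2basis R G i) = complexify (proj_entry i).
Proof.
rewrite /orth_proj; set p := complexify _.
have pP : is_orth_proj V (l2basis R G i) p by split; [exact: proj_ker | exact: proj_orth].
apply: xget_unique => // q [Vq q_orth].
have Vz := l2_kerB Vq (proj_ker i); set z := fun _ _ => _ in Vz.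
have /l2_kerP[zl2 _] := Vz.
have [/l2_kerP[ql2 _] /l2_kerP[pl2 _]] : V q /\ V p by split=> //; exact: proj_ker.
have b2 := l2_basis R G i; have bp := l2B b2 pl2; have bq := l2B b2 ql2.
have hs := has_sumD (re_l2inner bp zl2) (has_sumN (re_l2inner bq zl2)).
have zz : complex.Re (l2inner z z) = 0.
  apply: has_sum_unique (re_l2inner zl2 zl2) _.
  move: hs; rewrite (proj_orth i Vz) q_orth // subr0; congr (has_sum _ _).
  apply/funext => g; rewrite -sumrB; apply: eq_bigr => c _; rewrite -mulrBl.
  congr (_ * _); rewrite /realify /z -/p; case: c => j [] /=.
    by case: (l2basis _ _ _ _ _) (p _ _) (q _ _) => ? ? [? ?] [? ?] /=; ring.
  by case: (l2basis _ _ _ _ _) (p _ _) (q _ _) => ? ? [? ?] [? ?] /=; ring.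
have z0 := l2inner_self_eq0 zl2 zz.
apply/funext => j; apply/funext => g; apply/eqP; rewrite -subr_eq0.
by rewrite -[_ - _]/(z j g) z0.
Qed.

Lemma inner_basis i : complex.Re (l2inner (complexify (proj_entry i)) (l2basis R G i)) =
  proj_entry i i 1%g.
Proof.
apply: has_sum_unique (re_l2inner (proj_l2 i) (l2_basis R G i)) _.
rewrite l2basisE; set f := fun _ => _.
have -> : proj_entry i i 1%g = \sum_(g <- [fset 1%g]%fset) f g.
  rewrite big_seq_fset1 /f sum_components (bigD1 i) //= big1 => [|j nj].
    by rewrite !realify_complexify /= /basis_entry !eqxx mulr1 mul0r !addr0.
  by rewrite !realify_complexify /= /basis_entry (negbTE nj) mulr0 mul0r addr0.
apply: has_sum_fset => g; rewrite inE => g1; rewrite /f big1 // => c _.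
by rewrite !realify_complexify /basis_entry (negbTE g1) andbF; case: c.2; rewrite mulr0.
Qed.

(** Each row of the scaled powers converges weakly to the projection of a basis
    vector onto the kernel, and the trace is the sum of the diagonal entries. *)
Theorem l2_betti_shifted_trace : l2_betti R A = l.
Proof.
rewrite /l2_betti /vn_dim Re_sum.
have lim : u a @[a --> \oo] --> \sum_(i < m) proj_entry i i 1%g.
  rewrite (_ : u = fun a => \sum_(i < m) y a i i 1%g).
    by apply: cvg_big => [|i _]; [exact: add_continuous | exact: entry_cvg].
  apply/funext => a; rewrite /shifted_trace /gr_trace rmorph_sum mulr_suml.
  by apply: eq_bigr.
under eq_bigr => i _ do rewrite orth_proj_ker inner_basis.
exact: (cvg_unique _ lim u_cvg).
Qed.

End KernelProjection.

(** * Moments of the spectral measure *)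

Section Moments.
Variables (R : realType) (G : groupType) (m : nat).
Variables (B : 'M[grpalg int G]_m) (mu : {measure set (measurableTypeR R) -> \bar R}).

Lemma gr_complexM p q r (X : 'M[grpalg int G]_(p, q)) (Y : 'M[grpalg int G]_(q, r)) :
  gr_complex R (X *m Y) = gr_complex R X *m gr_complex R Y.
Proof.
apply/matrixP => i j; rewrite !mxE.
rewrite (big_morph _ (gr_mapD (intmul 1)) (gr_map0 G (intmul 1))).
by apply: eq_bigr => l _; rewrite !mxE; exact: (gr_mapM (intmul 1)).
Qed.

Lemma gr_complex1 : gr_complex R 1 = 1 :> 'M[grpalg R[i] G]_m.
Proof.
apply/matrixP => i j; rewrite !mxE; case: (i == j); last exact: (gr_map0 G (intmul 1)).
exact: (gr_mapU (intmul 1)).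
Qed.

Lemma gr_complexX i : gr_complex R (B ^+ i) = gr_complex R B ^+ i.
Proof.
elim: i => [|i IH]; first by rewrite !expr0 gr_complex1.
by rewrite !exprS -IH; exact: gr_complexM.
Qed.

Lemma gr_trace_complex (X : 'M[grpalg int G]_m) :
  gr_trace (gr_complex R X) = (gr_trace X)%:~R.
Proof.
rewrite /gr_trace rmorph_sum; apply: eq_bigr => i _ /=.
by rewrite mxE; exact: (mcoeff_gr_map (intmul 1)).
Qed.

Lemma gr_horner_Xn (D : 'M[grpalg R[i] G]_m) i : gr_horner 'X^i D = D ^+ i.
Proof.
rewrite /gr_horner size_polyXn big_ord_recr /= coefXn eqxx.
rewrite big1 => [|j _]; last first.
  by rewrite coefXn ltn_eqF // /gr_const monalgU0 scale0r.
by rewrite add0r; exact: scale1r.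
Qed.

Hypothesis Bmu : is_spectral_measure (gr_complex R B) mu.

Lemma integrable_poly (p : {poly R}) :
  mu.-integrable [set: R] (EFin \o (fun x => p.[x])).
Proof. by have [_ /(_ p)[]] := Bmu. Qed.

Lemma moment i : \int[mu]_x (x ^+ i) = (gr_trace (B ^+ i))%:~R.
Proof.
have [_ /(_ 'X^i)[_]] := Bmu.
rewrite (map_polyXn (real_complex R)) gr_horner_Xn -gr_complexX gr_trace_complex.
rewrite -(rmorph_int (real_complex R)) => /complexI ->.
by congr Rintegral; apply/funext => x; rewrite hornerXn.
Qed.

(** The factor [x ^+ i] makes the induction on [a] work. *)
Lemma integral_shifted_mul c a i :
  \int[mu]_x ((c%:R - x) ^+ a * x ^+ i) = (gr_trace ((c%:R - B) ^+ a * B ^+ i))%:~R.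
Proof.
elim: a i => [|a IH] i.
  by rewrite expr0 mul1r -moment; under eq_Rintegral do rewrite expr0 mul1r.
have int j : mu.-integrable [set: R] (EFin \o (fun x => (c%:R - x) ^+ a * x ^+ j)).
  have := integrable_poly ((c%:R%:P - 'X) ^+ a * 'X^j); congr (integrable _ _ _).
  by apply/funext => x; rewrite /= !hornerE ?horner_exp ?hornerE.
have intc : mu.-integrable [set: R] (EFin \o (fun x => c%:R * ((c%:R - x) ^+ a * x ^+ i))).
  have := integrable_poly (c%:R%:P * ((c%:R%:P - 'X) ^+ a * 'X^i)); congr (integrable _ _ _).
  by apply/funext => x; rewrite /= !hornerE ?horner_exp ?hornerE.
transitivity (\int[mu]_x (c%:R * ((c%:R - x) ^+ a * x ^+ i) - (c%:R - x) ^+ a * x ^+ i.+1)).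
  by congr Rintegral; apply/funext => x; rewrite exprS [x ^+ i.+1]exprS; ring.
rewrite RintegralB // RintegralZl // !IH.
rewrite [(c%:R - B) ^+ a.+1]exprSr -[_ * (c%:R - B) * _]mulrA mulrBl mulrBr -exprS.
rewrite gr_traceD gr_traceN.
by rewrite [c%:R * B ^+ i]mulr_natl mulrnAr gr_traceMn rmorphB rmorphMn /= mulr_natl.
Qed.

Lemma integral_shifted c a :
  \int[mu]_x ((c%:R - x) ^+ a) = (gr_trace ((c%:R - B) ^+ a))%:~R.
Proof.
have := integral_shifted_mul c a 0; rewrite expr0 mulr1 => <-.
by congr Rintegral; apply/funext => x; rewrite expr0 mulr1.
Qed.

End Moments.

Section SpectralEstimates.
Variables (R : realType) (G : groupType) (m n : nat).
Variables (A : 'M[grpalg int G]_(m, n)) (K : nat).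
Variables (mu : {measure set (measurableTypeR R) -> \bar R}).

Local Notation u := (shifted_trace R A K).
Let D := gr_complex R (A *m gr_adj A).
Let S : set R := `[0, l2_opnorm D].

Hypothesis K2 : (2 <= K)%N.
Hypothesis DK : l2_opnorm D <= K%:R.
Hypothesis Dmu : is_spectral_measure D mu.

Let KR0 : 0 < K%:R :> R. Proof. by rewrite ltr0n (leq_trans _ K2). Qed.

Definition decay (a : nat) (x : R) : R := (1 - x / K%:R) ^+ a.

Lemma decayE a x : decay a x = K%:R ^- a * (K%:R - x) ^+ a.
Proof.
rewrite /decay -exprVn -exprMn; congr (_ ^+ _).
by rewrite mulrBr mulVf ?lt0r_neq0 // mulrC.
Qed.

Lemma integrable_decay a : mu.-integrable [set: R] (EFin \o decay a).
Proof.
have := integrable_poly Dmu ((1 - 'X * (K%:R^-1)%:P) ^+ a); congr (integrable _ _ _).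
by apply/funext => x; rewrite /= !hornerE ?horner_exp ?hornerE.
Qed.

Lemma integral_decay a : (\int[mu]_(x in S) (decay a x)%:E)%E = (u a)%:E.
Proof.
have S0 : mu (~` S) = 0%E by have [] := Dmu.
have mS : measurable (S : set (measurableTypeR R)) by exact: measurable_itv.
have -> : S = [set: R] `\` ~` S by rewrite setTD setCK.
rewrite -negligible_integral //; [|exact: measurableC|exact: integrable_decay].
rewrite -[LHS]fineK; last exact: integrable_fin_num (integrable_decay a).
rewrite -[fine _]/(\int[mu]_x decay a x); congr _%:E.
rewrite (_ : decay a = fun x => K%:R ^- a * (K%:R - x) ^+ a); last first.
  by apply/funext => x; rewrite decayE.
rewrite RintegralZl //; last first.
  have := integrable_poly Dmu ((K%:R%:P - 'X) ^+ a); congr (integrable _ _ _).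
  by apply/funext => x; rewrite /= !hornerE ?horner_exp ?hornerE.
by rewrite (integral_shifted Dmu) mulrC.
Qed.

Lemma decay01 a x : S x -> 0 <= decay a x <= 1.
Proof.
rewrite /S /= in_itv /= => /andP[x0 xD]; have xK : x <= K%:R by exact: le_trans DK.
have t0 : 0 <= 1 - x / K%:R by rewrite subr_ge0 ler_pdivrMr // mul1r.
have t1 : 1 - x / K%:R <= 1 by rewrite gerBl divr_ge0 // ltW.
by rewrite exprn_ge0 //= exprn_ile1.
Qed.

Lemma bernoulli_ge (t : R) a : 0 <= t <= 1 -> 1 - a%:R * t <= (1 - t) ^+ a.
Proof.
move=> /andP[t0 t1]; elim: a => [|a IH]; first by rewrite mul0r subr0 expr0.
rewrite exprS; apply: le_trans (ler_wpM2l _ IH); last by rewrite subr_ge0.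
have : 0 <= a%:R * t ^+ 2 by rewrite mulr_ge0 ?sqr_ge0.
by rewrite -natr1; nra.
Qed.

Lemma bernoulli_le (t : R) a : 0 <= t <= 1 -> (1 - t) ^+ a <= (1 + a%:R * t)^-1.
Proof.
move=> /andP[t0 t1]; rewrite -[leRHS]mul1r ler_pdivlMr; last first.
  by rewrite ltr_pwDl // mulr_ge0.
elim: a => [|a IH]; first by rewrite expr0 mul0r addr0 mulr1.
apply: le_trans IH; rewrite exprSr -mulrA ler_wpM2l ?exprn_ge0 ?subr_ge0 //.
have : 0 <= a%:R * t ^+ 2 by rewrite mulr_ge0 ?sqr_ge0.
by rewrite -natr1; nra.
Qed.

Definition gap (j : nat) : set (measurableTypeR R) := `]0, j%:R^-1[%classic.

Let mS : measurable (S : set (measurableTypeR R)).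
Proof. exact: measurable_itv. Qed.

Lemma measurable_gap j : measurable (gap j).
Proof. exact: measurable_itv. Qed.

Let m0 : measurable ([set 0] : set (measurableTypeR R)).
Proof. exact: measurable_set1. Qed.

Lemma mu_setIS (X : set (measurableTypeR R)) : measurable X -> mu (X `&` S) = mu X.
Proof.
move=> mX; rewrite [RHS](measureDI _ mX mS) [X in (X + _)%E](_ : _ = 0%E) ?add0e //.
apply: (@subset_measure0 _ _ _ mu _ (~` S)).
- exact: measurableD.
- exact: measurableC.
- by move=> x [].
- by have [] := Dmu.
Qed.

Lemma integral_indic_S (X : set (measurableTypeR R)) : measurable X ->
  (\int[mu]_(x in S) (\1_X x)%:E)%E = mu X.
Proof. by move=> mX; rewrite integral_indic // mu_setIS. Qed.

Lemma measurable_indicE (X : set (measurableTypeR R)) : measurable X ->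
  measurable_fun S (fun x => (\1_X x : R)%:E).
Proof. by move=> mX; apply/measurable_EFinP; exact: measurable_indic. Qed.

Lemma measurable_decay a : measurable_fun S (fun x => (decay a x)%:E).
Proof.
by apply: measurable_funS (measurable_int _ (integrable_decay a)).
Qed.

(** On the gap, [(1 - x / K) ^+ j >= 1 - j * (x / K) >= 1 - 1 / K >= 1 / 2]; at 0 the
    value is 1. This is where [K >= 2] matters. *)
Lemma gap_lower j : (0 < j)%N ->
  (mu [set 0%R] + (2^-1)%:E * mu (gap j) <= (u j)%:E)%E.
Proof.
move=> j0; have mgap := measurable_gap j.
rewrite -integral_decay -(integral_indic_S m0) -(integral_indic_S (measurable_gap j)).
have ind0 X x : (0 <= (\1_X x : R)%:E)%E by rewrite lee_fin.
rewrite -ge0_integralZl_EFin //; last exact: measurable_indicE.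
rewrite -ge0_integralD //; first last.
- by apply: emeasurable_funM; [exact: measurable_cst | exact: measurable_indicE].
- exact: measurable_indicE.
apply: ge0_le_integral => //.
- by move=> x _; rewrite adde_ge0 // mule_ge0 // lee_fin.
- apply: emeasurable_funD; first exact: measurable_indicE.
  by apply: emeasurable_funM; [exact: measurable_cst | exact: measurable_indicE].
- exact: measurable_decay.
move=> x Sx; rewrite -EFinM -EFinD lee_fin !indicE.
have [x0|x0] := eqVneq x 0.
  rewrite x0 mem_set //= memNset /gap /= ?in_itv /= ?ltxx //.
  by rewrite mulr0 addr0 /decay mul0r subr0 expr1n.
rewrite (memNset (A := [set 0%R])) /=; last exact/eqP.
rewrite add0r; have [|xj] := boolP (x \in gap j); last first.
  by rewrite mulr0; have /andP[] := decay01 j Sx.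
rewrite inE /gap /= in_itv /= mulr1 => /andP[x_gt0 xj].
have jR : 0 < j%:R :> R by rewrite ltr0n.
have t1 : 0 <= x / K%:R <= 1.
  move: Sx; rewrite /S /= in_itv /= => /andP[_ xD].
  apply/andP; split; first by apply: divr_ge0; exact: ltW.
  by rewrite ler_pdivrMr // mul1r; exact: le_trans DK.
apply: le_trans (bernoulli_ge j t1).
have K2R : 2 <= K%:R :> R by rewrite ler_nat.
have : j%:R * (x / K%:R) <= 2^-1.
  rewrite mulrA ler_pdivrMr // (le_trans (y := 1)) //.
    by rewrite mulrC -ler_pdivlMr // mul1r ltW.
  by rewrite mulrC ler_pdivlMr // mul1r.
by lra.
Qed.

(** The value is at most 1 at 0 and on the gap. Beyond the gap it is at most its
    value at [1 / j], hence at most [(1 + a / (j * K))^-1]. *)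
Lemma gap_upper j a : (0 < j)%N ->
  ((u a)%:E <= mu [set 0%R] + mu (gap j) +
    ((1 + a%:R / (j%:R * K%:R))^-1)%:E * (u 0)%:E)%E.
Proof.
move=> j0; have mgap := measurable_gap j; rewrite -!integral_decay.
rewrite -(integral_indic_S m0) -(integral_indic_S mgap).
have ind0 X x : (0 <= (\1_X x : R)%:E)%E by rewrite lee_fin.
have jR : 0 < j%:R :> R by rewrite ltr0n.
set c := (1 + _)^-1; have c0 : 0 <= c.
  by rewrite invr_ge0 addr_ge0 // divr_ge0 // mulr_ge0.
rewrite -ge0_integralZl_EFin //; last exact: measurable_decay.
have mdecay0 : measurable_fun S (fun x => c%:E * (decay 0 x)%:E)%E.
  by apply: emeasurable_funM; [exact: measurable_cst | exact: measurable_decay].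
have mi := measurable_indicE m0; have mi2 := measurable_indicE (measurable_gap j).
have decay00 x : (0 <= c%:E * (decay 0 x)%:E)%E by rewrite -EFinM lee_fin /decay expr0 mulr1.
rewrite -ge0_integralD // -ge0_integralD //; first last.
- exact: emeasurable_funD.
- by move=> x _; rewrite adde_ge0.
apply: ge0_le_integral => //.
- by move=> x Sx; rewrite lee_fin; have /andP[] := decay01 a Sx.
- exact: measurable_decay.
- by apply: emeasurable_funD => //; exact: emeasurable_funD.
move=> x Sx; rewrite -EFinM -!EFinD lee_fin !indicE /decay expr0 mulr1.
have /andP[_ le1] := decay01 a Sx.
have [x0|x0] := boolP (x \in [set 0%R]).
  by apply: (le_trans le1); rewrite -addrA lerDl addr_ge0.
have [xj|xj] := boolP (x \in gap j).
  by apply: (le_trans le1); rewrite add0r lerDl.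
rewrite !add0r; move: (Sx); rewrite /S /= in_itv /= => /andP[x_ge0 xD].
have x_gt0 : 0 < x by rewrite lt_neqAle x_ge0 andbT eq_sym; apply: contraNneq x0 => ->; rewrite inE.
have xj' : j%:R^-1 <= x.
  by rewrite leNgt; apply: contra xj => lt; rewrite inE /gap /= in_itv /= x_gt0.
pose t : R := (j%:R * K%:R)^-1.
have K2R : 2 <= K%:R :> R by rewrite ler_nat.
have tx : t <= x / K%:R by rewrite /t invfM ler_wpM2r // invr_ge0 ltW.
have x1 : x / K%:R <= 1 by rewrite ler_pdivrMr // mul1r; exact: le_trans DK.
have t0 : 0 <= t by rewrite invr_ge0 mulr_ge0 // ltW.
have t01 : 0 <= t <= 1 by rewrite t0 (le_trans tx).
apply: le_trans (bernoulli_le a t01); apply: lerXn2r; rewrite ?nnegrE ?subr_ge0 //.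
  by case/andP: t01.
by rewrite lerB.
Qed.

End SpectralEstimates.

(** * The spectral gap and the approximation of the Betti number *)

Section SpectralLimit.
Variables (R : realType) (G : groupType) (m n : nat).
Variables (A : 'M[grpalg int G]_(m, n)) (K : nat).
Variables (mu : {measure set (measurableTypeR R) -> \bar R}).

Local Notation u := (shifted_trace R A K).
Let D := gr_complex R (A *m gr_adj A).

Hypothesis K2 : (2 <= K)%N.
Hypothesis DK : l2_opnorm D <= K%:R.
Hypothesis Dmu : is_spectral_measure D mu.

Definition gap_mass (j : nat) : R := fine (mu (gap j)).
Definition atom_mass : R := fine (mu [set 0]).

Lemma mu_fin_num (X : set (measurableTypeR R)) : measurable X -> mu X \is a fin_num.
Proof.
move=> mX; rewrite ge0_fin_numE ?measure_ge0 //.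
apply: (@le_lt_trans _ _ (mu setT)); first by apply: le_measure; rewrite ?inE.
rewrite -(mu_setIS Dmu measurableT) setTI.
rewrite (_ : mu _ = (u 0)%:E) ?ltry // -(integral_decay K2 Dmu 0).
under eq_integral do rewrite /decay expr0.
by rewrite integral_cst ?mul1e //; exact: measurable_itv.
Qed.

Lemma gap_massE j : mu (gap j) = (gap_mass j)%:E.
Proof. by rewrite fineK // mu_fin_num //; exact: measurable_gap. Qed.

Lemma atom_massE : mu [set 0] = atom_mass%:E.
Proof. by rewrite fineK // mu_fin_num. Qed.

Lemma gap_mass_ge0 j : 0 <= gap_mass j.
Proof. exact/fine_ge0/measure_ge0. Qed.

Lemma gap_mass_le j : (0 < j)%N -> gap_mass j <= 2 * (u j - atom_mass).
Proof.
move=> j0; have := gap_lower K2 DK Dmu j0.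
by rewrite atom_massE gap_massE -EFinM -EFinD lee_fin; lra.
Qed.

Lemma trace0_ge0 : 0 <= u 0.
Proof.
have := gr_trace_adj_ge0 (1%:M : 'M[grpalg int G]_m).
rewrite [gr_adj _]gr_adj1 mul1mx => tr1.
by rewrite /shifted_trace !expr0 divr1 ler0z.
Qed.

Lemma trace_upper j a (c : R) : (0 < j)%N -> 0 < c -> c <= 1 + a%:R / (j%:R * K%:R) ->
  u a <= atom_mass + gap_mass j + u 0 * c^-1.
Proof.
move=> j0 c0 cle; have := gap_upper K2 DK Dmu a j0.
rewrite atom_massE gap_massE -EFinM -!EFinD lee_fin => /le_trans; apply.
rewrite lerD2l mulrC ler_wpM2l ?trace0_ge0 // lef_pV2 ?posrE //.
Qed.

(** From the exponent [j * j * K] on, the part of the spectrum beyond [1 / j]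
    contributes at most [1 / j] times the total mass. *)
Lemma trace_le_gap j a : (0 < j)%N -> (j * j * K <= a)%N ->
  u a <= atom_mass + gap_mass j + u 0 * j%:R^-1.
Proof.
move=> j0 ja; apply: trace_upper; rewrite ?ltr0n //.
rewrite -[leLHS]add0r lerD // ler_pdivlMr -!natrM ?ltr0n ?ler_nat; nia.
Qed.

Lemma gap_mass_cvg : gap_mass j.+1 @[j --> \oo] --> 0.
Proof.
have gap0 : \bigcap_j gap j.+1 = set0 :> set (measurableTypeR R).
  apply/seteqP; split=> // x xgap; have := xgap 0%N I.
  rewrite /gap /= in_itv /= => /andP[x0 _].
  have [j _] := near_infty_natSinv_lt (PosNum x0) => /(_ j (leqnn _)) /= lt.
  by have := xgap j I; rewrite /gap /= in_itv /= => /andP[_ /(lt_trans lt)]; rewrite ltxx.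
have cvg : (mu \o (fun j => gap j.+1)) j @[j --> \oo] --> mu (\bigcap_j gap j.+1).
  apply: nonincreasing_cvg_mu => [|j||].
  - by rewrite gap_massE ltry.
  - exact: measurable_gap.
  - by rewrite gap0; exact: measurable0.
  move=> i j leij; apply/subsetPset => x; rewrite /gap /= !in_itv /= => /andP[-> /=].
  by move/lt_le_trans; apply; rewrite lef_pV2 ?posrE ?ltr0n // ler_nat.
by move: cvg; rewrite gap0 measure0 => /fine_cvg.
Qed.

Lemma trace_cvg : u @ \oo --> atom_mass.
Proof.
have lim : gap_mass j.+1 + u 0 * j.+1%:R^-1 @[j --> \oo] --> (0 : R).
  rewrite [X in _ --> X](_ : 0 = 0 + u 0 * 0); last by rewrite mulr0 addr0.
  apply: cvgD; first exact: gap_mass_cvg.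
  apply: cvgMr; exact: cvg_harmonic.
apply/cvgrPdist_le => e e0.
have /cvgrPdist_le/(_ _ e0)[j _ /(_ j (leqnn _))] := lim.
rewrite /= sub0r normrN => le_e; exists (j.+1 * j.+1 * K)%N => // a /= ja.
have a0 : (0 < a)%N by nia.
have lower : atom_mass <= u a by have := gap_mass_le a0; have := gap_mass_ge0 a; lra.
have h1 := le_trans (ler_norm _) le_e; have h2 := trace_le_gap (ltn0Sn j) ja.
by rewrite distrC ger0_norm ?subr_ge0 // lerBlDl (le_trans h2) // -addrA lerD2l.
Qed.

Lemma l2_betti_atom : l2_betti R A = atom_mass.
Proof.
apply: (@l2_betti_shifted_trace R G m n A K atom_mass (atom_mass + gap_mass 1 + u 0 * 1^-1)).
- by nia.
- exact: trace_cvg.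
by move=> a; apply: trace_upper; rewrite // lerDl divr_ge0 // mulr_ge0.
Qed.

End SpectralLimit.

(** * Computable bounds for the Betti number *)

Lemma degree_rat_computable g q (a : set (nat -> nat)) :
  a g -> rat_computable g q -> rat_seq_degree_at_most a q.
Proof. by move=> ag cq; exists g => //; apply/turing_leP. Qed.

Section Equivalence.
Variables (R : realType) (G : groupType) (k : nat) (s : 'I_k -> G).
Variables (m n : nat) (A : 'M[grpalg int G]_(m, n)) (K : nat).
Variables (mu : {measure set (measurableTypeR R) -> \bar R}).
Hypothesis gen : generates s.
Hypothesis K2 : (2 <= K)%N.
Hypothesis DK : l2_opnorm (gr_complex R (A *m gr_adj A)) <= K%:R.
Hypothesis Dmu : is_spectral_measure (gr_complex R (A *m gr_adj A)) mu.

Let a := turing_degree (word_problem s).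

Local Notation r := (l2_betti R A).
Local Notation u := (shifted_trace R A K).

Definition shifted_trace_rat (i : nat) : rat :=
  (gr_trace (shifted A K ^+ i))%:~R * (K ^ i)%:R^-1.

Lemma shifted_trace_ratE i : ratr (shifted_trace_rat i) = u i.
Proof. by rewrite rmorphM /= fmorphV /= ratr_int ratr_nat natrX. Qed.

(** The oracle that computes the given sequence has degree [a], so it computes
    the word problem as well: all three directions work relative to it. *)
Lemma degreeE q : rat_seq_degree_at_most a q ->
  exists g, [/\ a g, rat_computable g q & rat_computable g shifted_trace_rat].
Proof.
move=> [g ag /turing_leP cq]; exists g; split=> //.
have cwp : computable g (word_problem s) by apply/turing_leP; case: ag.
apply: rat_computable_mul; first exact: rat_computable_trace_expr cwp.
apply: rat_computable_invn; last by move=> i; rewrite expn_gt0 (leq_trans _ K2).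
exact: computable_exp (computable_const _ _) (computable_id g).
Qed.

Lemma betti_le_trace i : (0 < i)%N -> r <= u i.
Proof.
move=> i0; have := gap_mass_le K2 DK Dmu i0; have := gap_mass_ge0 mu i.
by rewrite (l2_betti_atom K2 DK Dmu); lra.
Qed.

Lemma trace_cvg_betti : u @ \oo --> r.
Proof. by rewrite (l2_betti_atom K2 DK Dmu); exact: trace_cvg. Qed.

Lemma rat_computable_pow2 g : rat_computable g (fun i => (2 ^ i)%N%:R^-1).
Proof.
apply: rat_computable_invn => [|i]; last by rewrite expn_gt0.
exact: computable_exp (computable_const _ _) (computable_id g).
Qed.

Lemma ratr_pow2 i : ratr ((2 ^ i)%N%:R^-1) = 2 ^- i :> R.
Proof. by rewrite fmorphV /= ratr_nat natrX. Qed.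

Lemma pow2_cvg : 2 ^- i @[i --> \oo] --> (0 : R).
Proof.
rewrite (_ : (fun i => 2 ^- i) = (fun i => 2^-1 ^+ i)).
  by apply: cvg_expr; rewrite ger0_norm ?invr_ge0 // invf_lt1 // ltr1n.
by apply/funext => i; rewrite exprVn.
Qed.

(** The upper bounds [u i] and the given lower bounds meet, so that a search
    finds a lower bound with small error. *)
Lemma left_computable_computable : left_computable_real a r -> computable_real a r.
Proof.
move=> [q /degreeE[g [ag cq cu]] [q_cvg q_le]].
pose P (b i : nat) := shifted_trace_rat i.+1 - q i.+1 - (2 ^ b)%N%:R^-1 <= 0.
have meets b : exists i, P b i.
  have lim : u i.+1 - ratr (q i.+1) @[i --> \oo] --> (0 : R).
    rewrite [X in _ --> X](_ : 0 = r - r); last by rewrite subrr.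
    apply: cvgB; first by have := trace_cvg_betti; rewrite -cvg_shiftS.
    by move: q_cvg; rewrite -cvg_shiftS.
  have e0 : 0 < 2 ^- b :> R by rewrite invr_gt0 exprn_gt0.
  have /cvgrPdist_le/(_ _ e0)[i _ /(_ i (leqnn _)) /= le_e] := lim.
  exists i; rewrite /P -(ler_rat R) !rmorphB /= shifted_trace_ratE ratr_pow2 rmorph0 subr_le0.
  by apply: le_trans le_e; rewrite sub0r normrN ler_norm.
pose f b := ex_minn (meets b).
have cf : computable g f.
  apply: (computable_mu (P := P)) => [|b]; last first.
    rewrite /f; case: ex_minnP => i Pi mini; split=> // j ltj.
    by apply/negP => /mini; rewrite leqNgt ltj.
  have ch := computable_hd g; have ct := computable_succ (computable_tl g).
  apply: computable_rat_le0; apply: rat_computable_sub.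
    apply: rat_computable_sub; first exact: rat_computable_comp cu ct.
    exact: rat_computable_comp cq ct.
  exact: rat_computable_comp (rat_computable_pow2 g) ch.
exists (fun b => q (f b).+1).
  by apply: (degree_rat_computable ag); exact: rat_computable_comp cq (computable_succ cf).
move=> b; rewrite ger0_norm ?subr_ge0 //.
rewrite /f; case: ex_minnP => i Pi _; move: Pi.
rewrite /P -(ler_rat R) !rmorphB /= shifted_trace_ratE ratr_pow2 rmorph0.
by have := betti_le_trace (ltn0Sn i); lra.
Qed.

(** The mass of the gap is at most twice [u j - r], and [r] is known up to
    [2 ^- j]. *)
Lemma computable_gap : computable_real a r ->
  exists2 eps : nat -> rat, rat_seq_degree_at_most a eps &
    ((fun j => ratr (eps j) : R) @ \oo --> (0 : R)) /\
    (forall j : nat, (0 < j)%N ->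
       (mu `]0%R, (j%:R^-1 : R)%R[%classic <= (ratr (eps j))%:E)%E).
Proof.
move=> [q /degreeE[g [ag cq cu]] q_near].
pose eps i := 2%:R * (shifted_trace_rat i - (q i - (2 ^ i)%N%:R^-1)).
have epsE i : ratr (eps i) = 2 * (u i - (ratr (q i) - 2 ^- i)) :> R.
  by rewrite rmorphM !rmorphB /= ratr_nat shifted_trace_ratE ratr_pow2.
exists eps.
  apply: (degree_rat_computable ag); apply: rat_computable_mul.
    exact: rat_computable_nat (computable_const g 2).
  apply: rat_computable_sub => //; apply: rat_computable_sub => //.
  exact: rat_computable_pow2.
split=> [|j j0]; last first.
  rewrite -/(gap j) (gap_massE K2 Dmu) lee_fin epsE.
  apply: le_trans (gap_mass_le K2 DK Dmu j0) _.
  have := q_near j; rewrite ler_norml => /andP[h1 h2].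
  by rewrite -(l2_betti_atom K2 DK Dmu); lra.
have q_cvg : ratr (q i) @[i --> \oo] --> r.
  apply/cvgrPdist_le => e e0.
  have /cvgrPdist_le/(_ _ e0)[N _ hN] := pow2_cvg.
  exists N => // i /hN; rewrite sub0r normrN ger0_norm ?invr_ge0 ?exprn_ge0 //.
  exact: le_trans (q_near i).
have lim : 2 * (u i - (ratr (q i) - 2 ^- i)) @[i --> \oo] --> 2 * (r - (r - 0)).
  by apply: cvgMr; apply: cvgB; [exact: trace_cvg_betti | apply: cvgB => //; exact: pow2_cvg].
by rewrite (funext epsE); move: lim; rewrite subr0 subrr mulr0.
Qed.

(** If the mass of the gap is controlled, then the traces with exponents
    [j * j * K] become lower bounds once the control and the contribution
    [u 0 / j] of the spectrum beyond the gap are subtracted. *)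
Lemma gap_left_computable :
    (exists2 eps : nat -> rat, rat_seq_degree_at_most a eps &
      ((fun j => ratr (eps j) : R) @ \oo --> (0 : R)) /\
      (forall j : nat, (0 < j)%N ->
         (mu `]0%R, (j%:R^-1 : R)%R[%classic <= (ratr (eps j))%:E)%E)) ->
  left_computable_real a r.
Proof.
move=> [eps /degreeE[g [ag ceps cu]] [eps_cvg eps_gap]].
pose f i := (i.+1 * i.+1 * K)%N.
pose q i := shifted_trace_rat (f i) - eps i.+1 - shifted_trace_rat 0 * i.+1%:R^-1.
have qE i : ratr (q i) = u (f i) - ratr (eps i.+1) - u 0 * i.+1%:R^-1.
  by rewrite !rmorphB /= shifted_trace_ratE rmorphM /= fmorphV /= ratr_nat shifted_trace_ratE.
exists q.
  apply: (degree_rat_computable ag).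
  have cS := computable_succ (computable_id g).
  apply: rat_computable_sub.
    apply: rat_computable_sub; last exact: rat_computable_comp ceps cS.
    apply: rat_computable_comp cu _; apply: computable_mul (computable_const _ _).
    exact: computable_mul.
  apply: rat_computable_mul; last exact: rat_computable_invn.
  exact: rat_computable_comp cu (computable_const _ _).
split=> [|i]; last first.
  have fi : (i.+1 * i.+1 * K <= f i)%N by [].
  have le1 := trace_le_gap K2 DK Dmu (ltn0Sn i) fi.
  have := eps_gap i.+1 isT; rewrite -/(gap i.+1) (gap_massE K2 Dmu) lee_fin => le2.
  rewrite qE (l2_betti_atom K2 DK Dmu) !lerBlDr; apply: (le_trans le1).
  by rewrite [leRHS]addrAC lerD2r lerD2l.
rewrite (funext qE).
suff : u (f i) - ratr (eps i.+1) - u 0 * i.+1%:R^-1 @[i --> \oo] --> r - 0 - u 0 * 0.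
  by rewrite mulr0 !subr0.
apply: cvgB; last by apply: cvgMr; exact: cvg_harmonic.
apply: cvgB; last by move: eps_cvg; rewrite -cvg_shiftS.
apply/cvgrPdist_le => e e0; have /cvgrPdist_le/(_ _ e0)[N _ hN] := trace_cvg_betti.
by exists N => // i /= leNi; apply: hN; rewrite /= /f; nia.
Qed.

End Equivalence.

Theorem theorem4p5 (R : realType) (G : groupType)
  (k : nat) (s : 'I_k -> G) (hs : generates s)
  (a : set (nat -> nat)) (ha : a = turing_degree (word_problem s))
  (m n : nat) (A : 'M[grpalg int G]_(m, n))
  (mu : {measure set (measurableTypeR R) -> \bar R})
  (hmu : is_spectral_measure (gr_complex R (A *m gr_adj A)) mu) :
  [<-> left_computable_real a (l2_betti R A);
       computable_real a (l2_betti R A);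
       exists2 eps : nat -> rat, rat_seq_degree_at_most a eps &
         ((fun j => ratr (eps j) : R) @ \oo --> (0 : R)) /\
         (forall j : nat, (0 < j)%N ->
            (mu `]0%R, (j%:R^-1 : R)%R[%classic <= (ratr (eps j))%:E)%E)].
Proof.
have [K K2 DK] : exists2 K : nat, (2 <= K)%N &
    l2_opnorm (gr_complex R (A *m gr_adj A)) <= K%:R.
  set x := l2_opnorm _; exists (maxn 2 (Num.bound `|x|)); first exact: leq_maxl.
  apply: le_trans (ler_norm x) _; apply: le_trans (ltW (archi_boundP (normr_ge0 x))) _.
  by rewrite ler_nat leq_maxr.
rewrite ha; tfae.
- exact: (left_computable_computable hs K2 DK hmu).
- exact: (computable_gap hs K2 DK hmu).
- exact: (gap_left_computable hs K2 DK hmu).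
Qed.
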